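(* Let $U$ be a left bialgebroid over $A$ and let $N$ be a braided commutative Yetter-Drinfel'd algebra over $U$. Then $C^\bullet(U,N):=\mathrm{Hom}_{A^{\mathrm{op}}}\big((U^{\otimes_{A^{\mathrm{op}}}\bullet})_\triangleleft,N\big)$, with the operations $\circ_i$, the multiplication $\mu$, the identity $\mathbb 1$ and the element $e$ specified in the context, is an operad with multiplication. Hence the cohomology $H^\bullet(U,N):=H(C^\bullet(U,N),\delta)$ carries the structure of a Gerstenhaber algebra (with the cup product and bracket induced by this operad with multiplication).
   Context: **Bialgebroids.** $k$ is a commutative ring, unadorned tensor products are over $k$, algebras are unital associative. Let $A,U$ be $k$-algebras with a $k$-algebra map $\eta:A\otimes A^{\mathrm{op}}\to U$; put $s(a)=\eta(a\otimes1)$, $t(a)=\eta(1\otimes a)$. A left $U$-module $N$ is an $A$-bimodule via $a\triangleright n\triangleleft b:=s(a)t(b)n$, a right $U$-module $M$ via $a\blacktriangleright m\blacktriangleleft b:=m\,t(a)s(b)$; both apply to $U$. $U\otimes_A U:=U_\triangleleft\otimes_A{}_\triangleright U$ (so $t(a)u\otimes v=u\otimes s(a)v$) and $U\otimes_{A^{\mathrm{op}}}U:={}_\blacktriangleright U\otimes_{A^{\mathrm{op}}}U_\triangleleft$ (so $ut(a)\otimes v=u\otimes t(a)v$). $U$ is a left bialgebroid over $A$ if it carries $A$-bimodule maps (for $\triangleright,\triangleleft$) $\Delta:U\to U\otimes_AU$, $u\mapsto u_{(1)}\otimes_Au_{(2)}$, and $\varepsilon:U\to A$ making it a coassociative counital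 coalgebra in $A$-bimodules, such that $\Delta$ takes values in $U\times_AU=\{\sum u_i\otimes_Av_i:\ \sum u_it(a)\otimes_A v_i=\sum u_i\otimes_A v_is(a)\ \forall a\in A\}$ and is a unital algebra map into it, $\varepsilon(1)=1$, and $\varepsilon(uv)=\varepsilon(us(\varepsilon(v)))=\varepsilon(ut(\varepsilon(v)))$. **Yetter-Drinfel'd algebras.** A left $U$-comodule is a left $A$-module $N$ with a coassociative counital left $A$-linear map $\Delta_N:N\to U_\triangleleft\otimes_AN$, $n\mapsto n_{(-1)}\otimes_An_{(0)}$; it has the induced right $A$-action $na:=\varepsilon(n_{(-1)}t(a))n_{(0)}$. A Yetter-Drinfel'd module is a left $U$-module and left $U$-comodule $N$ whose two $A$-bimodule structures coincide and with $(u_{(1)}n)_{(-1)}u_{(2)}\otimes_A(u_{(1)}n)_{(0)}=u_{(1)}n_{(-1)}\otimes_Au_{(2)}n_{(0)}$. A Yetter-Drinfel'd algebra is such an $N$ that is also an $A$-ring (monoid in $A$-bimodules, product $\cdot_N$, unit $1_N$) with $u(n\cdot_Nn')=(u_{(1)}n)\cdot_N(u_{(2)}n')$, $u1_N=\varepsilon(u)\triangleright1_N=1_N\triangleleft\varepsilon(u)$, $\Delta_N(1_N)=1_U\otimes_A1_N$ and $\Delta_N(n\cdot_Nn')=n_{(-1)}n'_{(-1)}\otimes_An_{(0)}\cdot_Nn'_{(0)}$. It is braided commutative if $n\cdot_Nn'=(n_{(-1)}n')\cdot_Nn_{(0)}$ for all $n,n'\in N$. **Operads.** An operad is a sequence of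 $k$-modules $O(n)$, $n\ge0$, with $\mathbb 1\in O(1)$ and $k$-bilinear $\circ_i:O(p)\otimes O(q)\to O(p+q-1)$ such that, for $\varphi\in O(p),\psi\in O(q),\chi\in O(r)$: $\varphi\circ_i\psi=0$ if $p<i$ or $p=0$; $(\varphi\circ_i\psi)\circ_j\chi$ equals $(\varphi\circ_j\chi)\circ_{i+r-1}\psi$ if $j<i$, $\varphi\circ_i(\psi\circ_{j-i+1}\chi)$ if $i\le j<q+i$, and $(\varphi\circ_{j-q+1}\chi)\circ_i\psi$ if $j\ge q+i$; and $\varphi\circ_i\mathbb 1=\varphi$ for $i\le p$, $\mathbb 1\circ_1\varphi=\varphi$. It is an operad with multiplication if there are $\mu\in O(2)$, $e\in O(0)$ with $\mu\circ_1\mu=\mu\circ_2\mu$ and $\mu\circ_1e=\mu\circ_2e=\mathbb 1$. With $|n|:=n-1$ put $\varphi\bar\circ\psi=(-1)^{|p||q|}\sum_{i=1}^p(-1)^{|q||i|}\varphi\circ_i\psi$, $\{\varphi,\psi\}=\varphi\bar\circ\psi-(-1)^{|p||q|}\psi\bar\circ\varphi$, $\varphi\smile\psi=(\mu\circ_1\varphi)\circ_{p+1}\psi$, $\delta\varphi=\{\mu,\varphi\}$; the cup product and bracket descend to $\delta$-cohomology. **Gerstenhaber algebra.** A graded commutative $k$-algebra $V=\bigoplus_{p\ge0}V^p$ ($\alpha\smile\beta=(-1)^{pq}\beta\smile\alpha$) with a graded Lie bracket $V^{p+1}\otimes V^{q+1}\to V^{p+q+1}$ on the desuspension $V[1]=\bigoplus_pV^{p+1}$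 satisfying $\{\gamma,\alpha\smile\beta\}=\{\gamma,\alpha\}\smile\beta+(-1)^{pq}\alpha\smile\{\gamma,\beta\}$ for $\gamma\in V^{p+1},\alpha\in V^q$. **The structure on $C^\bullet(U,N)$.** $C^p(U,N)$ consists of $k$-linear $\varphi:U^{\otimes_{A^{\mathrm{op}}}p}\to N$ with $\varphi(t(a)u^1,u^2,\dots,u^p)=\varphi(u^1,\dots,u^p)\triangleleft a$; $C^0(U,N)=N$. For $\psi\in C^q(U,N)$ write $$D_\psi(u^1,\dots,u^q)_{(-1)}\otimes_AD_\psi(u^1,\dots,u^q)_{(0)}:=\psi(u^1_{(1)},\dots,u^q_{(1)})_{(-1)}u^1_{(2)}\cdots u^q_{(2)}\otimes_A\psi(u^1_{(1)},\dots,u^q_{(1)})_{(0)},$$ (for $q=0$ this is $\Delta_N$ of the element $\psi\in N$). For $i=1,\dots,p$, $$(\varphi\circ_i\psi)(u^1,\dots,u^{p+q-1}):=\varphi\big(u^1_{(1)},\dots,u^{i-1}_{(1)},D_\psi(u^i,\dots,u^{i+q-1})_{(-1)},u^{i+q},\dots,u^{p+q-1}\big)\cdot_N\big(u^1_{(2)}\cdots u^{i-1}_{(2)}D_\psi(u^i,\dots,u^{i+q-1})_{(0)}\big),$$ and $n\circ_i\psi=0$ for $n\in C^0(U,N)$. Further $\mu(u,v)=\varepsilon(uv)\triangleright1_N$, $\mathbb 1(u)=\varepsilon(u)\triangleright1_N$, $e=1_N$. The differential is $$\delta\varphi(u^1,\dots,u^{p+1})=u^1\varphi(u^2,\dots,u^{p+1})+\sum_{i=1}^p(-1)^i\varphi(u^1,\dots,u^iu^{i+1},\dots,u^{p+1})+(-1)^{p+1}\varphi(u^1,\dots,\varepsilon(u^{p+1})\blacktriangleright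 u^p),$$ with $\delta n(u)=un-n\triangleleft\varepsilon(u)$ for $p=0$; it equals $\{\mu,\varphi\}$. *)

(* Defs.v *)
From HB Require Import structures.
From mathcomp Require Import all_boot all_algebra ring_quotient generic_quotient.
From mathcomp Require Import boolp functions monalg.

Set Implicit Arguments.
Unset Strict Implicit.
Unset Printing Implicit Defensive.

Import GRing.Theory.
Local Open Scope ring_scope.
Local Open Scope quotient_scope.

Section QuotientModule.
Variables (k : comNzRingType) (V : lmodType k) (P : V -> Prop).

(* Membership in the smallest submodule of V containing P. *)
Definition in_span : {pred V} := fun x => `[<
  forall S : V -> Prop, S 0 ->
    (forall (c : k) u v, S u -> S v -> S (c *: u + v)) ->
    (forall r, P r -> S r) -> S x >].

Lemma in_span_submod : submod_closed in_span.
Proof.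
split=> [|c u v /asboolP Su /asboolP Sv]; apply/asboolP => S S0 SL SP //.
by apply: (SL); [exact: Su | exact: Sv].
Qed.
HB.instance Definition _ := GRing.isSubmodClosed.Build k V in_span in_span_submod.

Definition quotmod := {ideal_quot (in_span : zmodClosed V)}.
HB.instance Definition _ := GRing.Zmodule.on quotmod.

Definition qclass (x : V) : quotmod := \pi_({ideal_quot (in_span : zmodClosed V)}) x.

Lemma qclassP x y : qclass x = qclass y <-> x - y \in in_span.
Proof.
rewrite (@Quotient.idealrBE V (in_span : zmodClosed V)).
by split=> [/eqP|/eqP].
Qed.

Lemma qclassK (q : quotmod) : qclass (repr q) = q.
Proof. exact: reprK. Qed.

Lemma qclassD : {morph qclass : x y / x + y}.
Proof. by move=> x y; rewrite /qclass !piE. Qed.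

Definition qscale (c : k) (q : quotmod) : quotmod := qclass (c *: repr q).

Lemma qscaleE c x : qscale c (qclass x) = qclass (c *: x).
Proof.
by apply/qclassP; rewrite -scalerBr; apply: rpredZ; apply/qclassP; exact: qclassK.
Qed.

Lemma qscaleA a b q : qscale a (qscale b q) = qscale (a * b) q.
Proof. by rewrite -(qclassK q) !qscaleE scalerA. Qed.
Lemma qscale1 : left_id 1 qscale.
Proof. by move=> q; rewrite -(qclassK q) qscaleE scale1r. Qed.
Lemma qscaleDr : right_distributive qscale +%R.
Proof.
move=> c p q; rewrite -(qclassK q) -(qclassK p).
by rewrite -qclassD !qscaleE -qclassD scalerDr.
Qed.
Lemma qscaleDl q : {morph qscale^~ q : a b / a + b}.
Proof. by move=> a b; rewrite -(qclassK q) !qscaleE -qclassD scalerDl. Qed.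

HB.instance Definition _ := GRing.Zmodule_isLmodule.Build k quotmod
  qscaleA qscale1 qscaleDr qscaleDl.

Lemma qclass_linear : linear qclass.
Proof. by move=> c x y; rewrite qclassD -qscaleE. Qed.
HB.instance Definition _ := GRing.isLinear.Build k V quotmod _ qclass qclass_linear.

End QuotientModule.

(* The k-module generated by T subject to the relations r = 0 for rel r. *)
Definition presented (k : comNzRingType) (T : choiceType)
  (rel : {malg k[T]} -> Prop) : lmodType k := quotmod rel.

Definition pgen (k : comNzRingType) (T : choiceType) (rel : {malg k[T]} -> Prop)
  (x : T) : presented rel := qclass rel (<< x >> : {malg k[T]}).

Section Tensor.
Variables (k : comNzRingType) (B : Type) (M N : lmodType k).
Variables (actM : M -> B -> M) (actN : B -> N -> N).

Let g (x : M) (y : N) : {malg k[(M * N)%type]} := << (x, y) >>.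

Inductive tensor_rel : {malg k[(M * N)%type]} -> Prop :=
| TensorAddL x x' y : tensor_rel (g (x + x') y - g x y - g x' y)
| TensorAddR x y y' : tensor_rel (g x (y + y') - g x y - g x y')
| TensorScaleL c x y : tensor_rel (g (c *: x) y - c *: g x y)
| TensorScaleR c x y : tensor_rel (g x (c *: y) - c *: g x y)
| TensorBalanced x b y : tensor_rel (g (actM x b) y - g x (actN b y)).

Definition tensor : lmodType k := presented tensor_rel.
Definition tpure (x : M) (y : N) : tensor := pgen tensor_rel (x, y).

(* R x is a representative of f x, so that sums over R x are Sweedler sums. Such
   an R always exists (sweedler_exists below). *)
Definition sweedler (X : Type) (f : X -> tensor) (R : X -> seq (M * N)) : Prop :=
  forall x, f x = \sum_(y <- R x) tpure y.1 y.2.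

Lemma tpureZl c x y : tpure (c *: x) y = c *: tpure x y.
Proof.
rewrite /tpure /pgen -linearZ; apply/qclassP/asboolP.
by move=> S _ _; apply; exact: TensorScaleL.
Qed.

Lemma sweedler_exists (X : Type) (f : X -> tensor) : exists R, sweedler f R.
Proof.
suff /choice[R hR] : forall x, exists l : seq (M * N),
  f x = \sum_(y <- l) tpure y.1 y.2 by exists R.
move=> x; rewrite -[f x]qclassK [repr _]monalgE.
elim/big_rec: _ => [|p z _ [l hl]]; first by exists [::]; rewrite big_nil linear0.
exists (((repr (f x))@_p *: p.1, p.2) :: l).
rewrite big_cons -hl /= linearD tpureZl; congr (_ + _).
rewrite /tpure /pgen -linearZ -surjective_pairing; congr (qclass _ _).
by apply/malgP=> i; rewrite malgZ_def fgscaleE !mcoeffU mulrnAr mulr1.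
Qed.

End Tensor.

Section Tensor3.
Variables (k : comNzRingType) (B : Type) (M N P : lmodType k).
Variables (actM : M -> B -> M) (lactN : B -> N -> N).
Variables (ractN : N -> B -> N) (actP : B -> P -> P).

Let g (x : M) (y : N) (z : P) : {malg k[(M * N * P)%type]} := << (x, y, z) >>.

Inductive tensor3_rel : {malg k[(M * N * P)%type]} -> Prop :=
| Tensor3Add1 x x' y z : tensor3_rel (g (x + x') y z - g x y z - g x' y z)
| Tensor3Add2 x y y' z : tensor3_rel (g x (y + y') z - g x y z - g x y' z)
| Tensor3Add3 x y z z' : tensor3_rel (g x y (z + z') - g x y z - g x y z')
| Tensor3Scale1 c x y z : tensor3_rel (g (c *: x) y z - c *: g x y z)
| Tensor3Scale2 c x y z : tensor3_rel (g x (c *: y) z - c *: g x y z)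
| Tensor3Scale3 c x y z : tensor3_rel (g x y (c *: z) - c *: g x y z)
| Tensor3Balanced12 x b y z :
    tensor3_rel (g (actM x b) y z - g x (lactN b y) z)
| Tensor3Balanced23 x y b z :
    tensor3_rel (g x (ractN y b) z - g x y (actP b z)).

Definition tensor3 : lmodType k := presented tensor3_rel.
Definition tpure3 (x : M) (y : N) (z : P) : tensor3 :=
  pgen tensor3_rel (x, y, z).

End Tensor3.

Definition ktensor (k : comNzRingType) (M N : lmodType k) : lmodType k :=
  tensor (fun (x : M) (c : k) => c *: x) (fun (c : k) (y : N) => c *: y).
Definition ktpure (k : comNzRingType) (M N : lmodType k) (x : M) (y : N) :
  ktensor M N := tpure _ _ x y.

Section Bialgebroid.
Variables (k : comNzRingType) (A U : algType k).

(* A k-algebra map eta : A (x) A^op -> U. The product of A (x) A^op is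
   (a (x) b)(a' (x) b') = aa' (x) b'b. *)
Record base_map := BaseMap {
  eta :> {linear ktensor A A -> U};
  eta1 : eta (ktpure 1 1) = 1;
  etaM : forall a b a' b' : A,
    eta (ktpure (a * a') (b' * b)) = eta (ktpure a b) * eta (ktpure a' b')
}.

Section Actions.
Variable e : base_map.

Definition src (a : A) : U := e (ktpure a 1).
Definition tgt (a : A) : U := e (ktpure 1 a).

(* a |> u and u <| a *)
Definition lact (a : A) (u : U) : U := src a * u.
Definition ract (u : U) (a : A) : U := tgt a * u.

Definition tensUU : lmodType k := tensor ract lact.
Definition tensUUU : lmodType k := tensor3 ract lact ract lact.
Definition tUU : U -> U -> tensUU := tpure ract lact.
Definition tUUU : U -> U -> U -> tensUUU := tpure3 ract lact ract lact.

End Actions.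

(* Each identity written with a Sweedler representation R of Delta is required
   for every such R. *)
Record left_bialgebroid := LeftBialgebroid {
  beta :> base_map;
  Delta : {linear U -> tensUU beta};
  counit : {linear U -> A};
  DeltaLR : forall R, sweedler Delta R -> forall (a b : A) (u : U),
    Delta (src beta a * tgt beta b * u) =
    \sum_(x <- R u) tUU beta (src beta a * x.1) (tgt beta b * x.2);
  counitLR : forall (a b : A) (u : U),
    counit (src beta a * tgt beta b * u) = a * counit u * b;
  DeltaA : forall R, sweedler Delta R -> forall u : U,
    \sum_(x <- R u) \sum_(y <- R x.1) tUUU beta y.1 y.2 x.2 =
    \sum_(x <- R u) \sum_(y <- R x.2) tUUU beta x.1 y.1 y.2;
  Delta_counitl : forall R, sweedler Delta R -> forall u : U,
    \sum_(x <- R u) src beta (counit x.1) * x.2 = u;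
  Delta_counitr : forall R, sweedler Delta R -> forall u : U,
    \sum_(x <- R u) tgt beta (counit x.2) * x.1 = u;
  Delta_takeuchi : forall R, sweedler Delta R -> forall (u : U) (a : A),
    \sum_(x <- R u) tUU beta (x.1 * tgt beta a) x.2 =
    \sum_(x <- R u) tUU beta x.1 (x.2 * src beta a);
  Delta1 : Delta 1 = tUU beta 1 1;
  DeltaM : forall R, sweedler Delta R -> forall u v : U,
    Delta (u * v) =
    \sum_(x <- R u) \sum_(y <- R v) tUU beta (x.1 * y.1) (x.2 * y.2);
  counit1 : counit 1 = 1;
  counitM_src : forall u v : U,
    counit (u * v) = counit (u * src beta (counit v));
  counitM_tgt : forall u v : U,
    counit (u * v) = counit (u * tgt beta (counit v))
}.

End Bialgebroid.

Record left_module (k : comNzRingType) (R : algType k) (N : lmodType k) :=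
  LeftModule {
  act :> R -> N -> N;
  act_linear : forall u : R, linear (act u);
  act_linearl : forall n : N, linear (act ^~ n);
  act1 : forall n : N, act 1 n = n;
  actA : forall (u v : R) (n : N), act u (act v n) = act (u * v) n
}.

Section YetterDrinfeld.
Variables (k : comNzRingType) (A U : algType k) (H : left_bialgebroid A U).
Variable N : lmodType k.

Local Notation s := (src H).
Local Notation t := (tgt H).
Local Notation eps := (counit H).

Section ComoduleTensors.
Variable aN : left_module A N.
Definition tensUN : lmodType k := tensor (ract H) aN.
Definition tensUUN : lmodType k := tensor3 (ract H) (lact H) (ract H) aN.
Definition tUN : U -> N -> tensUN := tpure (ract H) aN.
Definition tUUN : U -> U -> N -> tensUUN :=
  tpure3 (ract H) (lact H) (ract H) aN.
End ComoduleTensors.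

Record left_comodule := LeftComodule {
  cact : left_module A N;
  coact : {linear N -> tensUN cact};
  coactL : forall R, sweedler coact R -> forall (a : A) (n : N),
    coact (cact a n) = \sum_(x <- R n) tUN cact (s a * x.1) x.2;
  coactA : forall Q, sweedler (Delta H) Q ->
    forall R, sweedler coact R -> forall n : N,
    \sum_(x <- R n) \sum_(y <- Q x.1) tUUN cact y.1 y.2 x.2 =
    \sum_(x <- R n) \sum_(y <- R x.2) tUUN cact x.1 y.1 y.2;
  coact_counit : forall R, sweedler coact R -> forall n : N,
    \sum_(x <- R n) cact (eps x.1) x.2 = n
}.

Record yd_module := YDModule {
  uact :> left_module U N;
  ucoact : left_comodule;
  yd_lact : forall (a : A) (n : N), cact ucoact a n = uact (s a) n;
  yd_ract : forall R, sweedler (coact ucoact) R -> forall (n : N) (a : A),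
    \sum_(x <- R n) cact ucoact (eps (x.1 * t a)) x.2 = uact (t a) n;
  yd_compat : forall Q, sweedler (Delta H) Q ->
    forall R, sweedler (coact ucoact) R -> forall (u : U) (n : N),
    \sum_(x <- Q u) \sum_(y <- R (uact x.1 n))
      tUN (cact ucoact) (y.1 * x.2) y.2 =
    \sum_(x <- Q u) \sum_(y <- R n)
      tUN (cact ucoact) (x.1 * y.1) (uact x.2 y.2)
}.

Definition yd_coact (Y : yd_module) := coact (ucoact Y).
Definition yd_tens (Y : yd_module) := tUN (cact (ucoact Y)).

Record yd_algebra := YDAlgebra {
  ydm :> yd_module;
  nmul : N -> N -> N;
  none : N;
  nmul_linearr : forall n : N, linear (nmul n);
  nmul_linearl : forall n : N, linear (nmul ^~ n);
  nmulA : associative nmul;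
  nmul1n : left_id none nmul;
  nmuln1 : right_id none nmul;
  (* the product is a map of A-bimodules N (x)_A N -> N *)
  nmul_balanced : forall (n n' : N) (a : A),
    nmul (ydm (t a) n) n' = nmul n (ydm (s a) n');
  nmul_lact : forall (a : A) (n n' : N),
    ydm (s a) (nmul n n') = nmul (ydm (s a) n) n';
  nmul_ract : forall (a : A) (n n' : N),
    ydm (t a) (nmul n n') = nmul n (ydm (t a) n');
  nmul_act : forall Q, sweedler (Delta H) Q -> forall (u : U) (n n' : N),
    ydm u (nmul n n') = \sum_(x <- Q u) nmul (ydm x.1 n) (ydm x.2 n');
  none_actl : forall u : U, ydm u none = ydm (s (eps u)) none;
  none_actr : forall u : U, ydm u none = ydm (t (eps u)) none;
  none_coact : yd_coact ydm none = yd_tens ydm 1 none;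
  nmul_coact : forall R, sweedler (yd_coact ydm) R -> forall n n' : N,
    yd_coact ydm (nmul n n') =
    \sum_(x <- R n) \sum_(y <- R n') yd_tens ydm (x.1 * y.1) (nmul x.2 y.2)
}.

Definition braided_commutative (Y : yd_algebra) : Prop :=
  forall R, sweedler (yd_coact Y) R -> forall n n' : N,
    nmul Y n n' = \sum_(x <- R n) nmul Y (Y x.1 n') x.2.

End YetterDrinfeld.

Section Graded.
Variables (k : comNzRingType) (V : nat -> lmodType k).

(* The degree q component of the homogeneous element x of degree p: the
   transport of x along p = q, and 0 when p <> q. *)
Definition regrade (p q : nat) (x : V p) : V q :=
  if p =P q is ReflectT e then ecast n (V n) e x else 0.

Lemma regrade_linear p q : linear (@regrade p q).
Proof.
move=> c x y; rewrite /regrade; case: eqP => [e|_]; last by rewrite scaler0 addr0.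
by case: _ / e.
Qed.

End Graded.

Arguments regrade {k V p} q x.

(* sgn m *: x is (-1)^m x, and deg n is |n| = n - 1, which may be -1. *)
Definition sgn (k : comNzRingType) (m : int) : k := (-1) ^+ `|m|%N.
Definition deg (n : nat) : int := n%:Z - 1.
Arguments sgn {k} m.

(* Operations of degree -1 take values in V (p + q - 1) with truncated
   subtraction; when p = q = 0 they vanish, as V^(-1) = 0. *)
Record operad_mult (k : comNzRingType) (O : nat -> lmodType k) := OperadMult {
  oone : O 1%N;
  circ : forall p q : nat, nat -> O p -> O q -> O (p + q - 1)%N;
  circ_linearr : forall p q i (phi : O p), (0 < i)%N -> linear (@circ p q i phi);
  circ_linearl : forall p q i (psi : O q), (0 < i)%N ->
    linear (fun phi : O p => circ i phi psi);
  circ_out : forall p q i (phi : O p) (psi : O q), (0 < i)%N ->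
    (p < i)%N || (p == 0%N) -> circ i phi psi = 0;
  circA_lt : forall p q r i j (phi : O p) (psi : O q) (chi : O r),
    (0 < j)%N -> (j < i)%N ->
    circ j (circ i phi psi) chi =
    regrade _ (circ (i + r - 1)%N (circ j phi chi) psi);
  circA_mid : forall p q r i j (phi : O p) (psi : O q) (chi : O r),
    (0 < i)%N -> (i <= j < q + i)%N ->
    circ j (circ i phi psi) chi =
    regrade _ (circ i phi (circ (j - i + 1)%N psi chi));
  circA_ge : forall p q r i j (phi : O p) (psi : O q) (chi : O r),
    (0 < i)%N -> (q + i <= j)%N ->
    circ j (circ i phi psi) chi =
    regrade _ (circ i (circ (j - q + 1)%N phi chi) psi);
  circ1r : forall p i (phi : O p), (0 < i <= p)%N ->
    circ i phi oone = regrade _ phi;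
  circ1l : forall p (phi : O p), circ 1%N oone phi = regrade _ phi;
  omul : O 2%N;
  ounit : O 0%N;
  omulA : circ 1%N omul omul = circ 2%N omul omul;
  omul1l : circ 1%N omul ounit = oone;
  omul1r : circ 2%N omul ounit = oone
}.

Section OperadOperations.
Variables (k : comNzRingType) (O : nat -> lmodType k) (P : operad_mult O).

Definition bcirc p q (phi : O p) (psi : O q) : O (p + q - 1)%N :=
  sgn (deg p * deg q) *:
  \sum_(1 <= i < p.+1) sgn (deg q * deg i) *: circ P i phi psi.

Definition bracket p q (phi : O p) (psi : O q) : O (p + q - 1)%N :=
  bcirc phi psi - sgn (deg p * deg q) *: regrade _ (bcirc psi phi).

Definition cup p q (phi : O p) (psi : O q) : O (p + q)%N :=
  regrade _ (circ P p.+1 (circ P 1%N (omul P) phi) psi).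

Definition delta p (phi : O p) : O p.+1 := regrade _ (bracket (omul P) phi).

Lemma bcirc_linearr p q (phi : O p) : linear (@bcirc p q phi).
Proof.
move=> c x y; rewrite /bcirc scalerA [c * _]mulrC -scalerA -scalerDr; congr (_ *: _).
rewrite scaler_sumr -big_split; apply: eq_big_nat => i /andP[i0 _] /=.
by rewrite circ_linearr // scalerDr !scalerA [_ * c]mulrC.
Qed.

Lemma bcirc_linearl p q (psi : O q) : linear (fun phi : O p => bcirc phi psi).
Proof.
move=> c x y; rewrite /bcirc scalerA [c * _]mulrC -scalerA -scalerDr; congr (_ *: _).
rewrite scaler_sumr -big_split; apply: eq_big_nat => i /andP[i0 _] /=.
by rewrite circ_linearl // scalerDr !scalerA [_ * c]mulrC.
Qed.

Lemma bracket_linearr p q (phi : O p) : linear (@bracket p q phi).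
Proof.
move=> c x y; rewrite /bracket bcirc_linearr bcirc_linearl regrade_linear.
by rewrite scalerDr scalerBr !scalerA opprD addrACA [_ * c]mulrC.
Qed.

Lemma delta_linear p : linear (@delta p).
Proof. by move=> c x y; rewrite /delta bracket_linearr regrade_linear. Qed.
HB.instance Definition _ p :=
  GRing.isLinear.Build k (O p) (O p.+1) _ (@delta p) (@delta_linear p).

Definition cocycle_pred p : {pred O p} := fun phi => delta phi == 0.

Lemma cocycle_submod p : submod_closed (@cocycle_pred p).
Proof.
split; first by rewrite /cocycle_pred unfold_in linear0.
by move=> c x y /eqP x0 /eqP y0; apply/eqP; rewrite delta_linear x0 y0 scaler0 addr0.
Qed.
HB.instance Definition _ p :=
  GRing.isSubmodClosed.Build k (O p) (@cocycle_pred p) (@cocycle_submod p).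

Record cocycle p := Cocycle { cocycle_val : O p; _ : cocycle_pred cocycle_val }.
HB.instance Definition _ p := [isSub for @cocycle_val p].
HB.instance Definition _ p := [Choice of cocycle p by <:].
HB.instance Definition _ p := [SubChoice_isSubLmodule of cocycle p by <:].

Definition coboundary p (z : cocycle p) : Prop :=
  exists q (phi : O q), q.+1 = p /\ val z = regrade p (delta phi).

Definition cohomology (p : nat) : lmodType k := quotmod (@coboundary p).
Definition hclass p (z : cocycle p) : cohomology p := qclass (@coboundary p) z.

End OperadOperations.

Record gerstenhaber (k : comNzRingType) (V : nat -> lmodType k) :=
  Gerstenhaber {
  gcup : forall p q : nat, V p -> V q -> V (p + q)%N;
  gone : V 0%N;
  gbr : forall p q : nat, V p -> V q -> V (p + q - 1)%N;
  gcup_linearr : forall p q (x : V p), linear (@gcup p q x);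
  gcup_linearl : forall p q (y : V q), linear (fun x : V p => gcup x y);
  gcupA : forall p q r (x : V p) (y : V q) (z : V r),
    gcup x (gcup y z) = regrade _ (gcup (gcup x y) z);
  gcup1l : forall p (x : V p), gcup gone x = x;
  gcup1r : forall p (x : V p), gcup x gone = regrade _ x;
  gcupC : forall p q (x : V p) (y : V q),
    gcup x y = sgn (p%:Z * q%:Z) *: regrade _ (gcup y x);
  gbr_linearr : forall p q (x : V p), linear (@gbr p q x);
  gbr_linearl : forall p q (y : V q), linear (fun x : V p => gbr x y);
  gbr00 : forall x y : V 0%N, gbr x y = 0;
  gbrC : forall p q (x : V p) (y : V q),
    gbr x y = - (sgn (deg p * deg q) *: regrade _ (gbr y x));
  (* Jacobi, compared in each degree m because the truncated index of a
     vanishing inner bracket V^0 (x) V^0 -> V^(-1) is off by one. *)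
  gbr_jacobi : forall p q r m (x : V p) (y : V q) (z : V r),
    regrade m (gbr x (gbr y z)) =
    regrade m (gbr (gbr x y) z) +
    sgn (deg p * deg q) *: regrade m (gbr y (gbr x z));
  gbr_leibniz : forall p q r (x : V p) (y : V q) (z : V r),
    gbr x (gcup y z) =
    regrade _ (gcup (gbr x y) z) +
    sgn (deg p * q%:Z) *: regrade _ (gcup y (gbr x z))
}.

Section TensorPower.
Variables (k : comNzRingType) (A U : algType k) (H : left_bialgebroid A U).

Local Notation t := (tgt H).
Let g (s : seq U) : {malg k[seq U]} := << s >>.

(* The p-fold tensor power of U over A^op, with u t(a) (x) v = u (x) t(a) v:
   the sequences of length other than p are set to 0. For p = 0 it is the free
   k-module on the empty sequence. *)
Inductive tpower_rel (p : nat) : {malg k[seq U]} -> Prop :=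
| TPowerSize s : size s != p -> tpower_rel p (g s)
| TPowerAdd s1 s2 u v : tpower_rel p
    (g (s1 ++ (u + v) :: s2) - g (s1 ++ u :: s2) - g (s1 ++ v :: s2))
| TPowerScale s1 s2 c u : tpower_rel p
    (g (s1 ++ (c *: u) :: s2) - c *: g (s1 ++ u :: s2))
| TPowerBalanced s1 s2 u a v : tpower_rel p
    (g (s1 ++ (u * t a) :: v :: s2) - g (s1 ++ u :: (t a * v) :: s2)).

Definition tpower (p : nat) : lmodType k := presented (tpower_rel p).
Definition tppure (p : nat) (s : seq U) : tpower p := pgen (tpower_rel p) s.

End TensorPower.

Section Cochains.
Variables (k : comNzRingType) (A U : algType k) (H : left_bialgebroid A U).
Variables (N : lmodType k) (Y : yd_algebra H N).

Local Notation s := (src H).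
Local Notation t := (tgt H).
Local Notation eps := (counit H).

(* k-linear maps, right A-linear for u <| a = t(a) u on the first factor and
   n <| a = t(a) n. The condition is void for p = 0, and C^0 is identified with
   N by evaluation at the empty tensor. *)
Definition cochain_pred p : {pred tpower H p -> N} := fun f => `[<
  linear f /\ forall (a : A) (u : U) (us : seq U),
    f (tppure H p ((t a * u) :: us)) = Y (t a) (f (tppure H p (u :: us))) >].

Lemma cochain_submod p : submod_closed (@cochain_pred p).
Proof.
split=> [|c f g /asboolP[fL fA] /asboolP[gL gA]]; apply/asboolP; split.
- by move=> c x y; rewrite scaler0 addr0.
- move=> a u us; have := act_linear Y (t a) (-1) 0 0.
  by rewrite !scaleN1r oppr0 addr0 addNr => ->.
- move=> d x y.
  have E z : (c *: f + g) z = c *: f z + g z by [].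
  by rewrite !E fL gL !scalerDr !scalerA [c * d]mulrC addrACA.
- move=> a u us; have E z : (c *: f + g) z = c *: f z + g z by [].
  by rewrite !E fA gA (act_linear Y).
Qed.
HB.instance Definition _ p :=
  GRing.isSubmodClosed.Build k _ (@cochain_pred p) (@cochain_submod p).

Record cochain_of p := Cochain {
  cochain_fun :> tpower H p -> N;
  _ : cochain_pred cochain_fun
}.
HB.instance Definition _ p := [isSub for @cochain_fun p].
HB.instance Definition _ p := [Choice of cochain_of p by <:].
HB.instance Definition _ p := [SubChoice_isSubLmodule of cochain_of p by <:].

Definition cochain (p : nat) : lmodType k := cochain_of p.

(* phi (u^1, ..., u^p) for us = [u^1; ...; u^p] *)
Definition ceval p (phi : cochain p) (us : seq U) : N :=
  (phi : cochain_of p) (tppure H p us).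

(* The terms [(u^1_(1), u^1_(2)); ...; (u^m_(1), u^m_(2))] of the product of the
   Sweedler sums of u^1, ..., u^m. *)
Definition coprods (Q : U -> seq (U * U)) (us : seq U) : seq (seq (U * U)) :=
  foldr (fun u cs => [seq x :: c | x <- Q u, c <- cs]) [:: [::]] us.

Definition fsts (c : seq (U * U)) : seq U := [seq x.1 | x <- c].
Definition snds (c : seq (U * U)) : U := \prod_(x <- c) x.2.

(* A representative of D_psi (u^1, ..., u^q) in U (x)_A N. *)
Definition dterms (Q : U -> seq (U * U)) (R : N -> seq (U * N))
    q (psi : cochain q) (us : seq U) : seq (U * N) :=
  [seq (y.1 * snds c, y.2) | c <- coprods Q us, y <- R (ceval psi (fsts c))].

(* The insertion of psi in the slot following us1, evaluated at
   us1 ++ us2 ++ us3; us2 holds the arguments of psi. *)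
Definition insertion (Q : U -> seq (U * U)) (R : N -> seq (U * N))
    p q (phi : cochain p) (psi : cochain q) (us1 us2 us3 : seq U) : N :=
  \sum_(c <- coprods Q us1) \sum_(d <- dterms Q R psi us2)
    nmul Y (ceval phi (fsts c ++ d.1 :: us3)) (Y (snds c) d.2).

Definition hochschild_delta p (phi : cochain p) (us : seq U) : N :=
  if p is 0%N then Y us`_0 (ceval phi [::]) - Y (t (eps us`_0)) (ceval phi [::])
  else
  Y us`_0 (ceval phi (behead us)) +
  \sum_(1 <= i < p.+1) (-1) ^+ i *:
    ceval phi (take i.-1 us ++ (us`_i.-1 * us`_i) :: drop i.+1 us) +
  (-1) ^+ p.+1 *: ceval phi (take p.-1 us ++ [:: us`_p.-1 * t (eps us`_p)]).

Definition is_cochain_operad (P : operad_mult cochain) : Prop :=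
  [/\ forall p q i (phi : cochain p) (psi : cochain q) (us1 us2 us3 : seq U),
        (0 < i <= p)%N -> size us1 = i.-1 -> size us2 = q ->
        size us3 = (p - i)%N ->
        forall Q, sweedler (Delta H) Q -> forall R, sweedler (yd_coact Y) R ->
        ceval (circ P i phi psi) (us1 ++ us2 ++ us3) =
        insertion Q R phi psi us1 us2 us3,
      forall u v : U,
        ceval (omul P) [:: u; v] = Y (s (eps (u * v))) (none Y),
      forall u : U, ceval (oone P) [:: u] = Y (s (eps u)) (none Y)
    & ceval (ounit P) [::] = none Y].

End Cochains.

Definition induced_gerstenhaber (k : comNzRingType) (O : nat -> lmodType k)
    (P : operad_mult O) (G : gerstenhaber (cohomology P)) : Prop :=
  [/\ forall p q (a : cocycle P p) (b : cocycle P q),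
        exists2 c : cocycle P (p + q)%N, val c = cup P (val a) (val b) &
          gcup G (hclass a) (hclass b) = hclass c,
      forall p q (a : cocycle P p) (b : cocycle P q),
        exists2 c : cocycle P (p + q - 1)%N, val c = bracket P (val a) (val b) &
          gbr G (hclass a) (hclass b) = hclass c
    & exists2 c : cocycle P 0, val c = ounit P & gone G = hclass c].

(* Main.v *)
(* Two independent ideas.

   An operad with multiplication yields a Gerstenhaber algebra.  Put
   a *_m b = (-1)^{m|b|} a o_{p-m} b, where the slot is counted from the right.
   In these terms nested insertions compose without any sign and parallel ones
   commute up to the Koszul sign, so that summing over the slots gives the brace
   relations for a{b}{c}, a{b,c}{d} and a{b}{c,d}.  The differential is the
   bracket with mu and the cup product of a and b is (-1)^{|a|} mu{a,b}; the brace
   relations with one entry equal to mu show that a{b} is a homotopy for graded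
   commutativity and c{a,b} one for the Leibniz rule.

   The cochains form an operad.  Writing D_psi = psi(u_(1))_(-1) u_(2) (x)
   psi(u_(1))_(0), composition is phi o_i psi = phi(u_(1), D_(-1), -) (u_(2) D_(0)).
   Parallel insertions commute because braided commutativity turns
   d_(1) (x) (d_(2) X) n, for d (x) n in D_psi(u), into D_psi(u_(1)) (u_(2) X), and
   nested ones agree because D_psi is colinear,
   D_(-1)(1) (x) D_(-1)(2) (x) D_(0) = D(u_(1))_(-1) (x) D(u_(1))_(0)(-1) u_(2) (x)
   D(u_(1))_(0)(0), together with the Yetter-Drinfel'd condition.  Every such step
   rewrites a sum over Sweedler representatives, which is legitimate only for
   functions balanced over A; for lists of arguments this needs the Takeuchi
   condition. *)

Require Import Defs.
From HB Require Import structures.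
From mathcomp Require Import all_boot all_algebra.
From mathcomp Require Import generic_quotient zify boolp monalg finmap.

Set Implicit Arguments.
Unset Strict Implicit.
Unset Printing Implicit Defensive.

Import GRing.Theory.
Local Open Scope ring_scope.

(** * The brace calculus of an operad *)

(** A composite lives in arity p + q - 1, and iterated composites in arities that agree only up to
    arithmetic. The identities are therefore stated in the product [gprod] of all arities, where no
    transport appears, and signs are booleans ([sg b]), so that a sign check is a finite truth
    table. The truncated index at p = q = 0 does no harm: an element of arity 0 has no slot, so the
    composite is zero. On the cochain side the obstacle is that a Sweedler sum depends on its
    representatives unless the summand is balanced. Cochains become functions on lists of any length
    ([cochainlike]); [mixed] and [mixed2] record what a summand must satisfy to be evaluated on a
    twofold or threefold coproduct of a whole list. Both conditions survive the contraction of one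
    argument, which makes induction on lists possible. The functions eps(u^1 ... u^p) 1_N, for all
    p, give e, the identity and mu at once: inserting one of them substitutes a product of
    arguments, and the axioms relating mu and e reduce to this. *)

Section Signs.
Variable V : zmodType.

Definition sg (b : bool) (x : V) : V := if b then - x else x.

Lemma sg_sum b (I : Type) (r : seq I) (Q : pred I) (F : I -> V) :
  sg b (\sum_(i <- r | Q i) F i) = \sum_(i <- r | Q i) sg b (F i).
Proof. by case: b; rewrite // sumrN. Qed.

Lemma sgD b x y : sg b (x + y) = sg b x + sg b y.
Proof. by case: b; rewrite //= opprD. Qed.

Lemma sg_sg a b x : sg a (sg b x) = sg (a (+) b) x.
Proof. by case: a b => [] []; rewrite //= opprK. Qed.

Lemma sg0 b : sg b 0 = 0.
Proof. by case: b; rewrite //= oppr0. Qed.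

End Signs.

(** * Linear identities in abelian groups, decided by integer coefficients *)

Section AbelianNormalization.
Variable V : zmodType.

Inductive zexpr := ZVar of nat | ZZero | ZAdd of zexpr & zexpr | ZOpp of zexpr.

Fixpoint zeval (e : seq V) (t : zexpr) : V :=
  match t with
  | ZVar i => e`_i
  | ZZero => 0
  | ZAdd a b => zeval e a + zeval e b
  | ZOpp a => - zeval e a
  end.

Fixpoint zcoef (t : zexpr) (i : nat) : int :=
  match t with
  | ZVar j => (i == j)%:Z
  | ZZero => 0
  | ZAdd a b => zcoef a i + zcoef b i
  | ZOpp a => - zcoef a i
  end.

Fixpoint zbound (n : nat) (t : zexpr) : bool :=
  match t with
  | ZVar i => i < n
  | ZZero => true
  | ZAdd a b => zbound n a && zbound n b
  | ZOpp a => zbound n a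
  end%N.

Lemma zevalE e t : zbound (size e) t ->
  zeval e t = \sum_(i < size e) e`_i *~ zcoef t i.
Proof.
elim: t => [j /= jn||a IHa b IHb /=|a IHa /=].
- rewrite (bigD1 (Ordinal jn)) //= eqxx mulr1z big1 ?addr0 // => i.
  by rewrite -val_eqE /= => /negbTE ->; rewrite mulr0z.
- by rewrite big1.
- move=> /andP[/IHa -> /IHb ->]; rewrite -big_split; apply: eq_bigr => i _ /=.
  by rewrite mulrzDr.
- by move=> /IHa ->; rewrite -sumrN; apply: eq_bigr => i _; rewrite mulrNz.
Qed.

(** On reified terms the coefficients are closed integers, so all three hypotheses compute to
    [true]; this is why [zmod_eq] can supply [isT]. *)
Lemma zeval_eq e s t : zbound (size e) s -> zbound (size e) t ->
  all (fun i => zcoef s i == zcoef t i) (iota 0 (size e)) -> zeval e s = zeval e t.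
Proof.
move=> hs ht /allP h; rewrite !zevalE //; apply: eq_bigr => i _.
by rewrite (eqP (h i _)) // mem_iota /=.
Qed.

End AbelianNormalization.

(* Atoms are compared by unification: the same sum may mention different but
   convertible paths to the group structure. *)
Ltac zatom e x :=
  lazymatch e with
  | nil => constr:(@cons _ x nil)
  | cons ?y ?r =>
      match goal with
      | _ => let _ := match goal with _ => unify x y end in e
      | _ => let r' := zatom r x in constr:(cons y r')
      end
  end.
Ltac zatoms e t :=
  lazymatch t with
  | @GRing.add _ ?a ?b => let e' := zatoms e a in zatoms e' b
  | @GRing.opp _ ?a => zatoms e a
  | @GRing.zero _ => e
  | ?x => zatom e x
  end.
Ltac zindex e x :=
  lazymatch e with
  | cons ?y ?r =>
      match goal with
      | _ => let _ := match goal with _ => unify x y end in constr:(O)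
      | _ => let n := zindex r x in constr:(S n)
      end
  end.
Ltac zreify e t :=
  lazymatch t with
  | @GRing.add _ ?a ?b =>
      let a' := zreify e a in let b' := zreify e b in constr:(ZAdd a' b')
  | @GRing.opp _ ?a => let a' := zreify e a in constr:(ZOpp a')
  | @GRing.zero _ => constr:(ZZero)
  | ?x => let n := zindex e x in constr:(ZVar n)
  end.
Ltac zmod_eq :=
  lazymatch goal with
  | |- @eq ?T ?a ?b =>
      let e0 := constr:(@nil T) in
      let e1 := zatoms e0 a in let e := zatoms e1 b in
      let s := zreify e a in let t := zreify e b in
      exact (@zeval_eq _ e s t isT isT isT)
  end.
Lemma subr0_eqP (V : zmodType) (x y : V) : x = y -> x - y = 0.
Proof. by move=> ->; rewrite subrr. Qed.

(* Closes a = b when a - b is plus or minus the difference of the sides of H. *)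
Ltac zmod_by H :=
  lazymatch type of H with
  | ?L = ?R =>
      apply/eqP; rewrite -subr_eq0; apply/eqP;
      first [transitivity (L - R); [zmod_eq | exact/subr0_eqP]
            |transitivity (R - L); [zmod_eq | exact/subr0_eqP/esym]]
  end.

(** * The product of all arities and the signed insertions *)

Section GradedProduct.
Variables (k : comNzRingType) (O : nat -> lmodType k).

(** The full product can stand for the direct sum because [star] and the braces are finite sums in
    each arity. Elements of one arity enter through [emb]. *)
Definition gprod := forall n, O n.
HB.instance Definition _ := gen_eqMixin gprod.
HB.instance Definition _ := gen_choiceMixin gprod.

Definition tot_add (f g : gprod) : gprod := fun n => f n + g n.
Definition tot_opp (f : gprod) : gprod := fun n => - f n.

Lemma totP (f g : gprod) : (forall n, f n = g n) -> f = g.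
Proof. by move=> fg; apply: functional_extensionality_dep. Qed.

Lemma tot_addA : associative tot_add.
Proof. by move=> f g h; apply: totP => n; rewrite /tot_add addrA. Qed.
Lemma tot_addC : commutative tot_add.
Proof. by move=> f g; apply: totP => n; rewrite /tot_add addrC. Qed.
Lemma tot_add0 : left_id ((fun n => 0) : gprod) tot_add.
Proof. by move=> f; apply: totP => n; rewrite /tot_add add0r. Qed.
Lemma tot_addN : left_inverse ((fun n => 0) : gprod) tot_opp tot_add.
Proof. by move=> f; apply: totP => n; rewrite /tot_add addNr. Qed.
HB.instance Definition _ :=
  GRing.isZmodule.Build gprod tot_addA tot_addC tot_add0 tot_addN.

Lemma totD (f g : gprod) n : (f + g) n = f n + g n. Proof. by []. Qed.
Lemma tot_sum (I : Type) (r : seq I) (Q : pred I) (F : I -> gprod) n :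
  (\sum_(i <- r | Q i) F i) n = \sum_(i <- r | Q i) F i n.
Proof. by apply: (big_morph (fun f : gprod => f n)). Qed.
Lemma tot_sg b (f : gprod) n : (sg b f) n = sg b (f n).
Proof. by case: b. Qed.

Lemma regrade_id p (x : O p) : regrade p x = x.
Proof.
rewrite /regrade; case: eqP => [e|//]; by rewrite (eq_irrelevance e erefl).
Qed.

Lemma regrade_ne p q (x : O p) : p <> q -> regrade q x = 0.
Proof. by rewrite /regrade; case: eqP. Qed.

Definition emb p (x : O p) : gprod := fun n => regrade n x.

Lemma emb_linear_add p : {morph @emb p : x y / x + y}.
Proof.
move=> x y; apply: totP => n; rewrite /emb totD.
by have := @regrade_linear k O p n 1 x y; rewrite !scale1r.
Qed.

Lemma emb0 p : emb (0 : O p) = 0.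
Proof. by apply: (addrI (emb (0 : O p))); rewrite -emb_linear_add !addr0. Qed.

Lemma embN p : {morph @emb p : x / - x}.
Proof. by move=> x; apply/eqP; rewrite -addr_eq0 -emb_linear_add addNr emb0. Qed.

Lemma emb_sg p b (x : O p) : emb (sg b x) = sg b (emb x).
Proof. by case: b => //=; rewrite embN. Qed.

Lemma embE p (x : O p) : emb x p = x.
Proof. exact: regrade_id. Qed.

Lemma emb_regrade p q (x : O p) : p = q -> emb (regrade q x) = emb x.
Proof. by move=> <-; rewrite regrade_id. Qed.

(** Homogeneity as a property instead of a type: zero is homogeneous of every arity, which absorbs
    the degenerate cases of truncated subtraction. *)
Definition conc p (f : gprod) := forall n, n <> p -> f n = 0.

Lemma conc_emb p (x : O p) : conc p (emb x).
Proof. by move=> n np; apply: regrade_ne => pn; apply: np. Qed.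

Lemma concE p f : conc p f -> f = emb (f p).
Proof.
move=> hf; apply: totP => n; case: (n =P p) => [->|np]; first by rewrite embE.
by rewrite hf // conc_emb.
Qed.

Lemma concD p f g : conc p f -> conc p g -> conc p (f + g).
Proof. by move=> hf hg n np; rewrite totD hf // hg // addr0. Qed.
Lemma conc_sg p b f : conc p f -> conc p (sg b f).
Proof. by move=> hf n np; rewrite tot_sg hf // sg0. Qed.
Lemma conc_sum p (I : Type) (r : seq I) (Q : pred I) (F : I -> gprod) :
  (forall i, conc p (F i)) -> conc p (\sum_(i <- r | Q i) F i).
Proof. by move=> hF n np; rewrite tot_sum big1 // => i _; exact: hF. Qed.

Variable P : operad_mult O.

Lemma circDr p q i (x : O p) : (0 < i)%N ->
  {morph (@circ _ _ P p q i x) : y z / y + z}.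
Proof. by move=> i0 y z; have := circ_linearr P x i0 1 y z; rewrite !scale1r. Qed.

Lemma circDl p q i (y : O q) : (0 < i)%N ->
  {morph (fun x : O p => circ P i x y) : x z / x + z}.
Proof. by move=> i0 x z; have := circ_linearl P (p:=p) y i0 1 x z; rewrite !scale1r. Qed.

Lemma circ0r p q i (x : O p) : (0 < i)%N -> circ P i x (0 : O q) = 0.
Proof. by move=> i0; apply: (addrI (circ P i x (0 : O q))); rewrite -circDr // !addr0. Qed.
Lemma circ0l p q i (y : O q) : (0 < i)%N -> circ P i (0 : O p) y = 0.
Proof.
by move=> i0; apply: (addrI (circ P i (0 : O p) y)); rewrite -(circDl y i0) !addr0.
Qed.

(* Positions are counted from the right, starting at 0: only then does the sign
   of [bcirc] depend on the position and not on the arity of f. *)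
Definition star (m : nat) (f g : gprod) : gprod := fun n =>
  \sum_(p < n.+2 | (m < p)%N) sg (odd (m * (n.+2 - p)))
     (regrade n (circ P (p - m)%N (f p) (g (n.+1 - p)%N))).

Lemma regrade_add p n (x y : O p) : regrade n (x + y) = regrade n x + regrade n y.
Proof. exact: (congr1 (fun f : gprod => f n) (emb_linear_add x y)). Qed.

Lemma regrade0 p n : regrade n (0 : O p) = 0.
Proof. exact: (congr1 (fun f : gprod => f n) (emb0 p)). Qed.

Lemma star_addl m g : {morph (star m)^~ g : f f' / f + f'}.
Proof.
move=> f f'; apply: totP => n; rewrite totD /star -big_split /=.
by apply: eq_bigr => p mp; rewrite totD circDl ?subn_gt0 // regrade_add sgD.
Qed.

Lemma star_addr m f : {morph star m f : g g' / g + g'}.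
Proof.
move=> g g'; apply: totP => n; rewrite totD /star -big_split /=.
by apply: eq_bigr => p mp; rewrite totD circDr ?subn_gt0 // regrade_add sgD.
Qed.

Lemma star_emb m p q (x : O p) (y : O q) :
  star m (emb x) (emb y) =
  if (m < p)%N then sg (odd (m * q.+1)) (emb (circ P (p - m) x y)) else 0.
Proof.
apply: totP => n; rewrite /star.
have Z (i : 'I_n.+2) : (m < i)%N -> i <> p :> nat ->
  sg (odd (m * (n.+2 - i)))
     (regrade n (circ P (i - m) (emb x i) (emb y (n.+1 - i)%N))) = 0.
  by move=> mi ip; rewrite conc_emb // circ0l ?subn_gt0 // regrade0 sg0.
have [mp|pm] := ltnP m p; last first.
  rewrite big1 // => i mi; apply: Z => // ip.
  by move: mi pm; rewrite ip; lia.
rewrite tot_sg.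
have [pn|np] := ltnP p n.+2; last first.
  rewrite big1 => [|i mi]; last by apply: Z => // ip; have := ltn_ord i; lia.
  by rewrite conc_emb ?sg0 //; lia.
rewrite (bigD1 (Ordinal pn)) //= [X in _ + X]big1 ?addr0; last first.
  by move=> i /andP[mi /eqP ip]; apply: Z => // e; apply: ip; apply: val_inj.
clear Z; rewrite embE; have [e|ne] := eqVneq (n.+1 - p)%N q.
  rewrite -e in y *; rewrite embE.
  by have -> : (n.+2 - p = (n.+1 - p).+1)%N by lia.
rewrite (conc_emb y); last exact/eqP.
rewrite circ0r ?subn_gt0 // regrade0 conc_emb ?sg0 //.
by move: ne => /eqP; lia.
Qed.

Lemma star_hom m p q f g : conc p f -> conc q g -> conc (p + q - 1)%N (star m f g).
Proof.
move=> /concE -> /concE ->; rewrite star_emb; case: ifP => // _.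
by apply: conc_sg; exact: conc_emb.
Qed.

Lemma star_out m p f g : conc p f -> (p <= m)%N -> star m f g = 0.
Proof.
move=> /concE -> pm; apply: totP => n; rewrite /star big1 // => i mi.
by rewrite conc_emb ?circ0l ?subn_gt0 ?regrade0 ?sg0 //; lia.
Qed.

Lemma star_big m f g n : (n.+2 <= m)%N -> star m f g n = 0.
Proof. by move=> nm; rewrite /star big1 // => i; have := ltn_ord i; lia. Qed.

Lemma star0l m f : star m 0 f = 0.
Proof. by apply: (addrI (star m 0 f)); rewrite -star_addl !addr0. Qed.
Lemma star0r m f : star m f 0 = 0.
Proof. by apply: (addrI (star m f 0)); rewrite -star_addr !addr0. Qed.
Lemma star_sgl m b f g : star m (sg b f) g = sg b (star m f g).
Proof.
by case: b => //=; apply/eqP; rewrite -addr_eq0 -star_addl addNr star0l.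
Qed.
Lemma star_sgr m b f g : star m f (sg b g) = sg b (star m f g).
Proof.
by case: b => //=; apply/eqP; rewrite -addr_eq0 -star_addr addNr star0r.
Qed.
Lemma star_suml m g (I : Type) (r : seq I) (Q : pred I) (F : I -> gprod) :
  star m (\sum_(i <- r | Q i) F i) g = \sum_(i <- r | Q i) star m (F i) g.
Proof. by apply: (big_morph ((star m)^~ g)); [exact: star_addl | exact: star0l]. Qed.
Lemma star_sumr m f (I : Type) (r : seq I) (Q : pred I) (F : I -> gprod) :
  star m f (\sum_(i <- r | Q i) F i) = \sum_(i <- r | Q i) star m f (F i).
Proof. by apply: (big_morph (star m f)); [exact: star_addr | exact: star0r]. Qed.

(** Here [c] lies to the left of [b], so inserting [b] first moves the slot of [c], counted from the
    right, by q - 1, from [l.+1] to [l + q]. The sign is the Koszul sign. *)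
Lemma star_swap n l p q r a b c : conc p a -> conc q b -> conc r c -> (n <= l)%N ->
  star n (star l.+1 a c) b =
  sg (odd (q.+1 * r.+1)) (star (l + q)%N (star n a b) c).
Proof.
move=> /concE -> /concE -> /concE -> nl.
have [lp|pl] := ltnP l.+1 p; last first.
  rewrite (star_out _ (conc_emb (a p)) pl) star0l.
  rewrite (star_out _ (star_hom n (conc_emb (a p)) (conc_emb (b q)))) ?sg0 //.
  by lia.
rewrite !star_emb lp (leq_ltn_trans nl) ?(ltnW lp) //.
rewrite !star_sgl !star_emb.
do 2 (case: ifP => [_|]; last by lia).
rewrite circA_ge; [|lia..].
rewrite emb_regrade; last by lia.
have -> : (p + r - 1 - n - r + 1 = p - n)%N by lia.
have -> : (p + q - 1 - (l + q) = p - l.+1)%N by lia.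
rewrite !sg_sg; congr (sg _ _).
by rewrite !(oddM, oddD, oddS) /=; case: (odd l) (odd q) (odd r) (odd n) => [] [] [] [].
Qed.

(** No sign remains because m|b| + (m + n)|c| = n|c| + m(|b| + |c|), where |b| + |c| is the degree
    of the inner composite. *)
Lemma star_mid m n p q r a b c : conc p a -> conc q b -> conc r c -> (n < q)%N ->
  star (m + n)%N (star m a b) c = star m a (star n b c).
Proof.
move=> /concE -> /concE -> /concE -> nq.
have [mp|pm] := ltnP m p; last first.
  by rewrite !(star_out _ (conc_emb (a p)) pm) star0l.
rewrite !star_emb mp nq star_sgl star_sgr !star_emb mp.
case: ifP => [_|]; last by lia.
rewrite circA_mid; [|lia..].
rewrite emb_regrade; last by lia.
have -> : (p + q - 1 - (m + n) - (p - m) + 1 = q - n)%N by lia.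
rewrite !sg_sg; congr (sg _ _).
have -> : (q + r - 1).+1 = (q + r)%N by lia.
by rewrite !(oddM, oddD, oddS) /=; case: (odd m) (odd q) (odd r) (odd n) => [] [] [] [].
Qed.

(* [bcirc] and the braces f{g,h} and f{g,h,i} on inhomogeneous elements; the
   bounds on the positions only cut off vanishing terms. *)
Definition bcomp (f g : gprod) : gprod := fun n =>
  \sum_(0 <= m < n.+2) star m f g n.
Definition brace (f g h : gprod) : gprod := fun n =>
  \sum_(0 <= m < n.+3) \sum_(0 <= l < m) star l (star m f g) h n.
Definition brace3 (f g h i : gprod) : gprod := fun n =>
  \sum_(0 <= m < n.+4) \sum_(0 <= l < m) \sum_(0 <= j < l)
    star j (star l (star m f g) h) i n.

Lemma sum_nat_trim (V : zmodType) (n A B : nat) (F : nat -> V) :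
  (forall m, (A <= m)%N -> F m = 0) -> (A <= B)%N ->
  \sum_(n <= m < B) F m = \sum_(n <= m < A) F m.
Proof.
move=> FA AB; have [nA|An] := leqP n A.
  rewrite (big_cat_nat (n := A)) //= [X in _ + X]big1_seq ?addr0 // => m.
  by rewrite mem_index_iota => /= /andP[Am _]; exact: FA.
rewrite [RHS]big_geq ?(ltnW An) // big1_seq // => m.
by rewrite mem_index_iota => /= /andP[nm _]; apply: FA; lia.
Qed.

Lemma sum_nat_stable (V : zmodType) (A B : nat) (F : nat -> V) :
  (forall m, (A <= m)%N -> F m = 0) -> (forall m, (B <= m)%N -> F m = 0) ->
  \sum_(0 <= m < A) F m = \sum_(0 <= m < B) F m.
Proof.
by move=> FA FB; case/orP: (leq_total A B) => AB;
  [rewrite [RHS](sum_nat_trim _ FA) | rewrite (sum_nat_trim _ FB)].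
Qed.

(** Changes which of two insertions provides the outer summation index; the brace relations compare
    sums written in the two orders. *)
Lemma sum_triangle (V : zmodType) (n K : nat) (F : nat -> nat -> V) :
  \sum_(n <= m < K) \sum_(m.+1 <= l < K) F m l =
  \sum_(n <= l < K) \sum_(n <= m < l) F m l.
Proof.
elim: K => [|K IH]; first by rewrite !big_geq.
have [nK|Kn] := leqP n K; last by rewrite !big_geq.
rewrite [RHS]big_nat_recr //= -IH big_nat_recr //= [X in _ + X = _]big_geq // addr0.
rewrite -big_split /=.
by apply: eq_big_nat => m /andP[_ mK]; rewrite big_nat_recr.
Qed.

Lemma star_eq0 m f g n : (forall i, (i < n.+2)%N -> f i = 0) -> star m f g n = 0.
Proof.
move=> f0; rewrite /star big1 // => i mi.
by rewrite f0 // circ0l ?subn_gt0 // regrade0 sg0.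
Qed.

(** For homogeneous [f] the bound no longer depends on the arity of the value, so the sum can be
    taken in [gprod] itself and its terms rewritten there. *)
Lemma comp_hom p K f g : conc p f -> (p <= K)%N ->
  bcomp f g = \sum_(0 <= m < K) star m f g.
Proof.
move=> hf pK; apply: totP => n; rewrite tot_sum; apply: sum_nat_stable => m mn.
  exact: star_big.
by rewrite (star_out _ hf) // (leq_trans pK).
Qed.

Lemma brace_hom p K f g h : conc p f -> (p <= K)%N ->
  brace f g h = \sum_(0 <= m < K) \sum_(0 <= l < m) star l (star m f g) h.
Proof.
move=> hf pK; apply: totP => n; rewrite tot_sum.
under [RHS]eq_bigr do rewrite tot_sum.
apply: sum_nat_stable => m mn; apply: big1 => l _.
  by apply: star_eq0 => i ni; apply: star_big; lia.
by rewrite (star_out _ hf) ?star0l // (leq_trans pK).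
Qed.

Lemma brace3_hom p K f g h i : conc p f -> (p <= K)%N ->
  brace3 f g h i = \sum_(0 <= m < K) \sum_(0 <= l < m) \sum_(0 <= j < l)
    star j (star l (star m f g) h) i.
Proof.
move=> hf pK; apply: totP => n; rewrite tot_sum.
under [RHS]eq_bigr do (rewrite tot_sum; under eq_bigr do rewrite tot_sum).
apply: sum_nat_stable => m mn; apply: big1 => l _; apply: big1 => j _.
  by apply: star_eq0 => x xn; apply: star_eq0 => y yx; apply: star_big; lia.
by rewrite (star_out _ hf) ?star0l // (leq_trans pK).
Qed.

Lemma comp_homog p q f g : conc p f -> conc q g -> conc (p + q - 1)%N (bcomp f g).
Proof.
move=> hf hg; rewrite (comp_hom _ hf (leqnn p)).
by apply: conc_sum => m; exact: star_hom.
Qed.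

Lemma comp_addl f f' g : bcomp (f + f') g = bcomp f g + bcomp f' g.
Proof.
apply: totP => n; rewrite totD /bcomp -big_split /=.
by apply: eq_bigr => m _; rewrite star_addl.
Qed.
Lemma comp_addr f g g' : bcomp f (g + g') = bcomp f g + bcomp f g'.
Proof.
apply: totP => n; rewrite totD /bcomp -big_split /=.
by apply: eq_bigr => m _; rewrite star_addr.
Qed.
Lemma comp0l f : bcomp 0 f = 0.
Proof. by apply: (addrI (bcomp 0 f)); rewrite -comp_addl !addr0. Qed.
Lemma comp0r f : bcomp f 0 = 0.
Proof. by apply: (addrI (bcomp f 0)); rewrite -comp_addr !addr0. Qed.
Lemma comp_sgl b f g : bcomp (sg b f) g = sg b (bcomp f g).
Proof.
by case: b => //=; apply/eqP; rewrite -addr_eq0 -comp_addl addNr comp0l.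
Qed.
Lemma comp_sgr b f g : bcomp f (sg b g) = sg b (bcomp f g).
Proof.
by case: b => //=; apply/eqP; rewrite -addr_eq0 -comp_addr addNr comp0r.
Qed.

Local Opaque star bcomp brace brace3.

(** * Brace relations, by the relative position of the insertions *)

Section Relations.
Variables (p q r : nat) (a b c : gprod).
Hypotheses (ha : conc p a) (hb : conc q b) (hc : conc r c).

(** [c] lands to the right of [b], inside [b], or to its left. In the last case the two insertions
    are swapped, so that [b] keeps the slot [m]. *)
Lemma star_sum n m B : (n <= m <= B)%N ->
  \sum_(n <= l < B + q) star l (star m a b) c =
  \sum_(n <= l < m) star l (star m a b) c + star m a (bcomp b c) +
  sg (odd (q.+1 * r.+1)) (\sum_(m.+1 <= l < B.+1) star m (star l a c) b).
Proof.
move=> /andP[nm mB].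
rewrite (big_cat_nat (n := m)) /=; [|lia..].
rewrite (big_cat_nat (n := (m + q)%N) (m := m)) /=; [|lia..].
rewrite addrA; congr (_ + _ + _).
  rewrite (comp_hom _ hb (leqnn q)) star_sumr -{1}[m]add0n big_addn addKn.
  by apply: eq_big_nat => l /andP[_ lq]; rewrite addnC (star_mid m ha hb hc).
rewrite big_addn addnK big_add1 /= sg_sum; apply: eq_big_nat => l /andP[ml _].
by rewrite (star_swap ha hb hc ml) sg_sg addbb.
Qed.

Lemma star_sum_trim n m B : (n <= m <= B)%N -> (p <= B)%N ->
  \sum_(n <= l < B + q) star l (star m a b) c =
  \sum_(n <= l < m) star l (star m a b) c + star m a (bcomp b c) +
  sg (odd (q.+1 * r.+1)) (\sum_(m.+1 <= l < B) star m (star l a c) b).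
Proof.
move=> nmB pB; rewrite star_sum //; congr (_ + sg _ _).
apply: sum_nat_trim => // l Bl.
by rewrite (star_out _ ha) ?star0l // (leq_trans pB).
Qed.

Lemma comp_comp : bcomp (bcomp a b) c =
  bcomp a (bcomp b c) + brace a b c + sg (odd (q.+1 * r.+1)) (brace a c b).
Proof.
have pq : (p + q - 1 <= p + q)%N by lia.
rewrite (comp_hom _ (comp_homog ha hb) pq) !(comp_hom _ ha (leqnn p)).
under eq_bigr do rewrite star_suml.
rewrite exchange_big /= !(brace_hom _ _ ha (leqnn p)).
(* In a{c,b} the slot of [b] is the inner index; exchanging the order makes it the outer one, as in
   the other terms. *)
rewrite -[X in _ + sg _ X]sum_triangle [X in X + _]addrC sg_sum -!big_split /=.
apply: eq_big_nat => m /andP[_ mp].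
have mp' : (0 <= m <= p)%N by lia.
by rewrite (star_sum_trim mp').
Qed.

End Relations.

Section Relations4.
Variables (p q r u : nat) (a b c d : gprod).
Hypotheses (ha : conc p a) (hb : conc q b) (hc : conc r c) (hd : conc u d).

(** With [c] at slot l and [b] at slot m, l < m, the three-way split is applied twice: [d] against
    [c], then what falls to the left of [c] against [b]. The five outcomes are: in [c], in [b], to
    the right of both, between them, to the left of both. *)
Lemma brace_comp : bcomp (brace a b c) d =
  brace a b (bcomp c d) + sg (odd (r.+1 * u.+1)) (brace a (bcomp b d) c) +
  brace3 a b c d + sg (odd (r.+1 * u.+1)) (brace3 a b d c) +
  sg (odd (u.+1 * (q.+1 + r.+1))) (brace3 a d b c).
Proof.
have E : odd (u.+1 * (q.+1 + r.+1)) = odd (q.+1 * u.+1) (+) odd (r.+1 * u.+1).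
  by rewrite !(oddM, oddD, oddS); case: (odd q) (odd r) (odd u) => [] [] [].
rewrite {}E; set s := odd (q.+1 * u.+1); set s' := odd (r.+1 * u.+1).
have hab m := star_hom m ha hb.
have h : conc (p + q - 1 + r - 1)%N (brace a b c).
  rewrite (brace_hom _ _ ha (leqnn p)).
  by apply: conc_sum => m; apply: conc_sum => l; apply: star_hom.
(* The bound is (p + q) + r, so that the split against [c] leaves the bound p + q, again of the
   shape needed for the split against [b]. *)
rewrite (comp_hom (K := (p + q + r)%N) _ h); last by lia.
rewrite !(brace_hom _ _ ha (leqnn p)) !(brace3_hom _ _ _ ha (leqnn p)).
under eq_bigr do (rewrite star_suml; under eq_bigr do rewrite star_suml).
rewrite exchange_big /=.
under eq_bigr do rewrite exchange_big /=.
under [X in _ + _ + _ + sg _ X + _]eq_bigr do rewrite -sum_triangle.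
rewrite -[X in _ + sg _ X]sum_triangle !sg_sum -!big_split /=.
apply: eq_big_nat => m /andP[_ mp].
rewrite [\sum_(m.+1 <= l < p) _]exchange_big /=.
rewrite !sg_sum -!big_split /=.
apply: eq_big_nat => l /andP[_ lm].
rewrite (star_sum_trim (hab m) hc hd); [|lia..].
rewrite -star_suml (star_sum_trim ha hb hd); [|lia..].
rewrite !star_addl !star_sgl !sgD !sg_sg !star_suml addbC -/s -/s'.
zmod_eq.
Qed.

(** The part of a{b}{c,d} in which [d] is not to the right of [b]. As [d] is to the right of [c],
    either both lie in [b], or [c] is to the left of [b] and [d] lies in [b] or between the two. *)
Lemma comp_brace_region m : (m < p)%N ->
  \sum_(m <= i < p + q) \sum_(m <= j < i) star j (star i (star m a b) c) d =
  star m a (brace b c d) +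
  sg (odd (q.+1 * r.+1)) (\sum_(m.+1 <= i < p) star m (star i a c) (bcomp b d)) +
  sg (odd (q.+1 * (r.+1 + u.+1)))
    (\sum_(m.+1 <= i < p) \sum_(m.+1 <= j < i) star m (star j (star i a c) d) b).
Proof.
move=> mp; rewrite (big_cat_nat (n := (m + q)%N)) /=; [|lia..].
rewrite -addrA; congr (_ + _).
  rewrite (brace_hom _ _ hb (leqnn q)) star_sumr -{1}[m]add0n big_addn addKn.
  apply: eq_big_nat => i /andP[_ iq].
  rewrite star_sumr addnC -{1}[m]add0n big_addn addKn.
  apply: eq_big_nat => j /andP[_ ji].
  rewrite (star_mid m ha hb hc) // addnC (star_mid m ha (star_hom i hb hc) hd) //.
  by lia.
(* A slot i >= m + q of the composite is slot i - q + 1 of [a]; the sums are extended to [p.+1] by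
   vanishing terms to match this range. *)
rewrite -[X in _ = _ + sg _ X](_ : \sum_(m.+1 <= i < p.+1) \sum_(m.+1 <= j < i)
    star m (star j (star i a c) d) b = _); last first.
  apply: sum_nat_trim => // i pi; apply: big1 => j _.
  by rewrite (star_out _ ha) // !star0l.
rewrite -[X in sg _ X + _](_ : \sum_(m.+1 <= i < p.+1)
    star m (star i a c) (bcomp b d) = _); last first.
  by apply: sum_nat_trim => // i pi; rewrite (star_out _ ha) // !star0l.
rewrite big_addn addnK !big_add1 /= !sg_sum -big_split /=.
apply: eq_big_nat => l /andP[ml lp].
have E : star (l + q)%N (star m a b) c =
         sg (odd (q.+1 * r.+1)) (star m (star l.+1 a c) b).
  by rewrite (star_swap ha hb hc ml) sg_sg addbb.
under eq_bigr do rewrite E star_sgl.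
rewrite -sg_sum (star_sum (star_hom l.+1 ha hc) hb hd) ?leqnn //.
rewrite (big_geq (leqnn m)) add0r sgD sg_sg; congr (_ + sg _ _).
by rewrite !(oddM, oddD, oddS); case: (odd q) (odd r) (odd u) => [] [] [].
Qed.

Lemma comp_brace : brace (bcomp a b) c d =
  bcomp a (brace b c d) + brace a (bcomp b c) d +
  sg (odd (q.+1 * r.+1)) (brace a c (bcomp b d)) +
  brace3 a b c d + sg (odd (q.+1 * r.+1)) (brace3 a c b d) +
  sg (odd (q.+1 * (r.+1 + u.+1))) (brace3 a c d b).
Proof.
have E : odd (q.+1 * (r.+1 + u.+1)) = odd (q.+1 * r.+1) (+) odd (q.+1 * u.+1).
  by rewrite !(oddM, oddD, oddS); case: (odd q) (odd r) (odd u) => [] [] [].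
rewrite E; set s := odd (q.+1 * r.+1); set s' := odd (q.+1 * u.+1).
have hab := comp_homog ha hb.
rewrite (brace_hom (K := (p + q)%N) _ _ hab); last by lia.
rewrite (comp_hom _ ha (leqnn p)) !(brace_hom _ _ ha (leqnn p)).
rewrite !(brace3_hom _ _ _ ha (leqnn p)) (comp_hom _ ha (leqnn p)).
under eq_bigr do (under eq_bigr do rewrite star_suml star_suml).
under eq_bigr do rewrite exchange_big /=.
rewrite exchange_big /=.
under [X in _ + X + _ + _]eq_bigr do rewrite -sum_triangle.
rewrite -[X in _ + sg _ X + _ + _ + _]sum_triangle.
rewrite -[X in _ + sg _ X + _]sum_triangle.
under [X in _ + sg _ X]eq_bigr do rewrite -sum_triangle.
rewrite -[X in _ + sg _ X]sum_triangle !sg_sum -!big_split /=.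
apply: eq_big_nat => m /andP[_ mp].
(* Separates the terms with [d] to the right of [b], where [c] may still be on either side of [b] or
   inside it, from those of [comp_brace_region]. *)
rewrite -sum_triangle (big_cat_nat (n := m)) //=; last by lia.
rewrite sum_triangle comp_brace_region // E -/s -/s'.
rewrite [X in _ = _ + sg s X + sg _ _]exchange_big /=.
have -> : \sum_(0 <= j < m) \sum_(j.+1 <= l < p + q)
      star j (star l (star m a b) c) d =
    \sum_(0 <= j < m) \sum_(j.+1 <= l < m) star j (star l (star m a b) c) d +
    \sum_(0 <= l < m) star l (star m a (bcomp b c)) d +
    sg s (\sum_(0 <= j < m) \sum_(m.+1 <= l < p)
      star j (star m (star l a c) b) d).
  rewrite sg_sum -!big_split /=; apply: eq_big_nat => j /andP[_ jm].
  rewrite -star_suml (star_sum_trim ha hb hc); [|lia..].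
  by rewrite !star_addl star_sgl !star_suml.
zmod_eq.
Qed.

End Relations4.

End GradedProduct.

(** * Differential, bracket and cup product expressed by braces *)

Section Homotopies.
Variables (k : comNzRingType) (O : nat -> lmodType k) (P : operad_mult O).
Local Notation gprod := (gprod O).
Local Notation star := (star P).
Local Notation bcomp := (bcomp P).
Local Notation brace := (brace P).
Local Notation brace3 := (brace3 P).
Implicit Types a b c x : gprod.

Lemma compNl a b : bcomp (- a) b = - bcomp a b.
Proof. exact: (comp_sgl P true). Qed.
Lemma compNr a b : bcomp a (- b) = - bcomp a b.
Proof. exact: (comp_sgr P true). Qed.

Lemma brace_addl a a' b c : brace (a + a') b c = brace a b c + brace a' b c.
Proof.
apply: totP => n; rewrite totD /brace -big_split /=; apply: eq_bigr => m _.
by rewrite -big_split /=; apply: eq_bigr => l _; rewrite !star_addl.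
Qed.
Lemma brace_addm a b b' c : brace a (b + b') c = brace a b c + brace a b' c.
Proof.
apply: totP => n; rewrite totD /brace -big_split /=; apply: eq_bigr => m _.
by rewrite -big_split /=; apply: eq_bigr => l _; rewrite star_addr star_addl.
Qed.
Lemma brace_addr a b c c' : brace a b (c + c') = brace a b c + brace a b c'.
Proof.
apply: totP => n; rewrite totD /brace -big_split /=; apply: eq_bigr => m _.
by rewrite -big_split /=; apply: eq_bigr => l _; rewrite star_addr.
Qed.
Lemma brace_sgl s a b c : brace (sg s a) b c = sg s (brace a b c).
Proof.
apply: totP => n; rewrite tot_sg sg_sum; apply: eq_bigr => m _.
by rewrite sg_sum; apply: eq_bigr => l _; rewrite !star_sgl tot_sg.
Qed.
Lemma brace_sgm s a b c : brace a (sg s b) c = sg s (brace a b c).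
Proof.
apply: totP => n; rewrite tot_sg sg_sum; apply: eq_bigr => m _.
by rewrite sg_sum; apply: eq_bigr => l _; rewrite star_sgr star_sgl tot_sg.
Qed.
Lemma brace_sgr s a b c : brace a b (sg s c) = sg s (brace a b c).
Proof.
apply: totP => n; rewrite tot_sg sg_sum; apply: eq_bigr => m _.
by rewrite sg_sum; apply: eq_bigr => l _; rewrite star_sgr tot_sg.
Qed.
Lemma braceNl a b c : brace (- a) b c = - brace a b c.
Proof. exact: (brace_sgl true). Qed.
Lemma braceNm a b c : brace a (- b) c = - brace a b c.
Proof. exact: (brace_sgm true). Qed.
Lemma braceNr a b c : brace a b (- c) = - brace a b c.
Proof. exact: (brace_sgr true). Qed.
Lemma brace0l b c : brace 0 b c = 0.
Proof. by apply: (addrI (brace 0 b c)); rewrite -brace_addl !addr0. Qed.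
Lemma brace0m a c : brace a 0 c = 0.
Proof. by apply: (addrI (brace a 0 c)); rewrite -brace_addm !addr0. Qed.
Lemma brace0r a b : brace a b 0 = 0.
Proof. by apply: (addrI (brace a b 0)); rewrite -brace_addr !addr0. Qed.

Definition expand := (comp_addl, comp_addr, comp_sgl, comp_sgr, compNl, compNr,
  comp0l, comp0r, brace_addl, brace_addm, brace_addr, brace_sgl, brace_sgm,
  brace_sgr, braceNl, braceNm, braceNr, brace0l, brace0m, brace0r).

(* s is the parity of |n| = n - 1 in the nonzero degree n. *)
Definition phom (s : bool) a := exists2 p, conc p a & odd p.+1 = s.

Lemma phom_emb p (x : O p) : phom (odd p.+1) (emb x).
Proof. by exists p => //; exact: conc_emb. Qed.

Lemma phom0 s : phom s 0.
Proof. by exists s.+1 => //=; rewrite negbK; case: s. Qed.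

Lemma phom_comp s t a b : phom s a -> phom t b -> phom (s (+) t) (bcomp a b).
Proof.
move=> [p ha <-] [q hb <-]; have [pq|pq] := posnP (p + q).
  (* For p = q = 0 the truncated index 0 has the wrong parity, but the composite is zero and zero
     has every parity. *)
  have p0 : (p <= 0)%N by lia.
  by rewrite (comp_hom P _ ha p0) big_geq //; exact: phom0.
exists (p + q - 1)%N; first exact: comp_homog.
by rewrite -subSn // subn1 /= oddD /= addNb addbN negbK.
Qed.

Lemma phom_brace s t u a b c :
  phom s a -> phom t b -> phom u c -> phom (s (+) t (+) u) (brace a b c).
Proof.
move=> [p ha <-] [q hb <-] [r hc <-]; have [p1|p1] := leqP p 1.
  (* With fewer than two slots the brace vanishes; for p >= 2 the subtractions below are not
     truncated. *)
  rewrite (brace_hom P _ _ ha p1) big_nat1 big_geq //; exact: phom0.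
exists (p + q - 1 + r - 1)%N.
  rewrite (brace_hom P _ _ ha (leqnn p)); apply: conc_sum => m; apply: conc_sum => l.
  exact/star_hom/hc/star_hom.
have -> : (p + q - 1 + r - 1).+1 = (p.+1 + q.+1 + r.+1 - 4)%N by lia.
by rewrite oddB ?oddD /= ?addbF; lia.
Qed.

Section PreLie.
Variables (s t u v : bool) (a b c x : gprod).
Hypotheses (ha : phom s a) (hb : phom t b) (hc : phom u c) (hx : phom v x).

Lemma comp_compP : bcomp (bcomp a b) c =
  bcomp a (bcomp b c) + brace a b c + sg (t && u) (brace a c b).
Proof.
move: ha hb hc => [p h _] [q h' <-] [r h'' <-].
by rewrite (comp_comp P h h' h'') oddM.
Qed.

Lemma brace_compP : bcomp (brace a b c) x =
  brace a b (bcomp c x) + sg (u && v) (brace a (bcomp b x) c) +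
  brace3 a b c x + sg (u && v) (brace3 a b x c) +
  sg (v && (t (+) u)) (brace3 a x b c).
Proof.
move: ha hb hc hx => [p h _] [q h' <-] [r h'' <-] [w hw <-].
by rewrite (brace_comp P h h' h'' hw) !oddM oddD.
Qed.

Lemma comp_braceP : brace (bcomp a b) c x =
  bcomp a (brace b c x) + brace a (bcomp b c) x +
  sg (t && u) (brace a c (bcomp b x)) +
  brace3 a b c x + sg (t && u) (brace3 a c b x) +
  sg (t && (u (+) v)) (brace3 a c x b).
Proof.
move: ha hb hc hx => [p h _] [q h' <-] [r h'' <-] [w hw <-].
by rewrite (comp_brace P h h' h'' hw) !oddM oddD.
Qed.

End PreLie.

Definition br (s : bool) a b := bcomp a b - sg s (bcomp b a).

(** By the pre-Lie identity [comp_compP] the associator (a{b}){c} - a{b{c}} is graded symmetric in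
    [b] and [c], so the two-entry braces cancel over the six orderings. *)
Lemma br_jacobi s t u a b c : phom s a -> phom t b -> phom u c ->
  br (s && (t (+) u)) a (br (t && u) b c) =
  br ((s (+) t) && u) (br (s && t) a b) c +
  sg (s && t) (br (t && (s (+) u)) b (br (s && u) a c)).
Proof.
move=> ha hb hc; rewrite /br !expand.
rewrite (comp_compP ha hb hc) (comp_compP ha hc hb) (comp_compP hb ha hc).
rewrite (comp_compP hb hc ha) (comp_compP hc ha hb) (comp_compP hc hb ha).
case: s t u {ha hb hc} => [] [] [] /=; zmod_eq.
Qed.

Definition Mu : gprod := emb (omul P).

Lemma phom_Mu : phom true Mu. Proof. exact: (phom_emb (omul P)). Qed.

Lemma brace3_Mu a b c : brace3 Mu a b c = 0.
Proof.
rewrite (brace3_hom P _ _ _ (conc_emb (omul P)) (leqnn 2)).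
by rewrite !big_nat_recr //= !big_geq //= !add0r.
Qed.

(** The two slots carry opposite signs because mu is odd, so this is the associativity of mu. *)
Lemma comp_Mu_Mu : bcomp Mu Mu = 0.
Proof.
rewrite (comp_hom P _ (conc_emb (omul P)) (leqnn 2)).
rewrite !big_nat_recr //= big_geq //= add0r /Mu !star_emb /= subn0.
by rewrite -[(2 - 1)%N]/1%N omulA subrr.
Qed.

Definition dif (s : bool) a := br s Mu a.

(** Jacobi for mu, mu, a would give only twice this identity; the pre-Lie relation with mu{mu} = 0
    gives it over any [k]. *)
Lemma dif_dif s a : phom s a -> dif (~~ s) (dif s a) = 0.
Proof.
have hM := phom_Mu; move=> ha; rewrite /dif /br !expand.
rewrite (comp_compP hM ha hM) (comp_compP ha hM hM) comp_Mu_Mu comp0r add0r.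
have := comp_compP hM hM ha; rewrite comp_Mu_Mu comp0l.
by case: s {ha} => /= H; zmod_by H.
Qed.

Lemma dif_comp s t a b : phom s a -> phom t b ->
  dif (s (+) t) (bcomp a b) = bcomp (dif s a) b + sg s (bcomp a (dif t b))
    - brace Mu a b - sg (s && t) (brace Mu b a).
Proof.
have hM := phom_Mu; move=> ha hb; rewrite /dif /br !expand.
rewrite (comp_compP ha hb hM) (comp_compP ha hM hb) (comp_compP hM ha hb).
case: s t {ha hb} => [] [] /=; zmod_eq.
Qed.

(** In the relation for mu{mu}{a,b} the left side vanishes since mu{mu} = 0, and so do the
    three-entry braces of mu. What remains is the Leibniz rule of the differential on the cup
    product. *)
Lemma dif_brace_Mu s t a b : phom s a -> phom t b ->
  dif (~~ (s (+) t)) (brace Mu a b) =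
  - brace Mu (dif s a) b - sg s (brace Mu a (dif t b)).
Proof.
have hM := phom_Mu; move=> ha hb; rewrite /dif /br !expand.
rewrite (brace_compP hM ha hb hM) !brace3_Mu.
have := comp_braceP hM hM ha hb; rewrite comp_Mu_Mu !brace3_Mu brace0l.
by case: s t {ha hb} => [] [] /= H; zmod_by H.
Qed.

Lemma br_dif s t a b : phom s a -> phom t b ->
  dif (s (+) t) (br (s && t) a b) =
  br (~~ s && t) (dif s a) b + sg s (br (s && ~~ t) a (dif t b)).
Proof. by move=> ha hb; exact: br_jacobi phom_Mu ha hb. Qed.

(* The brace [c{a,b}] is a homotopy for the Leibniz rule. *)
Lemma br_leibniz s t u a b c : phom s a -> phom t b -> phom u c ->
  dif s a = 0 -> dif t b = 0 -> dif u c = 0 ->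
  br (u && ~~ (s (+) t)) c (sg s (brace Mu a b)) =
  sg (u (+) s) (brace Mu (br (u && s) c a) b) +
  sg (u && ~~ s) (sg s (brace Mu a (br (u && t) c b))) +
  sg (s (+) u) (dif (s (+) t (+) u) (brace c a b)).
Proof.
have hM := phom_Mu; move=> ha hb hc da db dc; rewrite /dif /br !expand.
rewrite (brace_compP hc ha hb hM) (brace_compP hM ha hb hc) !brace3_Mu.
(* A cocycle commutes with mu up to sign; this turns mu{c}{a,b} into c{mu}{a,b}, which a brace
   relation expands once more. *)
have E x w : dif w x = 0 -> bcomp Mu x = sg w (bcomp x Mu).
  by move/eqP; rewrite subr_eq0 => /eqP.
have := comp_braceP hM hc ha hb; rewrite (E _ _ dc) !brace3_Mu brace_sgl.
rewrite (comp_braceP hc hM ha hb) (E _ _ da) (E _ _ db) !expand.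
by case: s t u {ha hb hc da db dc E} => [] [] [] /= H; zmod_by H.
Qed.

Lemma brace_Mu a b : brace Mu a b = star 0 (star 1 Mu a) b.
Proof.
rewrite (brace_hom P _ _ (conc_emb (omul P)) (leqnn 2)).
by rewrite !big_nat_recr //= !big_geq //= !add0r.
Qed.

(** Both sides insert [a], [b], [c] in the three slots of mu composed with itself. Associativity
    exchanges the two slots of the outer mu, with a minus sign, and moving the odd inner mu past [a]
    gives the rest of the sign. *)
Lemma brace_Mu_assoc s t u a b c : phom s a -> phom t b -> phom u c ->
  brace Mu (brace Mu a b) c = sg (~~ s) (brace Mu a (brace Mu b c)).
Proof.
have hM : conc 2 Mu by exact: conc_emb.
move=> [p ha <-] [q hb _] [r hc _]; rewrite !brace_Mu.
have hMa := star_hom P 1 hM ha; have hMb := star_hom P 1 hM hb.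
have -> : star 1 Mu (star 0 (star 1 Mu a) b) = star 1 (star 2 (star 1 Mu Mu) a) b.
  by rewrite -(star_mid P 1 hM hMa hb) -?(star_mid P 1 hM hM ha) //; lia.
have -> : star 0 (star 1 Mu a) (star 0 (star 1 Mu b) c) =
          star 0 (star 1 (star 0 (star 1 Mu a) Mu) b) c.
  by rewrite -(star_mid P 0 hMa hMb hc) -?(star_mid P 0 hMa hM hb) //; lia.
rewrite (star_swap P (n := 0) (l := 0) hM hM ha) // !star_sgl sg_sg.
have E : star 1 Mu Mu = - star 0 Mu Mu.
  have := comp_Mu_Mu; rewrite (comp_hom P _ hM (leqnn 2)).
  rewrite !big_nat_recr //= big_geq //= add0r => /eqP.
  by rewrite addrC addr_eq0 => /eqP.
rewrite E -[- _]/(sg true _) !star_sgl; congr (sg _ _).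
by rewrite oddM /= negbK; case: (odd p).
Qed.

Definition opunit : gprod := emb (ounit P).

Lemma star_oone p x : conc p x -> star 0 (emb (oone P)) x = x.
Proof.
move=> /concE ->; rewrite star_emb /= subn0 circ1l emb_regrade //.
by rewrite add1n subn1.
Qed.

(** Slot 1 carries the sign (-1)^|e| with |e| = -1. The two values cancel, which is why e is a
    cocycle. *)
Lemma star_Mu_one : star 1 Mu opunit = - emb (oone P) /\ star 0 Mu opunit = emb (oone P).
Proof. by split; rewrite star_emb /=; [rewrite -omul1l | rewrite -omul1r]. Qed.

Lemma brace_Mu1l s a : phom s a -> sg true (brace Mu opunit a) = a.
Proof.
move=> [p ha _]; rewrite brace_Mu star_Mu_one.1 -[- _]/(sg true _) star_sgl sg_sg.
exact: star_oone ha.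
Qed.

Lemma brace_Mu1r s a : phom s a -> sg s (brace Mu a opunit) = a.
Proof.
move=> [p ha <-]; rewrite brace_Mu.
rewrite (star_swap P (n := 0) (l := 0) (conc_emb _) (conc_emb _) ha) //.
by rewrite star_Mu_one.2 addn0 (star_oone ha) sg_sg mul1n addbb.
Qed.

Lemma dif_one : dif true opunit = 0.
Proof.
have E : bcomp opunit Mu = 0.
  by rewrite (comp_hom P _ (conc_emb (ounit P)) (leqnn 0)) big_geq.
rewrite /dif /br E sg0 subr0 (comp_hom P _ (conc_emb (omul P)) (leqnn 2)).
rewrite !big_nat_recr //= big_geq //= add0r.
by rewrite star_Mu_one.1 star_Mu_one.2 subrr.
Qed.

Lemma odd_absz_deg n : odd `|deg n|%N = odd n.+1.
Proof.
by rewrite /deg; case: n => [//|n]; rewrite -[n.+1]addn1 PoszD addrK /= addn1 /= negbK.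
Qed.

Lemma sgnE (V : lmodType k) (m : int) (x : V) : sgn m *: x = sg (odd `|m|%N) x.
Proof.
rewrite /sgn -signr_odd; case: (odd _); first by rewrite expr1 scaleN1r.
by rewrite expr0 scale1r.
Qed.

Lemma sgn_degE (V : lmodType k) p q (x : V) :
  sgn (deg p * deg q) *: x = sg (odd p.+1 && odd q.+1) x.
Proof. by rewrite sgnE abszM oddM !odd_absz_deg. Qed.

Lemma emb_sum p (I : Type) (r : seq I) (Q : pred I) (F : I -> O p) :
  emb (\sum_(i <- r | Q i) F i) = \sum_(i <- r | Q i) emb (F i).
Proof. by apply: (big_morph (@emb k O p)); [exact: emb_linear_add | exact: emb0]. Qed.

Lemma emb_bcirc p q (x : O p) (y : O q) :
  emb (bcirc P x y) = bcomp (emb x) (emb y).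
Proof.
rewrite /bcirc sgn_degE emb_sg emb_sum (comp_hom P _ (conc_emb x) (leqnn p)).
(* Slot i from the left is slot p - i from the right, and |p||q| + |q||i| has the parity of (p -
   i)|q|. *)
rewrite sg_sum big_add1 /= [RHS]big_nat_rev /=.
apply: eq_big_nat => i /andP[_ ip].
rewrite sgn_degE emb_sg sg_sg add0n star_emb ifT; last by lia.
have -> : (p - (p - i.+1) = i.+1)%N by lia.
congr (sg _ _); rewrite oddM oddB // !oddS.
by case: (odd p) (odd q) (odd i) => [] [] [].
Qed.

Lemma emb_bracket p q (x : O p) (y : O q) :
  emb (bracket P x y) = br (odd p.+1 && odd q.+1) (emb x) (emb y).
Proof.
rewrite /bracket sgn_degE emb_linear_add embN emb_sg emb_regrade; last by rewrite addnC.
by rewrite !emb_bcirc.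
Qed.

Lemma emb_cup p q (x : O p) (y : O q) :
  emb (cup P x y) = sg (odd p.+1) (brace Mu (emb x) (emb y)).
Proof.
rewrite /cup emb_regrade; last by lia.
have -> : brace Mu (emb x) (emb y) =
    star 0 (sg (odd p.+1) (emb (circ P 1 (omul P) x))) (emb y).
  by rewrite brace_Mu star_emb mul1n.
rewrite star_sgl sg_sg addbb.
by rewrite star_emb.
Qed.

Lemma emb_delta p (x : O p) : emb (delta P x) = dif (odd p.+1) (emb x).
Proof. by rewrite /delta emb_regrade ?emb_bracket //; lia. Qed.

End Homotopies.

(** * The Gerstenhaber structure on cohomology *)

Section Cohomology.
Variables (k : comNzRingType) (O : nat -> lmodType k) (P : operad_mult O).
Local Notation gprod := (gprod O).
Local Notation bcomp := (bcomp P).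
Local Notation brace := (brace P).
Local Notation br := (br P).
Local Notation dif := (dif P).
Local Notation Mu := (Mu P).
Local Notation H := (cohomology P).
Implicit Types f g h : gprod.

Lemma delta_delta p (x : O p) : delta P (delta P x) = 0.
Proof.
have := congr1 (fun f : gprod => f p.+2) (dif_dif P (phom_emb x)).
by rewrite -emb_delta -[~~ odd p.+1]/(odd p.+2) -emb_delta /= embE.
Qed.

Lemma hclass0 p : hclass (0 : cocycle P p) = 0.
Proof. exact: linear0. Qed.

Lemma insubd0 p : insubd (0 : cocycle P p) 0 = 0.
Proof.
by apply: val_inj; rewrite insubdK // /cocycle_pred unfold_in [delta _ _]linear0.
Qed.

(* Junk value 0 when the component of degree m of f is not a cocycle. *)
Definition cls m f : H m := hclass (insubd (0 : cocycle P m) (f m)).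

Definition closed f := forall m, delta P (f m) = 0.

Lemma closedD f g : closed f -> closed g -> closed (f + g).
Proof.
by move=> hf hg m; rewrite totD [LHS](linearD (@delta _ _ P m)) /= hf hg addr0.
Qed.
Lemma closed_sg s f : closed f -> closed (sg s f).
Proof.
move=> hf m; rewrite tot_sg; case: s; last exact: hf.
by rewrite [LHS](linearN (@delta _ _ P m)) /= hf oppr0.
Qed.

Lemma closed_val m f : closed f -> val (insubd (0 : cocycle P m) (f m)) = f m.
Proof. by move=> hf; rewrite insubdK // /cocycle_pred unfold_in hf. Qed.

Lemma clsD m f g : closed f -> closed g -> cls m (f + g) = cls m f + cls m g.
Proof.
move=> hf hg; rewrite /cls /hclass -linearD; congr (qclass _ _); apply: val_inj.
by rewrite /= !closed_val //; exact: closedD.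
Qed.

Lemma cls_sg m s f : closed f -> cls m (sg s f) = sg s (cls m f).
Proof.
move=> hf; case: s => //=; rewrite /cls /hclass -linearN; congr (qclass _ _).
by apply: val_inj; rewrite /= !closed_val //; apply: (closed_sg true).
Qed.

Lemma cls_dif m s f : phom s f -> cls m (dif s f) = 0.
Proof.
move=> [p /concE -> <-]; rewrite -emb_delta /cls.
have [pm|/eqP pm] := eqVneq p.+1 m; last first.
  by rewrite conc_emb ?insubd0 ?hclass0 // => mp; apply: pm.
rewrite -hclass0; apply/qclassP/asboolP => S S0 _; apply; exists p, (f p); split=> //.
rewrite subr0 insubdK //= -?{1}pm /cocycle_pred unfold_in /emb.
by case: _ / pm; rewrite regrade_id delta_delta.
Qed.

Definition cocyc p f := conc p f /\ dif (odd p.+1) f = 0.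

Lemma cocyc_phom p f : cocyc p f -> phom (odd p.+1) f.
Proof. by move=> [hf _]; exists p. Qed.

Lemma cocyc_closed p f : cocyc p f -> closed f.
Proof.
move=> [hf df] m; have [->|/eqP mp] := eqVneq m p; last by rewrite hf // [LHS](linear0 (@delta _ _ P m)).
by rewrite -[delta P _]embE emb_delta -concE // df.
Qed.

Lemma cocyc_val p (z : cocycle P p) : cocyc p (emb (val z)).
Proof.
split; first exact: conc_emb.
by rewrite -emb_delta; case: z => z /= /eqP ->; rewrite emb0.
Qed.

Lemma cls_val p (z : cocycle P p) : cls p (emb (val z)) = hclass z.
Proof. by rewrite /cls embE; congr hclass; rewrite valKd. Qed.

Lemma regrade_cls p m f : conc p f -> regrade m (cls p f) = cls m f.
Proof.
move=> hf; have [<-|/eqP pm] := eqVneq p m; first exact: regrade_id.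
by rewrite regrade_ne // /cls hf ?insubd0 ?hclass0 // => mp; apply: pm.
Qed.

Definition rep p (x : H p) : gprod := emb (val (repr x : cocycle P p)).

Lemma cocyc_rep p (x : H p) : cocyc p (rep x). Proof. exact: cocyc_val. Qed.
Lemma cls_rep p (x : H p) : cls p (rep x) = x.
Proof. by rewrite /rep cls_val; exact: qclassK. Qed.

(** By linearity of [delta], an element of the span of the coboundaries is itself a coboundary; in
    degree 0 it is zero, since no degree precedes 0. *)
Lemma hclass_inj p (z z' : cocycle P p) : hclass z = hclass z' ->
  exists2 w, phom (~~ odd p.+1) w & emb (val z) = emb (val z') + dif (~~ odd p.+1) w.
Proof.
move=> /qclassP /asboolP.
suff E : z - z' \in in_span (@coboundary k O P p) ->
    exists2 w, phom (~~ odd p.+1) w & emb (val (z - z')) = dif (~~ odd p.+1) w.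
  move=> /asboolP /E [w hw e]; exists w => //.
  by rewrite -e -emb_linear_add [val (_ - _)]linearB addrC subrK.
move: (z - z') => {z'} {}z /asboolP; case: p z => [|p] z.
  move=> /(_ (fun z => val z = 0)) zz; exists 0; first exact: phom0.
  rewrite zz ?emb0 /dif /br ?bcomp0l ?bcomp0r ?sg0 ?subr0 //.
  - by rewrite /= comp0l comp0r subrr.
  - by move=> c u v u0 v0; rewrite linearP /= u0 v0 scaler0 addr0.
  - by move=> y [q [phi []]].
case/(_ (fun z => exists y, val z = delta P y)).
- by exists 0; rewrite [RHS]linear0.
- move=> c u v [y uy] [y' vy]; exists (c *: y + y').
  by rewrite linearP /= uy vy delta_linear.
- move=> y [q [phi [[e]]]]; case: _ / e y => y ->; exists phi.
  exact: regrade_id.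
- move=> y ->; exists (emb y); first by rewrite /= negbK; exact: (phom_emb y).
  by rewrite emb_delta /= negbK.
Qed.

Lemma cls_inj p f g : cocyc p f -> cocyc p g -> cls p f = cls p g ->
  exists2 w, phom (~~ odd p.+1) w & f = g + dif (~~ odd p.+1) w.
Proof.
move=> hf hg /hclass_inj[w hw e]; exists w => //.
have [cf cg] := (cocyc_closed hf, cocyc_closed hg).
by rewrite (concE hf.1) (concE hg.1) -(closed_val p cf) -(closed_val p cg).
Qed.

(** The sign is that of [emb_cup], which makes this the cup product. *)
Definition cupt p f g := sg (odd p.+1) (brace Mu f g).
Definition brt p q f g := br (odd p.+1 && odd q.+1) f g.

Lemma dif_sg s t f : dif s (sg t f) = sg t (dif s f).
Proof. by rewrite /dif /br !expand; case: s t => [] []; rewrite /=; zmod_eq. Qed.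

Lemma closed_dif s w : phom s w -> closed (dif s w).
Proof.
move=> [p /concE -> <-] m; rewrite -emb_delta.
have [->|/eqP mp] := eqVneq m p.+1; first by rewrite embE delta_delta.
by rewrite conc_emb // [LHS](linear0 (@delta _ _ P m)).
Qed.

(** Independence of representatives, and the identities that hold only up to homotopy, are proved
    through this lemma by exhibiting [w]. *)
Lemma cls_homotopic m f g s t w : closed g -> phom s w ->
  f = g + sg t (dif s w) -> cls m f = cls m g.
Proof.
move=> cg hw ->; rewrite clsD ?cls_sg ?cls_dif ?sg0 ?addr0 //.
  exact: closed_dif.
exact/closed_sg/closed_dif.
Qed.

Lemma cupt_cocyc p q f g : cocyc p f -> cocyc q g -> cocyc (p + q)%N (cupt p f g).
Proof.
move=> hf hg; have [[cf df] [cg dg]] := (hf, hg); split.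
  by rewrite (concE cf) (concE cg) /cupt -emb_cup; exact: conc_emb.
have -> : odd (p + q).+1 = ~~ (odd p.+1 (+) odd q.+1).
  by rewrite !oddS oddD; case: (odd p) (odd q) => [] [].
rewrite /cupt dif_sg (dif_brace_Mu P (cocyc_phom hf) (cocyc_phom hg)) df dg.
by rewrite brace0m brace0r sg0 subr0 oppr0 sg0.
Qed.

Lemma odd_predD p q : (0 < p + q)%N -> odd (p + q - 1).+1 = odd p.+1 (+) odd q.+1.
Proof. by move=> pq; rewrite -subSn // subn1 /= oddD /= addNb addbN negbK. Qed.

Lemma brt00 p q f g : (p + q = 0)%N -> conc p f -> conc q g -> brt p q f g = 0.
Proof.
move=> pq cf cg; have [p0 q0] : (p <= 0)%N /\ (q <= 0)%N by lia.
by rewrite /brt /br (comp_hom P _ cf p0) (comp_hom P _ cg q0) !big_geq // sg0 subr0.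
Qed.

Lemma br0l s f : br s 0 f = 0.
Proof. by rewrite /br !expand sg0 subr0. Qed.
Lemma br0r s f : br s f 0 = 0.
Proof. by rewrite /br !expand sg0 subr0. Qed.

Lemma dif0 s : dif s 0 = 0. Proof. exact: br0r. Qed.

Lemma brt_cocyc p q f g : cocyc p f -> cocyc q g ->
  cocyc (p + q - 1)%N (brt p q f g).
Proof.
move=> hf hg; have [[cf df] [cg dg]] := (hf, hg); split.
  by rewrite (concE cf) (concE cg) /brt -emb_bracket; exact: conc_emb.
have [pq|pq] := posnP (p + q); first by rewrite brt00 ?dif0.
rewrite odd_predD // /brt (br_dif P (cocyc_phom hf) (cocyc_phom hg)) df dg.
by rewrite br0l br0r sg0 addr0.
Qed.

Definition hcup p q (x : H p) (y : H q) : H (p + q)%N :=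
  cls (p + q) (cupt p (rep x) (rep y)).
Definition hbr p q (x : H p) (y : H q) : H (p + q - 1)%N :=
  cls (p + q - 1) (brt p q (rep x) (rep y)).

Lemma rep_cls p f : cocyc p f ->
  exists2 w, phom (~~ odd p.+1) w & rep (cls p f) = f + dif (~~ odd p.+1) w.
Proof. by move=> hf; apply: cls_inj => //; [exact: cocyc_rep | exact: cls_rep]. Qed.

Lemma phom_brace_Mu s t f g : phom s f -> phom t g ->
  phom (~~ (s (+) t)) (brace Mu f g).
Proof. by move=> hf hg; have := phom_brace P (phom_Mu P) hf hg; rewrite addTb addNb. Qed.

Lemma hcup_cls p q f g : cocyc p f -> cocyc q g ->
  hcup (cls p f) (cls q g) = cls (p + q) (cupt p f g).
Proof.
move=> hf hg; have [w hw ew] := rep_cls hf; have [v hv ev] := rep_cls hg.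
have hG := cocyc_rep (cls q g); have pG := cocyc_phom hG; rewrite /hcup.
(* One representative is replaced at a time, with homotopies mu{w,-} and mu{f,v}; in each the
   remaining argument is a cocycle. *)
transitivity (cls (p + q) (cupt p f (rep (cls q g)))).
  apply: (@cls_homotopic _ _ _ _ (odd p) _ _ (phom_brace_Mu hw pG)).
    exact: cocyc_closed (cupt_cocyc hf hG).
  rewrite ew /cupt brace_addm sgD (dif_brace_Mu P hw pG) hG.2 brace0r sg0 subr0.
  by rewrite /=; case: (odd p) => /=; zmod_eq.
have pf := cocyc_phom hf.
apply: (@cls_homotopic _ _ _ _ (true) _ _ (phom_brace_Mu pf hv)).
  exact: cocyc_closed (cupt_cocyc hf hg).
rewrite ev /cupt brace_addr sgD (dif_brace_Mu P pf hv) hf.2 brace0m.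
by rewrite /=; case: (odd p) => /=; zmod_eq.
Qed.

Lemma phom_br s t u f g : phom s f -> phom t g -> phom (s (+) t) (br u f g).
Proof.
move=> [p cf <-] [q cg <-]; have [pq|pq] := posnP (p + q).
  have [p0 q0] : (p <= 0)%N /\ (q <= 0)%N by lia.
  rewrite /br (comp_hom P _ cf p0) (comp_hom P _ cg q0) !big_geq // sg0 subr0.
  exact: phom0.
exists (p + q - 1)%N; last exact: odd_predD.
apply: concD; first exact: comp_homog.
by apply: (@conc_sg _ _ _ true); apply: conc_sg; rewrite addnC; apply: comp_homog.
Qed.

Lemma hbr_cls p q f g : cocyc p f -> cocyc q g ->
  hbr (cls p f) (cls q g) = cls (p + q - 1) (brt p q f g).
Proof.
move=> hf hg; have [w hw ew] := rep_cls hf; have [v hv ev] := rep_cls hg.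
have hG := cocyc_rep (cls q g); have pG := cocyc_phom hG; rewrite /hbr.
(* The homotopies are now brackets with [w] and with [v], by the derivation property [br_dif]. *)
transitivity (cls (p + q - 1) (brt p q f (rep (cls q g)))).
  apply: (@cls_homotopic _ _ _ _ (false) _ _ (phom_br (~~ odd p.+1 && odd q.+1) hw pG)).
    exact: cocyc_closed (brt_cocyc hf hG).
  rewrite (br_dif P hw pG) hG.2 br0r sg0 addr0 negbK ew /brt /dif /br !expand.
  by rewrite /=; case: (odd p) (odd q) => [] [] /=; zmod_eq.
have pf := cocyc_phom hf.
apply: (@cls_homotopic _ _ _ _ (odd p.+1) _ _ (phom_br (odd p.+1 && ~~ odd q.+1) pf hv)).
  exact: cocyc_closed (brt_cocyc hf hg).
rewrite (br_dif P pf hv) hf.2 br0l add0r sg_sg addbb negbK ev /brt /dif /br !expand.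
by rewrite /=; case: (odd p) (odd q) => [] [] /=; zmod_eq.
Qed.

Lemma cls_emb_scale p (c : k) (x y : O p) : delta P x = 0 -> delta P y = 0 ->
  cls p (emb (c *: x + y)) = c *: cls p (emb x) + cls p (emb y).
Proof.
move=> dx dy; rewrite /cls /hclass !embE -linearP; congr (qclass _ _).
have D : delta P (c *: x + y) = 0 by rewrite delta_linear dx dy scaler0 addr0.
have V z : delta P z = 0 -> val (insubd (0 : cocycle P p) z) = z.
  by move=> dz; rewrite insubdK // /cocycle_pred unfold_in dz.
by apply: val_inj; rewrite linearP /= !V.
Qed.

Lemma cup_linearr p q (x : O p) : linear (@cup k O P p q x).
Proof. by move=> c y z; rewrite /cup circ_linearr // regrade_linear. Qed.

Lemma cup_linearl p q (y : O q) : linear (fun x : O p => cup P x y).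
Proof.
by move=> c x z; rewrite /cup circ_linearr // circ_linearl // regrade_linear.
Qed.

Lemma emb_cocyc p (x : O p) : delta P x = 0 -> cocyc p (emb x).
Proof. by move=> dx; split; [exact: conc_emb | rewrite -emb_delta dx emb0]. Qed.

Lemma cocyc_delta p (x : O p) : cocyc p (emb x) -> delta P x = 0.
Proof. by move=> /cocyc_closed /(_ p); rewrite embE. Qed.

(** There are two views of a class: by a cocycle of [O p], for questions of [k]-linearity, and by a
    homogeneous element of [gprod] ([cocyc_spec]), for the brace identities. *)
Variant class_spec p : H p -> Type :=
  ClassSpec (x : O p) of delta P x = 0 : class_spec (cls p (emb x)).

Lemma classP p (x : H p) : class_spec x.
Proof.
by rewrite -[x]cls_rep; constructor; exact/cocyc_delta/cocyc_rep.
Qed.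

Lemma cupt_emb p q (x : O p) (y : O q) : cupt p (emb x) (emb y) = emb (cup P x y).
Proof. by rewrite emb_cup. Qed.
Lemma brt_emb p q (x : O p) (y : O q) : brt p q (emb x) (emb y) = emb (bracket P x y).
Proof. by rewrite emb_bracket. Qed.

Lemma delta_cup p q (x : O p) (y : O q) :
  delta P x = 0 -> delta P y = 0 -> delta P (cup P x y) = 0.
Proof.
move=> dx dy; apply: cocyc_delta; rewrite -cupt_emb.
by apply: cupt_cocyc; exact: emb_cocyc.
Qed.
Lemma delta_bracket p q (x : O p) (y : O q) :
  delta P x = 0 -> delta P y = 0 -> delta P (bracket P x y) = 0.
Proof.
move=> dx dy; apply: cocyc_delta; rewrite -brt_emb.
by apply: brt_cocyc; exact: emb_cocyc.
Qed.

Lemma deltaL p (c : k) (x y : O p) :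
  delta P x = 0 -> delta P y = 0 -> delta P (c *: x + y) = 0.
Proof. by move=> dx dy; rewrite delta_linear dx dy scaler0 addr0. Qed.

Lemma hcup_emb p q (x : O p) (y : O q) : delta P x = 0 -> delta P y = 0 ->
  hcup (cls p (emb x)) (cls q (emb y)) = cls (p + q) (emb (cup P x y)).
Proof. by move=> dx dy; rewrite hcup_cls ?cupt_emb //; exact: emb_cocyc. Qed.
Lemma hbr_emb p q (x : O p) (y : O q) : delta P x = 0 -> delta P y = 0 ->
  hbr (cls p (emb x)) (cls q (emb y)) = cls (p + q - 1) (emb (bracket P x y)).
Proof. by move=> dx dy; rewrite hbr_cls ?brt_emb //; exact: emb_cocyc. Qed.

Lemma hcup_linearr p q (x : H p) : linear (@hcup p q x).
Proof.
move=> c y z; case/classP: x => x dx; case/classP: y => y dy; case/classP: z => z dz.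
rewrite -cls_emb_scale // !hcup_emb //; last exact: deltaL.
by rewrite cup_linearr cls_emb_scale //; exact: delta_cup.
Qed.
Lemma hcup_linearl p q (y : H q) : linear (fun x : H p => hcup x y).
Proof.
move=> c x z; case/classP: x => x dx; case/classP: y => y dy; case/classP: z => z dz.
rewrite -cls_emb_scale // !hcup_emb //; last exact: deltaL.
by rewrite cup_linearl cls_emb_scale //; exact: delta_cup.
Qed.
Lemma hbr_linearr p q (x : H p) : linear (@hbr p q x).
Proof.
move=> c y z; case/classP: x => x dx; case/classP: y => y dy; case/classP: z => z dz.
rewrite -cls_emb_scale // !hbr_emb //; last exact: deltaL.
by rewrite bracket_linearr cls_emb_scale //; exact: delta_bracket.
Qed.
Lemma bracket_linearl p q (y : O q) : linear (fun x : O p => bracket P x y).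
Proof.
move=> c x z; rewrite /bracket bcirc_linearl bcirc_linearr regrade_linear.
by rewrite scalerDr scalerBr !scalerA opprD addrACA [_ * c]mulrC.
Qed.
Lemma hbr_linearl p q (y : H q) : linear (fun x : H p => hbr x y).
Proof.
move=> c x z; case/classP: x => x dx; case/classP: y => y dy; case/classP: z => z dz.
rewrite -cls_emb_scale // !hbr_emb //; last exact: deltaL.
by rewrite bracket_linearl cls_emb_scale //; exact: delta_bracket.
Qed.

Variant cocyc_spec p : H p -> Type :=
  CocycSpec f of cocyc p f : cocyc_spec (cls p f).

Lemma cocycP p (x : H p) : cocyc_spec x.
Proof. by rewrite -[x]cls_rep; constructor; exact: cocyc_rep. Qed.

Lemma odd_addS p q : odd (p + q).+1 = ~~ (odd p.+1 (+) odd q.+1).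
Proof. by rewrite !oddS oddD; case: (odd p) (odd q) => [] []. Qed.

(** Associativity is strict on cochains, so no homotopy enters. *)
Lemma hcupA p q r (x : H p) (y : H q) (z : H r) :
  hcup x (hcup y z) = regrade _ (hcup (hcup x y) z).
Proof.
case/cocycP: x => f hf; case/cocycP: y => g hg; case/cocycP: z => h hh.
have hfg := cupt_cocyc hf hg; have hgh := cupt_cocyc hg hh.
rewrite !hcup_cls // regrade_cls; last exact: (cupt_cocyc hfg hh).1.
congr (cls _ _); rewrite /cupt brace_sgm brace_sgr.
rewrite (brace_Mu_assoc P (cocyc_phom hf) (cocyc_phom hg) (cocyc_phom hh)).
by rewrite !sg_sg odd_addS; congr (sg _ _); rewrite /=; case: (odd p) (odd q) => [] [].
Qed.

Lemma cocyc_one : cocyc 0 (opunit P).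
Proof. by split; [exact: conc_emb | exact: dif_one]. Qed.

Definition hone : H 0%N := cls 0 (opunit P).

Lemma hcup1l p (x : H p) : hcup hone x = x.
Proof.
case/cocycP: x => f hf; rewrite hcup_cls //; last exact: cocyc_one.
by rewrite /cupt (brace_Mu1l P (cocyc_phom hf)).
Qed.

Lemma hcup1r p (x : H p) : hcup x hone = regrade _ x.
Proof.
case/cocycP: x => f hf; rewrite hcup_cls //; last exact: cocyc_one.
by rewrite /cupt (brace_Mu1r P (cocyc_phom hf)) regrade_cls //; exact: hf.1.
Qed.

Lemma hcupC p q (x : H p) (y : H q) :
  hcup x y = sgn (p%:Z * q%:Z) *: regrade _ (hcup y x).
Proof.
case/cocycP: x => f hf; case/cocycP: y => g hg.
have hgf := cupt_cocyc hg hf.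
rewrite !hcup_cls // regrade_cls; last exact: hgf.1.
rewrite sgnE -cls_sg; last exact: cocyc_closed hgf.
apply: (@cls_homotopic _ _ _ _ (odd p) _ _
  (phom_comp P (cocyc_phom hf) (cocyc_phom hg))).
  exact/closed_sg/(cocyc_closed hgf).
rewrite (dif_comp P (cocyc_phom hf) (cocyc_phom hg)) hf.2 hg.2 comp0l comp0r.
rewrite sg0 /cupt abszM oddM /=.
by case: (odd p) (odd q) => [] [] /=; zmod_eq.
Qed.

Lemma cls0 m : cls m 0 = 0.
Proof. by rewrite /cls insubd0 hclass0. Qed.

Lemma hbr00 (x y : H 0%N) : hbr x y = 0.
Proof.
case/cocycP: x => f hf; case/cocycP: y => g hg.
by rewrite hbr_cls // brt00 ?cls0 //; [exact: hf.1 | exact: hg.1].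
Qed.

Lemma hbrC p q (x : H p) (y : H q) :
  hbr x y = - (sgn (deg p * deg q) *: regrade _ (hbr y x)).
Proof.
case/cocycP: x => f hf; case/cocycP: y => g hg.
have hgf := brt_cocyc hg hf; have cgf := cocyc_closed hgf.
rewrite !hbr_cls // regrade_cls; last exact: hgf.1.
rewrite sgn_degE -cls_sg // -[- _]/(sg true _) -cls_sg; last exact: closed_sg.
congr (cls _ _); rewrite /brt /br /=.
by case: (odd p) (odd q) => [] [] /=; zmod_eq.
Qed.

(** For q = r = 0 the truncated index has the wrong parity, but the inner bracket is then zero, so
    the untruncated sign is correct in all cases. *)
Lemma brt_brtr p q r f g h : cocyc q g -> cocyc r h ->
  brt p (q + r - 1) f (brt q r g h) =
  br (odd p.+1 && (odd q.+1 (+) odd r.+1)) f (br (odd q.+1 && odd r.+1) g h).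
Proof.
move=> [cg _] [ch _]; have [qr|qr] := posnP (q + r).
  by rewrite -[br (_ && odd r.+1) g h]/(brt q r g h) (brt00 qr cg ch) /brt !br0r.
by rewrite /brt odd_predD.
Qed.

Lemma brt_brtl p q r f g h : cocyc p f -> cocyc q g ->
  brt (p + q - 1) r (brt p q f g) h =
  br ((odd p.+1 (+) odd q.+1) && odd r.+1) (br (odd p.+1 && odd q.+1) f g) h.
Proof.
move=> [cf _] [cg _]; have [pq|pq] := posnP (p + q).
  by rewrite -[br (_ && odd q.+1) f g]/(brt p q f g) (brt00 pq cf cg) /brt !br0l.
by rewrite /brt odd_predD.
Qed.

Lemma hbr_jacobi p q r m (x : H p) (y : H q) (z : H r) :
  regrade m (hbr x (hbr y z)) =
  regrade m (hbr (hbr x y) z) +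
  sgn (deg p * deg q) *: regrade m (hbr y (hbr x z)).
Proof.
case/cocycP: x => f hf; case/cocycP: y => g hg; case/cocycP: z => h hh.
have hfg := brt_cocyc hf hg; have hgh := brt_cocyc hg hh.
have hfh := brt_cocyc hf hh.
have h1 := brt_cocyc hf hgh; have h2 := brt_cocyc hfg hh; have h3 := brt_cocyc hg hfh.
rewrite !hbr_cls // !regrade_cls; [|exact: h3.1|exact: h2.1|exact: h1.1].
have [c2 c3] := (cocyc_closed h2, cocyc_closed h3).
rewrite sgn_degE -cls_sg // -clsD //; last exact: closed_sg.
congr (cls _ _); rewrite !brt_brtr // brt_brtl //.
have J := br_jacobi P (cocyc_phom hf) (cocyc_phom hg) (cocyc_phom hh).
exact: J.
Qed.

Lemma hbr_leibniz p q r (x : H p) (y : H q) (z : H r) :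
  hbr x (hcup y z) =
  regrade _ (hcup (hbr x y) z) + sgn (deg p * q%:Z) *: regrade _ (hcup y (hbr x z)).
Proof.
case/cocycP: x => f hf; case/cocycP: y => g hg; case/cocycP: z => h hh.
have hfg := brt_cocyc hf hg; have hgh := cupt_cocyc hg hh.
have hfh := brt_cocyc hf hh.
have h2 := cupt_cocyc hfg hh; have h3 := cupt_cocyc hg hfh.
have [pf [pg ph]] := (cocyc_phom hf, (cocyc_phom hg, cocyc_phom hh)).
rewrite !(hbr_cls, hcup_cls) // !regrade_cls; [|exact: h3.1|exact: h2.1].
have [c2 c3] := (cocyc_closed h2, cocyc_closed h3).
rewrite sgnE -cls_sg // -clsD //; last exact: closed_sg.
apply: (@cls_homotopic _ _ _ _ (odd q.+1 (+) odd p.+1) _ _ (phom_brace P pf pg ph)).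
  by apply: closedD => //; exact: closed_sg.
have := br_leibniz pg ph pf hg.2 hh.2 hf.2.
rewrite -odd_addS -[br _ f _]/(brt p (q + r) f (cupt q g h)) => ->.
rewrite [odd q.+1 (+) _ (+) _]addbC addbA.
have -> : sg (odd p.+1 (+) odd q.+1) (brace Mu (br (odd p.+1 && odd q.+1) f g) h) =
    cupt (p + q - 1) (brt p q f g) h.
  have [pq|pq] := posnP (p + q); last by rewrite /cupt odd_predD.
  by rewrite -[br _ f g]/(brt p q f g) (brt00 pq hf.1 hg.1) /cupt !brace0m !sg0.
by rewrite abszM oddM odd_absz_deg /= negbK.
Qed.

Definition cohomology_gerstenhaber : gerstenhaber H :=
  Gerstenhaber hcup_linearr hcup_linearl hcupA hcup1l hcup1r hcupC
    hbr_linearr hbr_linearl hbr00 hbrC hbr_jacobi hbr_leibniz.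

Lemma cohomology_gerstenhaber_induced : induced_gerstenhaber cohomology_gerstenhaber.
Proof.
have V p (x : O p) : delta P x = 0 -> val (insubd (0 : cocycle P p) x) = x.
  by move=> dx; rewrite insubdK // /cocycle_pred unfold_in dx.
have D p (z : cocycle P p) : delta P (val z) = 0.
  exact/cocyc_delta/cocyc_val.
split=> [p q a b|p q a b|].
- exists (insubd 0 (cup P (val a) (val b))); first by rewrite V //; exact: delta_cup.
  by rewrite -!cls_val -[LHS]/(hcup _ _) hcup_emb // V //; exact: delta_cup.
- exists (insubd 0 (bracket P (val a) (val b))).
    by rewrite V //; exact: delta_bracket.
  by rewrite -!cls_val -[LHS]/(hbr _ _) hbr_emb // V //; exact: delta_bracket.
- have d0 : delta P (ounit P) = 0 by exact: (cocyc_delta cocyc_one).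
  exists (insubd 0 (ounit P)); first by rewrite V.
  by rewrite -cls_val V.
Qed.

End Cohomology.

(** * Balanced functions and Sweedler sums *)

Section LinearFunctions.
Variables (k : comNzRingType) (M N V : lmodType k).
Implicit Types f : M -> V.

Lemma linD f : linear f -> {morph f : x y / x + y}.
Proof. by move=> fL x y; have := fL 1 x y; rewrite !scale1r. Qed.

Lemma lin0 f : linear f -> f 0 = 0.
Proof. by move=> fL; apply: (addrI (f 0)); rewrite -(linD fL) !addr0. Qed.

Lemma linZ f c x : linear f -> f (c *: x) = c *: f x.
Proof. by move=> fL; have := fL c x 0; rewrite lin0 // !addr0. Qed.

Lemma linB f : linear f -> {morph f : x y / x - y}.
Proof.
by move=> fL x y; rewrite -scaleN1r (linD fL) (linZ _ _ fL) scaleN1r.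
Qed.

Lemma lin_sum f (I : Type) (r : seq I) (Q : pred I) (F : I -> M) : linear f ->
  f (\sum_(i <- r | Q i) F i) = \sum_(i <- r | Q i) f (F i).
Proof. by move=> fL; apply: (big_morph f (linD fL) (lin0 fL)). Qed.

Lemma lin_sum2 f (I J : Type) (r : seq I) (r' : I -> seq J) (F : I -> J -> M) :
  linear f -> f (\sum_(i <- r) \sum_(j <- r' i) F i j) =
    \sum_(i <- r) \sum_(j <- r' i) f (F i j).
Proof. by move=> fL; rewrite lin_sum //; apply: eq_bigr => i _; rewrite lin_sum. Qed.

Lemma linear_bigsum (I : Type) (r : seq I) (F : I -> M -> V) :
  (forall i, linear (F i)) -> linear (fun x => \sum_(i <- r) F i x).
Proof.
move=> FL c x y; rewrite scaler_sumr -big_split /=.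
by apply: eq_bigr => i _; rewrite FL.
Qed.

Lemma linear_comp (f : M -> V) (g : N -> M) :
  linear f -> linear g -> linear (fun x => f (g x)).
Proof. by move=> fL gL c x y; rewrite gL fL. Qed.

End LinearFunctions.

(** * Universal properties of presented modules and tensor products *)

Section PresentedLift.
Variables (k : comNzRingType) (T : choiceType) (V : lmodType k).

Definition extend (f : T -> V) (m : {malg k[T]}) : V :=
  \sum_(x <- msupp m) m@_x *: f x.

Lemma extendEw f (m : {malg k[T]}) (d : {fset T}) : (msupp m `<=` d)%fset ->
  extend f m = \sum_(x <- d) m@_x *: f x.
Proof.
move=> md; apply: big_fset_incl => // x _; rewrite -mcoeff_eq0 => /eqP ->.
by rewrite scale0r.
Qed.

Lemma extend_linear f : linear (extend f).
Proof.
move=> c m n; pose d := (msupp m `|` msupp n)%fset.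
have dm : (msupp m `<=` d)%fset by exact: fsubsetUl.
have dn : (msupp n `<=` d)%fset by exact: fsubsetUr.
have dmn : (msupp (c *: m + n) `<=` d)%fset.
  by apply: fsubset_trans (msuppD_le _ _) _; apply: fsetSU; exact: msuppZ_le.
rewrite (extendEw f dm) (extendEw f dn) (extendEw f dmn) scaler_sumr -big_split /=.
by apply: eq_bigr => x _; rewrite mcoeffD mcoeffZ scalerDl scalerA.
Qed.

Lemma extendU f x : extend f << x >> = f x.
Proof. by rewrite /extend msuppU oner_eq0 big_seq_fset1 mcoeffUU scale1r. Qed.

Lemma extend_add f x y z :
  f x = f y + f z -> extend f (<< x >> - << y >> - << z >>) = 0.
Proof.
move=> e; have B := linB (extend_linear f).
by rewrite !B !extendU e -addrA -opprD subrr.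
Qed.

Lemma extend_scale f c x y : f x = c *: f y -> extend f (<< x >> - c *: << y >>) = 0.
Proof.
move=> e; have B := linB (extend_linear f).
by rewrite B (linZ _ _ (extend_linear f)) !extendU e subrr.
Qed.

Lemma extend_eq f x y : f x = f y -> extend f (<< x >> - << y >>) = 0.
Proof.
by move=> e; have B := linB (extend_linear f); rewrite B !extendU e subrr.
Qed.

Lemma presented_lift (rel : {malg k[T]} -> Prop) (f : T -> V) :
  (forall r, rel r -> extend f r = 0) ->
  exists2 L : presented rel -> V, linear L & forall x, L (pgen rel x) = f x.
Proof.
move=> frel; pose L (q : presented rel) := extend f (repr q).
(* The kernel of [extend f] is a submodule containing the relations, hence their span; so [L] does
   not depend on the representative. *)
have LE m : L (qclass rel m) = extend f m.
  apply/eqP; rewrite -subr_eq0 -(linB (extend_linear f)); apply/eqP.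
  have /qclassP /asboolP E := qclassK (qclass rel m).
  apply: (E (fun m => extend f m = 0)) => //.
  - exact: lin0 (extend_linear f).
  - by move=> c u v u0 v0; rewrite extend_linear u0 v0 scaler0 addr0.
exists L => [c x y|x]; last by rewrite /pgen LE extendU.
by rewrite -(qclassK x) -(qclassK y) -linearP !LE extend_linear.
Qed.

End PresentedLift.

Section Balanced.
Variables (k : comNzRingType) (B : Type) (M N P V : lmodType k).

Record balanced (actM : M -> B -> M) (actN : B -> N -> N) (f : M -> N -> V) :
  Prop := Balanced {
  bal_l : forall y, linear (f ^~ y);
  bal_r : forall x, linear (f x);
  bal_m : forall x b y, f (actM x b) y = f x (actN b y)
}.

Lemma tensor_lift actM actN f : balanced actM actN f ->
  exists2 L : tensor actM actN -> V, linear L &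
    forall x y, L (tpure actM actN x y) = f x y.
Proof.
move=> [fl fr fm]; pose h (x : M * N) := f x.1 x.2.
have [|L LL LE] := @presented_lift _ _ _ (tensor_rel actM actN) h.
  move=> r; case=> [x x' y|x y y'|c x y|c x y|x b y].
  - by apply: extend_add; exact: (linD (fl y)).
  - by apply: extend_add; exact: (linD (fr x)).
  - by apply: extend_scale; exact: (linZ _ _ (fl y)).
  - by apply: extend_scale; exact: (linZ _ _ (fr x)).
  - by apply: extend_eq; exact: fm.
by exists L => // x y; rewrite /tpure LE.
Qed.

Lemma tpureDl (actM : M -> B -> M) (actN : B -> N -> N) x x' y :
  tpure actM actN (x + x') y = tpure actM actN x y + tpure actM actN x' y.
Proof.
rewrite /tpure /pgen -qclassD; apply/qclassP/asboolP => S _ _; rewrite opprD addrA.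
by apply; exact: TensorAddL.
Qed.

Lemma tpureDr (actM : M -> B -> M) (actN : B -> N -> N) x y y' :
  tpure actM actN x (y + y') = tpure actM actN x y + tpure actM actN x y'.
Proof.
rewrite /tpure /pgen -qclassD; apply/qclassP/asboolP => S _ _; rewrite opprD addrA.
by apply; exact: TensorAddR.
Qed.

Lemma tpureZr (actM : M -> B -> M) (actN : B -> N -> N) c x y :
  tpure actM actN x (c *: y) = c *: tpure actM actN x y.
Proof.
rewrite /tpure /pgen -linearZ; apply/qclassP/asboolP => S _ _.
by apply; exact: TensorScaleR.
Qed.

Record balanced3 (actM : M -> B -> M) (lactN : B -> N -> N)
    (ractN : N -> B -> N) (actP : B -> P -> P) (f : M -> N -> P -> V) : Prop :=
  Balanced3 {
  bal3_1 : forall y z, linear (fun x => f x y z);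
  bal3_2 : forall x z, linear (fun y => f x y z);
  bal3_3 : forall x y, linear (f x y);
  bal3_12 : forall x b y z, f (actM x b) y z = f x (lactN b y) z;
  bal3_23 : forall x y b z, f x (ractN y b) z = f x y (actP b z)
}.

Lemma tensor3_lift actM lactN ractN actP f :
  balanced3 actM lactN ractN actP f ->
  exists2 L : tensor3 actM lactN ractN actP -> V, linear L &
    forall x y z, L (tpure3 actM lactN ractN actP x y z) = f x y z.
Proof.
move=> [f1 f2 f3 f12 f23]; pose h (x : M * N * P) := f x.1.1 x.1.2 x.2.
have [|L LL LE] := @presented_lift _ _ _ (tensor3_rel actM lactN ractN actP) h.
  move=> r; case=> [x x' y z|x y y' z|x y z z'|c x y z|c x y z|c x y z|x b y z|x y b z].
  - by apply: extend_add; exact: (linD (f1 y z)).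
  - by apply: extend_add; exact: (linD (f2 x z)).
  - by apply: extend_add; exact: (linD (f3 x y)).
  - by apply: extend_scale; exact: (linZ _ _ (f1 y z)).
  - by apply: extend_scale; exact: (linZ _ _ (f2 x z)).
  - by apply: extend_scale; exact: (linZ _ _ (f3 x y)).
  - by apply: extend_eq; exact: f12.
  - by apply: extend_eq; exact: f23.
by exists L => // x y z; rewrite /tpure3 LE.
Qed.

End Balanced.

(* For a map f into a tensor product with Sweedler representatives R,
   [sweep R u g] is the sum of g over the two legs of f u. *)
Section Sweep.
Variables (k : comNzRingType) (X : Type) (M N : lmodType k).

Definition sweep (V : lmodType k) (R : X -> seq (M * N)) (u : X) (g : M -> N -> V) :=
  \sum_(x <- R u) g x.1 x.2.

Lemma eq_sweep (V : lmodType k) R u (g h : M -> N -> V) :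
  (forall x y, g x y = h x y) -> sweep R u g = sweep R u h.
Proof. by move=> gh; apply: eq_bigr => x _. Qed.

Lemma sweep_bigsum (V : lmodType k) R u (I : Type) (r : seq I)
    (g : I -> M -> N -> V) :
  sweep R u (fun x y => \sum_(i <- r) g i x y) = \sum_(i <- r) sweep R u (g i).
Proof. by rewrite /sweep exchange_big. Qed.

Lemma linear_sweep (V W : lmodType k) R u (g : W -> M -> N -> V) :
  (forall x y, linear (fun w => g w x y)) -> linear (fun w => sweep R u (g w)).
Proof. by move=> gL; apply: linear_bigsum => x; exact: gL. Qed.

Lemma sweep_lin (V W : lmodType k) R u (g : M -> N -> V) (F : V -> W) : linear F ->
  F (sweep R u g) = sweep R u (fun x y => F (g x y)).
Proof. by move=> FL; rewrite /sweep lin_sum. Qed.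

Variables (B : Type) (actM : M -> B -> M) (actN : B -> N -> N).
Variable (f : X -> tensor actM actN).

(** One map [L] serves all representatives and all [u]: applying it to an identity in the tensor
    product yields an identity of Sweedler sums. *)
Lemma sweepE (V : lmodType k) (g : M -> N -> V) : balanced actM actN g ->
  exists L : tensor actM actN -> V, [/\ linear L,
    forall x y, L (tpure actM actN x y) = g x y &
    forall R, sweedler f R -> forall u, sweep R u g = L (f u)].
Proof.
move=> /tensor_lift[L LL LE]; exists L; split=> // R hR u.
by rewrite hR lin_sum //; apply: eq_bigr => x _; rewrite LE.
Qed.

Lemma sweep_irrel (V : lmodType k) (g : M -> N -> V) R R' u :
  balanced actM actN g -> sweedler f R -> sweedler f R' -> sweep R u g = sweep R' u g.
Proof. by move=> /sweepE[L [_ _ LE]] hR hR'; rewrite !LE. Qed.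

End Sweep.

(** * Coproduct identities, tested on balanced functions *)

Section BialgebroidSums.
Variables (k : comNzRingType) (A U : algType k) (H : left_bialgebroid A U).
Local Notation s := (src H).
Local Notation t := (tgt H).
Local Notation eps := (counit H).

Lemma ktpure_linearl (M N : lmodType k) (y : N) : linear (fun x : M => ktpure x y).
Proof. by move=> c u v; rewrite /ktpure tpureDl tpureZl. Qed.

Lemma ktpure_linearr (M N : lmodType k) (x : M) : linear (fun y : N => ktpure x y).
Proof. by move=> c u v; rewrite /ktpure tpureDr tpureZr. Qed.

Lemma UmulA (x y z : U) : x * (y * z) = x * y * z. Proof. exact: mulrA. Qed.
Lemma mull_linear (x : U) : linear (fun y : U => x * y).
Proof. by move=> c y z; rewrite mulrDr scalerAr. Qed.
Lemma mulr_linear (x : U) : linear (fun y : U => y * x).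
Proof. by move=> c y z; rewrite mulrDl scalerAl. Qed.

Lemma src_linear : linear s.
Proof. by move=> c a b; rewrite /src ktpure_linearl linearP. Qed.
Lemma tgt_linear : linear t.
Proof. by move=> c a b; rewrite /tgt ktpure_linearr linearP. Qed.

Lemma src1 : s 1 = 1. Proof. exact: eta1. Qed.
Lemma tgt1 : t 1 = 1. Proof. exact: eta1. Qed.
Lemma srcM a b : s (a * b) = s a * s b.
Proof. by rewrite /src -etaM mul1r. Qed.
Lemma tgtM a b : t (a * b) = t b * t a.
Proof. by rewrite /tgt -etaM mul1r. Qed.
Lemma src_tgt a b : s a * t b = t b * s a.
Proof. by rewrite /src /tgt -!etaM !mul1r !mulr1. Qed.

Lemma counit_src a u : eps (s a * u) = a * eps u.
Proof. by have := counitLR H a 1 u; rewrite tgt1 !mulr1. Qed.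
Lemma counit_tgt a u : eps (t a * u) = eps u * a.
Proof. by have := counitLR H 1 a u; rewrite src1 !mul1r. Qed.

Definition balU (V : lmodType k) := @balanced k A U U V (ract H) (lact H).

Definition bal3U (V : lmodType k) (f : U -> U -> U -> V) :=
  balanced3 (ract H) (lact H) (ract H) (lact H) f.

Variable Q : U -> seq (U * U).
Hypothesis hQ : sweedler (Delta H) Q.

Section Values.
Variables (V : lmodType k) (f : U -> U -> V).
Hypothesis hf : balU f.

Lemma sweepU_linear : linear (fun u => sweep Q u f).
Proof.
have [L [LL _ LE]] := sweepE (Delta H) hf; move=> c u v.
by rewrite !LE // linearP LL.
Qed.

Lemma sweepU_mul u v :
  sweep Q (u * v) f = sweep Q u (fun x y => sweep Q v (fun z w => f (x * z) (y * w))).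
Proof.
have [L [LL LP LE]] := sweepE (Delta H) hf.
rewrite LE // (DeltaM hQ) lin_sum //; apply: eq_bigr => x _.
by rewrite lin_sum //; apply: eq_bigr => y _; exact: LP.
Qed.

Lemma sweepU_one : sweep Q 1 f = f 1 1.
Proof. by have [L [LL LP LE]] := sweepE (Delta H) hf; rewrite LE // Delta1 LP. Qed.

Lemma sweepU_LR a b u :
  sweep Q (s a * t b * u) f = sweep Q u (fun x y => f (s a * x) (t b * y)).
Proof.
have [L [LL LP LE]] := sweepE (Delta H) hf.
rewrite LE // (DeltaLR hQ) lin_sum //.
by apply: eq_bigr => x _; exact: LP.
Qed.

Lemma sweepU_src a u : sweep Q (s a * u) f = sweep Q u (fun x y => f (s a * x) y).
Proof.
have := sweepU_LR a 1 u; rewrite tgt1 mulr1 => ->.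
by apply: eq_sweep => x y; rewrite mul1r.
Qed.

Lemma sweepU_tgt a u : sweep Q (t a * u) f = sweep Q u (fun x y => f x (t a * y)).
Proof.
have := sweepU_LR 1 a u; rewrite src1 mul1r => ->.
by apply: eq_sweep => x y; rewrite mul1r.
Qed.

Lemma sweepU_takeuchi a u :
  sweep Q u (fun x y => f (x * t a) y) = sweep Q u (fun x y => f x (y * s a)).
Proof.
have [L [LL LP LE]] := sweepE (Delta H) hf.
have := congr1 L (Delta_takeuchi hQ u a); rewrite !lin_sum // => E.
transitivity (\sum_(x <- Q u) L (tUU H (x.1 * t a) x.2)).
  by apply: eq_bigr => x _; rewrite -LP.
by rewrite E; apply: eq_bigr => x _; rewrite -LP.
Qed.

End Values.

Lemma balU_mul (V : lmodType k) (f : U -> U -> V) x y : balU f ->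
  balU (fun z w => f (z * x) (w * y)).
Proof.
move=> [fl fr fm]; split.
- by move=> w; apply: (linear_comp (fl _)) => c u v; rewrite mulrDl scalerAl.
- by move=> z; apply: (linear_comp (fr _)) => c u v; rewrite mulrDl scalerAl.
- by move=> z a w; rewrite /ract /lact -!mulrA; exact: fm.
Qed.

Lemma balU_tgt (V : lmodType k) (f : U -> U -> V) a : balU f ->
  balU (fun x y => f x (t a * y)).
Proof.
move=> [fl fr fm]; split=> [y|x|x b y]; first exact: fl.
- by apply: (linear_comp (fr _)) => c u v; rewrite mulrDr scalerAr.
- by rewrite /lact mulrA -src_tgt -mulrA; exact: fm.
Qed.

Lemma balU_src (V : lmodType k) (f : U -> U -> V) a : balU f ->
  balU (fun x y => f (s a * x) y).
Proof.
move=> [fl fr fm]; split=> [y|x|x b y]; last 1 first.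
- by rewrite /ract mulrA src_tgt -mulrA; exact: fm.
- by apply: (linear_comp (fl _)) => c u v; rewrite mulrDr scalerAr.
- exact: fr.
Qed.

(** Left multiplication by Delta(u) respects the balancing over A by the Takeuchi condition. *)
Lemma balU_sweep_mul (V : lmodType k) (f : U -> U -> V) u : balU f ->
  balU (fun z w => sweep Q u (fun x y => f (x * z) (y * w))).
Proof.
move=> hf; have [fl fr fm] := hf; split.
- move=> w; apply: linear_sweep => x y; apply: (linear_comp (fl _)).
  by move=> c p q; rewrite mulrDr scalerAr.
- move=> z; apply: linear_sweep => x y; apply: (linear_comp (fr _)).
  by move=> c p q; rewrite mulrDr scalerAr.
- move=> z b w; rewrite /ract /lact.
  transitivity (sweep Q u (fun x y => f (x * t b * z) (y * w))).
    by apply: eq_sweep => x y; rewrite mulrA.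
  rewrite (sweepU_takeuchi (balU_mul z w hf)).
  by apply: eq_sweep => x y; rewrite mulrA.
Qed.

Lemma sweepU_mulr (V : lmodType k) (f : U -> U -> V) u v : balU f ->
  sweep Q (u * v) f = sweep Q v (fun z w => sweep Q u (fun x y => f (x * z) (y * w))).
Proof. by move=> hf; rewrite sweepU_mul // /sweep exchange_big. Qed.

(** Writing t(a) as t(a) 1 gives Delta(t(a)) = 1 (x) t(a); the rest is multiplicativity of Delta. *)
Lemma sweepU_mulr_tgt (V : lmodType k) (f : U -> U -> V) a u : balU f ->
  sweep Q (u * t a) f = sweep Q u (fun x y => f x (y * t a)).
Proof.
move=> hf; have B := balU_sweep_mul u hf.
rewrite sweepU_mulr // -[t a]mulr1 (sweepU_tgt B) (sweepU_one (balU_tgt a B)).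
by apply: eq_sweep => x y; rewrite !mulr1.
Qed.

Lemma sweepU_mulr_src (V : lmodType k) (f : U -> U -> V) a u : balU f ->
  sweep Q (u * s a) f = sweep Q u (fun x y => f (x * s a) y).
Proof.
move=> hf; have B := balU_sweep_mul u hf.
rewrite sweepU_mulr // -[s a]mulr1 (sweepU_src B) (sweepU_one (balU_src a B)).
by apply: eq_sweep => x y; rewrite !mulr1.
Qed.

Lemma sweepU_assoc (V : lmodType k) (f : U -> U -> U -> V) u : bal3U f ->
  sweep Q u (fun x z => sweep Q x (fun x' y => f x' y z)) =
  sweep Q u (fun x y => sweep Q y (fun y' z => f x y' z)).
Proof.
move=> /tensor3_lift[L LL LP].
have E := etrans (congr1 L (DeltaA hQ u)) (lin_sum2 _ _ _ LL).
rewrite (lin_sum2 _ _ _ LL) in E.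
transitivity (\sum_(x <- Q u) \sum_(y <- Q x.1) L (tUUU H y.1 y.2 x.2)).
  by apply: eq_bigr => x _; apply: eq_bigr => y _; symmetry; exact: LP.
by rewrite E; apply: eq_bigr => x _; apply: eq_bigr => y _; exact: LP.
Qed.

Lemma sweepU_counitl u : sweep Q u (fun x y => s (eps x) * y) = u.
Proof. exact: (Delta_counitl hQ). Qed.

Lemma sweepU_counitr u : sweep Q u (fun x y => t (eps y) * x) = u.
Proof. exact: (Delta_counitr hQ). Qed.

End BialgebroidSums.

(** * Coaction identities, tested on balanced functions *)

Section YetterDrinfeldSums.
Variables (k : comNzRingType) (A U : algType k) (H : left_bialgebroid A U).
Variables (N : lmodType k) (Y : yd_algebra H N).
Local Notation s := (src H).
Local Notation t := (tgt H).
Local Notation eps := (counit H).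
Local Notation "n '.*' m" := (nmul Y n m) (at level 40, left associativity).

Lemma Ylinr u : linear (Y u). Proof. exact: act_linear. Qed.
Lemma Ylinl n : linear (fun u => Y u n). Proof. exact: act_linearl. Qed.
Lemma Y1 n : Y 1 n = n. Proof. exact: act1. Qed.
Lemma YM u v n : Y (u * v) n = Y u (Y v n). Proof. by rewrite actA. Qed.

Definition balN (V : lmodType k) := @balanced k A U N V (ract H) (cact (ucoact Y)).

Lemma balNP (V : lmodType k) (f : U -> N -> V) :
  (forall n, linear (f ^~ n)) -> (forall u, linear (f u)) ->
  (forall a u n, f (t a * u) n = f u (Y (s a) n)) -> balN f.
Proof. by move=> fl fr fm; split=> // u a n; rewrite yd_lact -fm. Qed.

Lemma balNE (V : lmodType k) (f : U -> N -> V) a u n : balN f ->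
  f (t a * u) n = f u (Y (s a) n).
Proof. by move=> [_ _ fm]; rewrite -yd_lact -fm. Qed.

Definition bal3N (V : lmodType k) (f : U -> U -> N -> V) :=
  balanced3 (ract H) (lact H) (ract H) (cact (ucoact Y)) f.

Variables (Q : U -> seq (U * U)) (R : N -> seq (U * N)).
Hypotheses (hQ : sweedler (Delta H) Q) (hR : sweedler (yd_coact Y) R).

Section Values.
Variables (V : lmodType k) (f : U -> N -> V).
Hypothesis hf : balN f.

Lemma sweepN_linear : linear (fun n => sweep R n f).
Proof.
have [L [LL _ LE]] := sweepE (yd_coact Y) hf; move=> c u v.
by rewrite !LE // linearP LL.
Qed.

Lemma sweepN_src a n : sweep R (Y (s a) n) f = sweep R n (fun u m => f (s a * u) m).
Proof.
have [L [LL LP LE]] := sweepE (yd_coact Y) hf.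
rewrite LE // -yd_lact /yd_coact (coactL hR) lin_sum //.
by apply: eq_bigr => x _; exact: LP.
Qed.

Lemma sweepN_mul n n' : sweep R (n .* n') f =
  sweep R n (fun u m => sweep R n' (fun u' m' => f (u * u') (m .* m'))).
Proof.
have [L [LL LP LE]] := sweepE (yd_coact Y) hf.
rewrite LE // (nmul_coact hR) lin_sum //; apply: eq_bigr => x _.
by rewrite lin_sum //; apply: eq_bigr => y _; exact: LP.
Qed.

Lemma sweepN_none : sweep R (none Y) f = f 1 (none Y).
Proof.
by have [L [LL LP LE]] := sweepE (yd_coact Y) hf; rewrite LE // none_coact [LHS]LP.
Qed.

Lemma sweepN_act u n :
  sweep Q u (fun x y => sweep R (Y x n) (fun v m => f (v * y) m)) =
  sweep Q u (fun x y => sweep R n (fun v m => f (x * v) (Y y m))).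
Proof.
have [L [LL LP LE]] := sweepE (yd_coact Y) hf.
have := congr1 L (yd_compat hQ hR u n); rewrite !(lin_sum2 _ _ _ LL) => E.
transitivity (\sum_(x <- Q u) \sum_(y <- R (Y x.1 n))
    L (tUN H (cact (ucoact Y)) (y.1 * x.2) y.2)).
  by apply: eq_bigr => x _; apply: eq_bigr => y _; symmetry; exact: LP.
by rewrite E; apply: eq_bigr => x _; apply: eq_bigr => y _; exact: LP.
Qed.

End Values.

Lemma sweepN_assoc (V : lmodType k) (f : U -> U -> N -> V) n : bal3N f ->
  sweep R n (fun u m => sweep Q u (fun x y => f x y m)) =
  sweep R n (fun u m => sweep R m (fun v m' => f u v m')).
Proof.
move=> /tensor3_lift[L LL LP]; have := congr1 L (coactA hQ hR n).
rewrite !(lin_sum2 _ _ _ LL) => E.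
transitivity (\sum_(x <- R n) \sum_(y <- Q x.1)
    L (tUUN H (cact (ucoact Y)) y.1 y.2 x.2)).
  by apply: eq_bigr => x _; apply: eq_bigr => y _; symmetry; exact: LP.
by rewrite E; apply: eq_bigr => x _; apply: eq_bigr => y _; exact: LP.
Qed.

Lemma sweepN_ract n a : sweep R n (fun u m => Y (s (eps (u * t a))) m) = Y (t a) n.
Proof. by rewrite -(yd_ract hR); apply: eq_bigr => x _; rewrite yd_lact. Qed.

Lemma balN_mul (V : lmodType k) (f : U -> N -> V) w : balN f ->
  balN (fun u n => f (u * w) n).
Proof.
move=> hf; have [fl fr _] := hf; apply: balNP => [n|u|a u n].
- by apply: (linear_comp (fl n)) => c u v; rewrite mulrDl scalerAl.
- exact: fr.
- by rewrite -mulrA; exact: balNE.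
Qed.

(* The right A-action on N is visible through its coaction: the coaction of n is
   unchanged when t(a) is moved from the N-leg to the U-leg. *)
Lemma sweepN_tgtr (V : lmodType k) (f : U -> N -> V) n a : balN f ->
  sweep R n (fun u m => f u (Y (t a) m)) = sweep R n (fun u m => f (u * t a) m).
Proof.
move=> hf; have [fl fr _] := hf.
have tM b c u m : f (t b * (t c * u)) m = f (t (c * b) * u) m by rewrite mulrA -tgtM.
(* t(a) m is the induced right action: the sum of eps(v t(a)) m' over the coaction v (x) m' of m. *)
transitivity (sweep R n (fun u m => sweep R m (fun v m' =>
    f (t (eps (v * t a)) * u) m'))).
  apply: eq_sweep => u m; rewrite -(sweepN_ract m a) (sweep_lin _ _ _ (fr u)).
  by apply: eq_sweep => v m'; rewrite balNE.
have tl c p q x : t (c *: p + q) * x = c *: (t p * x) + t q * x.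
  by rewrite tgt_linear mulrDl scalerAl.
rewrite -(@sweepN_assoc _ (fun u v m' => f (t (eps (v * t a)) * u) m')); last first.
  split.
  - move=> v m; apply: (linear_comp (fl m)) => c x y.
    by rewrite mulrDr scalerAr.
  - move=> u m; apply: (linear_comp (fl m)) => c x y.
    by rewrite mulrDl -scalerAl linearP tl.
  - by move=> u v; exact: fr.
  - by move=> u b v m; rewrite /ract /lact -mulrA counit_src tM.
  - move=> u v b m; rewrite /ract -mulrA counit_tgt yd_lact -(balNE _ _ _ hf).
    by rewrite tM.
apply: eq_sweep => u m.
have B : balU H (fun x y => f (t (eps y) * x) m).
  split.
  - by move=> y; apply: (linear_comp (fl m)) => c p q; rewrite mulrDr scalerAr.
  - by move=> x; apply: (linear_comp (fl m)) => c p q; rewrite linearP tl.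
  - by move=> x b y; rewrite /ract /lact counit_src tM.
(* After coassociativity both legs belong to Delta(u t(a)), and the right counit law collapses them
   to u t(a). *)
rewrite -(sweepU_mulr_tgt hQ a u B).
rewrite -{2}(sweepU_counitr hQ (u * t a)).
by rewrite (sweep_lin _ _ _ (fl m)).
Qed.

(** The right action comes from the coaction through eps(n_(-1) t(a)). Coassociativity brings this
    scalar onto the coproduct of n_(-1), the Takeuchi condition trades t(a) on the first leg for
    s(a) on the second, and the left counit law collapses the sum. *)
Lemma sweepN_tgt (V : lmodType k) (f : U -> N -> V) n a : balN f ->
  sweep R (Y (t a) n) f = sweep R n (fun u m => f (u * s a) m).
Proof.
move=> hf; have [fl fr _] := hf.
have sl c p q x : s (c *: p + q) * x = c *: (s p * x) + s q * x.
  by rewrite src_linear mulrDl scalerAl.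
rewrite -(sweepN_ract n a) (sweep_lin _ _ _ (sweepN_linear hf)).
transitivity (sweep R n (fun u m => sweep R m (fun v m' =>
    f (s (eps (u * t a)) * v) m'))).
  by apply: eq_sweep => u m; rewrite sweepN_src.
have sM b c u m : f (s b * (s c * u)) m = f (s (b * c) * u) m by rewrite mulrA -srcM.
rewrite -(@sweepN_assoc _ (fun u v m' => f (s (eps (u * t a)) * v) m')); last first.
  split.
  - move=> v m; apply: (linear_comp (fl m)) => c x y.
    by rewrite mulrDl -scalerAl linearP sl.
  - move=> u m; apply: (linear_comp (fl m)) => c x y.
    by rewrite mulrDr scalerAr.
  - by move=> u v; exact: fr.
  - by move=> u b v m; rewrite /ract /lact -mulrA counit_tgt sM.
  - move=> u v b m; rewrite /ract yd_lact -(balNE _ _ _ hf).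
    by rewrite !mulrA src_tgt.
apply: eq_sweep => u m.
have B : balU H (fun x y => f (s (eps x) * y) m).
  split.
  - by move=> y; apply: (linear_comp (fl m)) => c p q; rewrite linearP sl.
  - by move=> x; apply: (linear_comp (fl m)) => c p q; rewrite mulrDr scalerAr.
  - by move=> x b y; rewrite /ract /lact counit_tgt sM.
rewrite (sweepU_takeuchi hQ B) -{2}(sweepU_counitl hQ u).
have FL : linear (fun x => f (x * s a) m).
  by apply: (linear_comp (fl m)) => c p q; rewrite mulrDl scalerAl.
by rewrite (sweep_lin _ _ _ FL); apply: eq_sweep => x y; rewrite mulrA.
Qed.

End YetterDrinfeldSums.

(** * Coproducts of lists of arguments *)

Section ListCoproducts.
Variables (k : comNzRingType) (A U : algType k) (H : left_bialgebroid A U).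
Local Notation s := (src H).
Local Notation t := (tgt H).
Local Notation eps := (counit H).

(** No length is fixed, so that lists of arguments can be split, joined and contracted without
    tracking arities. *)
Record multi (V : lmodType k) (f : seq U -> V) : Prop := Multi {
  multi_lin : forall s1 s2, linear (fun u => f (s1 ++ u :: s2));
  multi_bal : forall s1 s2 u a v,
    f (s1 ++ (u * t a) :: v :: s2) = f (s1 ++ u :: (t a * v) :: s2)
}.

(* The functions that can be evaluated on the iterated coproduct of a list: the
   value at [fsts c], [snds c] summed over [c] is well defined. *)
Record mixed (V : lmodType k) (f : seq U -> U -> V) : Prop := Mixed {
  mixed_multi : forall w, multi (f ^~ w);
  mixed_lin : forall vs, linear (f vs);
  mixed_tgt : forall a v vs w, f ((t a * v) :: vs) w = f (v :: vs) (s a * w)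
}.

Variable Q : U -> seq (U * U).
Hypothesis hQ : sweedler (Delta H) Q.

Definition cosum (V : lmodType k) (us : seq U) (f : seq U -> U -> V) : V :=
  \sum_(c <- coprods Q us) f (fsts c) (snds c).

(** Absorbs the first argument into the function: statements about [cosum] follow by induction on
    the list with [f] generalised, [contract_mixed] being the invariant. *)
Definition contract (V : lmodType k) (u : U) (f : seq U -> U -> V) : seq U -> U -> V :=
  fun vs w => sweep Q u (fun x y => f (x :: vs) (y * w)).

Lemma eq_cosum (V : lmodType k) us (f g : seq U -> U -> V) :
  (forall vs w, f vs w = g vs w) -> cosum us f = cosum us g.
Proof. by move=> fg; apply: eq_bigr => c _. Qed.

Lemma cosum_nil (V : lmodType k) (f : seq U -> U -> V) : cosum [::] f = f [::] 1.
Proof. by rewrite /cosum big_seq1 /snds big_nil. Qed.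

Lemma cosum_cons (V : lmodType k) u us (f : seq U -> U -> V) :
  cosum (u :: us) f = sweep Q u (fun x y => cosum us (fun vs w => f (x :: vs) (y * w))).
Proof.
rewrite /cosum /= big_allpairs_dep; apply: eq_bigr => x _; apply: eq_bigr => c _.
by rewrite /snds big_cons.
Qed.

Lemma cosum_contract (V : lmodType k) u us (f : seq U -> U -> V) :
  cosum (u :: us) f = cosum us (contract u f).
Proof. by rewrite cosum_cons /sweep /cosum exchange_big. Qed.

Lemma cosum_cat (V : lmodType k) us us' (f : seq U -> U -> V) :
  cosum (us ++ us') f =
  cosum us (fun vs w => cosum us' (fun vs' w' => f (vs ++ vs') (w * w'))).
Proof.
elim: us f => [|u us IH] f.
  by rewrite cosum_nil; apply: eq_cosum => vs w; rewrite mul1r.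
rewrite /= !cosum_cons; apply: eq_sweep => x y; rewrite IH.
by apply: eq_cosum => vs w; apply: eq_cosum => vs' w'; rewrite mulrA.
Qed.

Lemma cosum_bigsum (V : lmodType k) us (I : Type) (r : seq I)
    (f : I -> seq U -> U -> V) :
  cosum us (fun vs w => \sum_(i <- r) f i vs w) = \sum_(i <- r) cosum us (f i).
Proof. by rewrite /cosum exchange_big. Qed.

Lemma cosum_exchange (V : lmodType k) us us' (f : seq U -> U -> seq U -> U -> V) :
  cosum us (fun vs w => cosum us' (f vs w)) =
  cosum us' (fun vs' w' => cosum us (fun vs w => f vs w vs' w')).
Proof. by rewrite /cosum exchange_big. Qed.

Lemma cosum_sweep (V X : lmodType k) (T : Type) (R : T -> seq (U * X)) us n
    (f : seq U -> U -> U -> X -> V) :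
  cosum us (fun vs w => sweep R n (f vs w)) =
  sweep R n (fun x y => cosum us (fun vs w => f vs w x y)).
Proof. by rewrite /cosum /sweep exchange_big. Qed.

Lemma linear_cosum (V W : lmodType k) us (f : W -> seq U -> U -> V) :
  (forall vs w, linear (fun x => f x vs w)) -> linear (fun x => cosum us (f x)).
Proof. by move=> fL; apply: linear_bigsum => c; exact: fL. Qed.

Lemma cosum_lin (V W : lmodType k) us (f : seq U -> U -> V) (F : V -> W) : linear F ->
  F (cosum us f) = cosum us (fun vs w => F (f vs w)).
Proof. by move=> FL; rewrite /cosum lin_sum. Qed.

Lemma multi_bigsum (V : lmodType k) (I : Type) (r : seq I) (f : I -> seq U -> V) :
  (forall i, multi (f i)) -> multi (fun us => \sum_(i <- r) f i us).
Proof.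
move=> fm; split=> [s1 s2|s1 s2 u a v].
  by apply: linear_bigsum => i; exact: multi_lin (fm i) _ _.
by apply: eq_bigr => i _; exact: multi_bal (fm i) _ _ _ _ _.
Qed.

Lemma multi_comp (V W : lmodType k) (f : seq U -> V) (F : V -> W) :
  linear F -> multi f -> multi (fun us => F (f us)).
Proof.
move=> FL [fl fb]; split=> [s1 s2|s1 s2 u a v]; last by rewrite fb.
exact: linear_comp FL (fl s1 s2).
Qed.

Lemma multi_catl (V : lmodType k) (f : seq U -> V) vs :
  multi f -> multi (fun us => f (vs ++ us)).
Proof.
move=> [fl fb]; split=> [s1 s2|s1 s2 u a v]; last by rewrite !catA fb.
by move=> c u v; rewrite !catA fl.
Qed.

Lemma multi_catr (V : lmodType k) (f : seq U -> V) vs :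
  multi f -> multi (fun us => f (us ++ vs)).
Proof.
move=> [fl fb]; split=> [s1 s2|s1 s2 u a v]; last by rewrite -!catA /= fb.
by move=> c u v; rewrite -!catA /= fl.
Qed.

Lemma mixed_balU (V : lmodType k) (f : seq U -> U -> V) vs w : mixed f ->
  balU H (fun x y => f (x :: vs) (y * w)).
Proof.
move=> [fm fl ft]; split.
- by move=> y; exact: (multi_lin (fm (y * w)) [::] vs).
- by move=> x; apply: (linear_comp (fl _)); exact: mulr_linear.
- by move=> x a y; rewrite /lact -UmulA -ft.
Qed.

Lemma contract_linear (V : lmodType k) (f : seq U -> U -> V) vs w : mixed f ->
  linear (fun u => contract u f vs w).
Proof. by move=> fm c u v; exact: (sweepU_linear hQ (mixed_balU vs w fm) c u v). Qed.

(** t(a) on the new head is balanced against u_(1), and the Takeuchi condition turns it into s(a) to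
    the right of u_(2), that is, to the left of [w]. *)
Lemma contract_mixed (V : lmodType k) u (f : seq U -> U -> V) :
  mixed f -> mixed (contract u f).
Proof.
move=> fmx; have [fm fl ft] := fmx; split.
- move=> w; apply: multi_bigsum => x.
  exact: (@multi_catl _ (f ^~ (x.2 * w)) [:: x.1] (fm _)).
- move=> vs; apply: linear_sweep => x y; apply: (linear_comp (fl _)).
  exact: mull_linear.
- move=> a v vs w; rewrite /contract.
  have B := mixed_balU (v :: vs) w fmx.
  transitivity (sweep Q u (fun x y => f ((x * t a) :: v :: vs) (y * w))).
    by apply: eq_sweep => x y; rewrite (multi_bal (fm _) [::]).
  rewrite (sweepU_takeuchi hQ B); apply: eq_sweep => x y.
  by rewrite UmulA.
Qed.

(** Delta(u t(a)) and Delta(t(a) v) both leave t(a) on the second leg, in the same place between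
    u_(2) and v_(2), so the products of second legs agree. *)
Lemma cosum_multi (V : lmodType k) (f : seq U -> U -> V) :
  mixed f -> multi (fun us => cosum us f).
Proof.
move=> fm; split=> s1; elim: s1 f fm => [|u1 s1 IH] f fm s2.
- move=> c u v; rewrite /= !cosum_contract.
  rewrite /cosum scaler_sumr -big_split /=; apply: eq_bigr => x _.
  exact: contract_linear.
- move=> c u v; rewrite /= !cosum_contract.
  exact: (IH (contract u1 f) (contract_mixed u1 fm)).
- move=> u a v; rewrite /= !cosum_contract; apply: eq_cosum => vs w.
  have B := mixed_balU vs w (contract_mixed u fm).
  rewrite /contract (sweepU_tgt hQ B); apply: eq_sweep => x y.
  rewrite (sweepU_mulr_tgt hQ a u (mixed_balU _ _ fm)).
  by apply: eq_sweep => x' y'; rewrite !UmulA.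
- move=> u a v; rewrite /= !(cosum_contract u1).
  exact: (IH (contract u1 f) (contract_mixed u1 fm)).
Qed.

Lemma cosum_tgt (V : lmodType k) (f : seq U -> U -> V) a u us : mixed f ->
  cosum ((t a * u) :: us) f = cosum (u :: us) (fun vs w => f vs (t a * w)).
Proof.
move=> fm; rewrite !cosum_contract; apply: eq_cosum => vs w.
rewrite /contract (sweepU_tgt hQ (mixed_balU _ _ fm)).
by apply: eq_sweep => x y; rewrite UmulA.
Qed.

Lemma cosum_mulr_tgt (V : lmodType k) (f : seq U -> U -> V) a u us : mixed f ->
  cosum (rcons us (u * t a)) f = cosum (rcons us u) (fun vs w => f vs (w * t a)).
Proof.
elim: us f => [|u1 us IH] f fm.
  rewrite /= !cosum_contract !cosum_nil /contract.
  rewrite (sweepU_mulr_tgt hQ a u (mixed_balU _ _ fm)).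
  by apply: eq_sweep => x y; rewrite !mulr1.
rewrite /= !cosum_contract IH; last exact: contract_mixed.
by apply: eq_cosum => vs w; apply: eq_sweep => x y; rewrite UmulA.
Qed.

(* The Takeuchi condition for lists: t(a) on the slot following the contracted
   ones becomes s(a) on the right of the product of second legs. *)
Lemma cosum_takeuchi (V : lmodType k) (f : seq U -> U -> V) a v T us : mixed f ->
  cosum us (fun vs w => f (vs ++ (t a * v) :: T) w) =
  cosum us (fun vs w => f (vs ++ v :: T) (w * s a)).
Proof.
elim: us f => [|u us IH] f fm.
  by rewrite !cosum_nil /= (mixed_tgt fm) mulr1 mul1r.
have := IH _ (contract_mixed u fm); rewrite !cosum_contract => E.
transitivity (cosum us (fun vs w => contract u f (vs ++ (t a * v) :: T) w)).
  by [].
rewrite E; apply: eq_cosum => vs w; apply: eq_sweep => x y.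
by rewrite UmulA.
Qed.

Lemma mixed_append (V : lmodType k) (f : seq U -> U -> V) T :
  mixed f -> mixed (fun vs w => f (vs ++ T) w).
Proof.
move=> [fm fl ft]; split=> [w|vs|a v vs w]; first exact: multi_catr (fm w).
- exact: fl.
- exact: ft.
Qed.

(** The analogue of [mixed] for a threefold coproduct: [vs] holds the first legs, [w] and [z] are
    the products of the second and of the third legs. *)
Record mixed2 (V : lmodType k) (f : seq U -> U -> U -> V) : Prop := Mixed2 {
  mixed2_multi : forall w z, multi (fun vs => f vs w z);
  mixed2_lin1 : forall vs z, linear (fun w => f vs w z);
  mixed2_lin2 : forall vs w, linear (f vs w);
  mixed2_tgt : forall a v vs w z, f ((t a * v) :: vs) w z = f (v :: vs) (s a * w) z;
  mixed2_bal : forall vs a w z, f vs (t a * w) z = f vs w (s a * z)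
}.

Lemma mixed2_balU (V : lmodType k) (f : seq U -> U -> U -> V) vs : mixed2 f ->
  balU H (f vs).
Proof. by move=> [fm f1 f2 ft fb]; split=> // x a y; exact: fb. Qed.

(** The invariant for [cosum_coassoc]. To move t(a) off the head, the Takeuchi condition puts s(a)
    to the right of u_(2), and Delta(y s(a)) = y_(1) s(a) (x) y_(2) leaves it on the middle leg. *)
Lemma mixed2_cons (V : lmodType k) (f : seq U -> U -> U -> V) u : mixed2 f ->
  mixed2 (fun vs w z => sweep Q u (fun x y =>
    sweep Q y (fun y1 y2 => f (x :: vs) (y1 * w) (y2 * z)))).
Proof.
move=> fm2; have [fm f1 f2 ft fb] := fm2.
have B x vs w z := balU_mul w z (mixed2_balU (x :: vs) fm2).
split.
- move=> w z; apply: multi_bigsum => x; apply: multi_bigsum => y.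
  exact: (@multi_catl _ (fun vs => f vs (y.1 * w) (y.2 * z)) [:: x.1] (fm _ _)).
- move=> vs z; apply: linear_sweep => x y; apply: linear_sweep => y1 y2.
  by apply: (linear_comp (f1 _ _)); exact: mull_linear.
- move=> vs w; apply: linear_sweep => x y; apply: linear_sweep => y1 y2.
  by apply: (linear_comp (f2 _ _)); exact: mull_linear.
- move=> a v vs w z.
  pose h x y := sweep Q y (fun y1 y2 => f (x :: v :: vs) (y1 * w) (y2 * z)).
  have hB : balU H h.
    split=> [y|x|x b y].
    + apply: linear_sweep => y1 y2.
      exact: (multi_lin (fm (y1 * w) (y2 * z)) [::]).
    + by move=> c p q; exact: (sweepU_linear hQ (B x (v :: vs) w z)).
    + rewrite /h /lact (sweepU_src hQ (B _ _ _ _)); apply: eq_sweep => y1 y2.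
      by rewrite ft UmulA.
  transitivity (sweep Q u (fun x y => h (x * t a) y)).
    apply: eq_sweep => x y; apply: eq_sweep => y1 y2.
    by rewrite (multi_bal (fm _ _) [::]).
  rewrite (sweepU_takeuchi hQ hB); apply: eq_sweep => x y.
  rewrite /h (sweepU_mulr_src hQ a y (B _ _ _ _)); apply: eq_sweep => y1 y2.
  by rewrite UmulA.
- move=> vs a w z; apply: eq_sweep => x y.
  have := sweepU_takeuchi hQ (B x vs w z) a y.
  rewrite /= => E; transitivity (sweep Q y (fun y1 y2 =>
      f (x :: vs) (y1 * t a * w) (y2 * z))).
    by apply: eq_sweep => y1 y2; rewrite UmulA.
  by rewrite E; apply: eq_sweep => y1 y2; rewrite UmulA.
Qed.

Lemma sweep_exchange (V X X' : lmodType k) (T T' : Type) (P : T -> seq (U * X))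
    (P' : T' -> seq (U * X')) n m (f : U -> X -> U -> X' -> V) :
  sweep P n (fun x y => sweep P' m (f x y)) =
  sweep P' m (fun x' y' => sweep P n (fun x y => f x y x' y')).
Proof. by rewrite /sweep exchange_big. Qed.

(** Coassociativity of each argument, combined with multiplicativity: the coproduct of the product
    of second legs is the product of their coproducts. *)
Lemma cosum_coassoc (V : lmodType k) us (f : seq U -> U -> U -> V) : mixed2 f ->
  cosum us (fun vs z => cosum vs (fun vs' w => f vs' w z)) =
  cosum us (fun vs w => sweep Q w (f vs)).
Proof.
elim: us f => [|u us IH] f fm2.
  by rewrite !cosum_nil (sweepU_one hQ (mixed2_balU _ fm2)).
have [fm f1 f2 ft fb] := fm2.
(* The tail is summed out, leaving a balanced function of the three legs of the head. *)
pose F x y z := cosum us (fun vs w2 =>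
  cosum vs (fun vs' w1 => f (x :: vs') (y * w1) (z * w2))).
have FB : bal3U H F.
  split=> [y z|x z|x y|x b y z|x y b z].
  - apply: linear_cosum => vs w2; apply: linear_cosum => vs' w1.
    exact: (multi_lin (fm (y * w1) (z * w2)) [::]).
  - apply: linear_cosum => vs w2; apply: linear_cosum => vs' w1.
    by apply: (linear_comp (f1 _ _)); exact: mulr_linear.
  - apply: linear_cosum => vs w2; apply: linear_cosum => vs' w1.
    by apply: (linear_comp (f2 _ _)); exact: mulr_linear.
  - apply: eq_cosum => vs w2; apply: eq_cosum => vs' w1.
    by rewrite /ract ft /lact UmulA.
  - apply: eq_cosum => vs w2; apply: eq_cosum => vs' w1.
    by rewrite /ract -UmulA fb /lact UmulA.
transitivity (sweep Q u (fun x z => sweep Q x (fun x' y => F x' y z))).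
  rewrite cosum_cons; apply: eq_sweep => x z.
  by rewrite -cosum_sweep; apply: eq_cosum => vs w2; rewrite cosum_cons.
rewrite (sweepU_assoc hQ u FB).
transitivity (cosum us (fun vs w => sweep Q w (fun z1 z2 => sweep Q u (fun x y =>
    sweep Q y (fun y1 y2 => f (x :: vs) (y1 * z1) (y2 * z2)))))).
  rewrite -(IH _ (mixed2_cons u fm2)).
  symmetry; transitivity (cosum us (fun vs w2 => sweep Q u (fun x y => sweep Q y (fun y1 y2 =>
    cosum vs (fun vs' w1 => f (x :: vs') (y1 * w1) (y2 * w2)))))).
    apply: eq_cosum => vs w2; rewrite cosum_sweep.
    by apply: eq_sweep => x y; exact: cosum_sweep.
  rewrite cosum_sweep; apply: eq_sweep => x y.
  by rewrite cosum_sweep.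
rewrite cosum_cons -cosum_sweep; apply: eq_cosum => vs w.
rewrite sweep_exchange; apply: eq_sweep => x y.
by rewrite sweep_exchange (sweepU_mul hQ (mixed2_balU _ fm2)).
Qed.

(** By [counitM_tgt] the scalar is eps(u_(2) t(eps w)), so this is the right counit law for u t(eps
    w). *)
Lemma sweepU_counit_tgt (V : lmodType k) (F : U -> V) u w : linear F ->
  sweep Q u (fun x y => F (t (eps (y * w)) * x)) = F (u * t (eps w)).
Proof.
move=> FL; rewrite -[in RHS](sweepU_counitr hQ (u * t (eps w))) (sweep_lin _ _ _ FL).
have tl c p q x : t (c *: p + q) * x = c *: (t p * x) + t q * x.
  by rewrite tgt_linear (mulr_linear x).
have B : balU H (fun x y => F (t (eps y) * x)).
  split=> [y|x|x b y].
  - by apply: (linear_comp FL); exact: mull_linear.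
  - by apply: (linear_comp FL) => c p q; rewrite linearP tl.
  - by rewrite /ract /lact counit_src UmulA tgtM.
rewrite (sweepU_mulr_tgt hQ _ _ B); apply: eq_sweep => x y.
by rewrite counitM_tgt.
Qed.

(** A right counit law for lists: the scalar eps(u_(2) w) on u_(1) becomes t(eps w) on the right of
    [u], and balancing passes it to the next argument until it reaches [v]. *)
Lemma cosum_counit (V : lmodType k) us (F : seq U -> V) (g : seq U -> U -> V) v T z :
  multi F -> (forall v vs w, g (v :: vs) w = F ((t (eps w) * v) :: vs)) ->
  cosum us (fun vs w => g (vs ++ v :: T) (w * z)) = F (us ++ (t (eps z) * v) :: T).
Proof.
elim: us F g => [|u us IH] F g Fm gE; first by rewrite cosum_nil /= gE mul1r.
rewrite cosum_contract.
transitivity (cosum us (fun vs w => contract u g (vs ++ v :: T) (w * z))).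
  by apply: eq_cosum => vs w; apply: eq_sweep => x y; rewrite UmulA.
apply: (IH (fun vs => F (u :: vs))); first exact: (multi_catl [:: u] Fm).
move=> v' vs' w; rewrite /contract.
have FL := multi_lin Fm [::] (v' :: vs').
rewrite -(multi_bal Fm [::]) -[RHS](sweepU_counit_tgt u w FL).
by apply: eq_sweep => x y; rewrite gE.
Qed.

Lemma cosum_counit1 (V : lmodType k) us (F : seq U -> V) (g : seq U -> U -> V) v T :
  multi F -> (forall v vs w, g (v :: vs) w = F ((t (eps w) * v) :: vs)) ->
  cosum us (fun vs w => g (vs ++ v :: T) w) = F (us ++ v :: T).
Proof.
move=> Fm gE; have := cosum_counit us v T 1 Fm gE.
rewrite counit1 tgt1 mul1r => <-.
by apply: eq_cosum => vs w; rewrite mulr1.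
Qed.

Lemma cosum_counit_last (V : lmodType k) us u (F : seq U -> V) (g : seq U -> U -> V) z :
  multi F -> (forall v vs w, g (v :: vs) w = F ((t (eps w) * v) :: vs)) ->
  cosum (rcons us u) (fun vs w => g vs (w * z)) = F (us ++ [:: u * t (eps z)]).
Proof.
move=> Fm gE; rewrite -cats1 cosum_cat.
transitivity (sweep Q u (fun x y => cosum us (fun vs w =>
    g (vs ++ [:: x]) (w * (y * z))))).
  rewrite -cosum_sweep; apply: eq_cosum => vs w; rewrite cosum_cons.
  by apply: eq_sweep => x y; rewrite cosum_nil mulr1 UmulA.
rewrite -(sweepU_counit_tgt u z (multi_lin Fm us [::])); apply: eq_sweep => x y.
exact: cosum_counit.
Qed.

End ListCoproducts.

(** * The operad of cochains *)

Section Insertions.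
Variables (k : comNzRingType) (A U : algType k) (H : left_bialgebroid A U).
Variables (N : lmodType k) (Y : yd_algebra H N).
Local Notation s := (src H).
Local Notation t := (tgt H).
Local Notation eps := (counit H).
Local Notation "n '.*' m" := (nmul Y n m) (at level 40, left associativity).
Local Notation balN := (@balN k A U H N Y).
Local Notation bal3N := (@bal3N k A U H N Y).

(** The conditions of a cochain on lists of arbitrary length, so that no arity enters the
    computations with insertions. *)
Record cochainlike (f : seq U -> N) : Prop := Cochainlike {
  cl_multi : multi H f;
  cl_tgt : forall a u us, f ((t a * u) :: us) = Y (t a) (f (u :: us))
}.

Variables (Q : U -> seq (U * U)) (R : N -> seq (U * N)).
Hypotheses (hQ : sweedler (Delta H) Q) (hR : sweedler (yd_coact Y) R).
Local Notation cosum := (cosum Q).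

(** This is [g] on the legs of the element D_f(us) of U (x)_A N. *)
Definition dsum (V : lmodType k) (f : seq U -> N) (us : seq U) (g : U -> N -> V) : V :=
  cosum us (fun vs w => sweep R (f vs) (fun y n => g (y * w) n)).

Lemma eq_dsum (V : lmodType k) f us (g h : U -> N -> V) :
  (forall d n, g d n = h d n) -> dsum f us g = dsum f us h.
Proof. by move=> gh; apply: eq_cosum => vs w; apply: eq_sweep => y n. Qed.

Lemma dsum_lin (V W : lmodType k) f us (g : U -> N -> V) (F : V -> W) : linear F ->
  F (dsum f us g) = dsum f us (fun d n => F (g d n)).
Proof.
move=> FL; rewrite /dsum (cosum_lin _ _ _ FL); apply: eq_cosum => vs w.
exact: sweep_lin.
Qed.

Lemma linear_dsum (V W : lmodType k) f us (g : W -> U -> N -> V) :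
  (forall d n, linear (fun x => g x d n)) -> linear (fun x => dsum f us (g x)).
Proof.
by move=> gL; apply: linear_cosum => vs w; apply: linear_sweep => y n; exact: gL.
Qed.

Lemma dsum_bigsum (V : lmodType k) f us (I : Type) (r : seq I) (g : I -> U -> N -> V) :
  dsum f us (fun d n => \sum_(i <- r) g i d n) = \sum_(i <- r) dsum f us (g i).
Proof.
rewrite /dsum -cosum_bigsum; apply: eq_cosum => vs w.
by rewrite -sweep_bigsum.
Qed.

Lemma dsum_cosum (V : lmodType k) f us vs (g : seq U -> U -> U -> N -> V) :
  dsum f us (fun d n => cosum vs (fun x y => g x y d n)) =
  cosum vs (fun x y => dsum f us (g x y)).
Proof. exact: dsum_bigsum. Qed.

(** t(a) on the first argument leaves [f] as a right action; its coaction puts s(a) to the right of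
    y, hence to the left of [w]. *)
Lemma dsum_mixed (V : lmodType k) f (g : U -> N -> V) : cochainlike f -> balN g ->
  mixed H (fun vs w => sweep R (f vs) (fun y n => g (y * w) n)).
Proof.
move=> [fm ft] gB; have B w := balN_mul w gB; have [gl gr _] := gB; split.
- move=> w; have L := sweepN_linear hR (B w).
  split=> [s1 s2|s1 s2 u a v].
    exact: (linear_comp L (multi_lin fm s1 s2)).
  by rewrite (multi_bal fm).
- move=> vs; apply: linear_sweep => y n; apply: (linear_comp (gl n)).
  exact: mull_linear.
- move=> a v vs w; rewrite ft (sweepN_tgt hQ hR _ _ (B w)).
  by apply: eq_sweep => y n; rewrite UmulA.
Qed.

Lemma dsum_multi (V : lmodType k) f (g : U -> N -> V) : cochainlike f -> balN g ->
  multi H (fun us => dsum f us g).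
Proof. by move=> fC gB; exact: (cosum_multi hQ (dsum_mixed fC gB)). Qed.

(** t(a) goes to the left of the second legs, hence to the right of the coaction leg, and
    [sweepN_tgtr] moves it from there to the N-leg. *)
Lemma dsum_tgt (V : lmodType k) f (g : U -> N -> V) a u us :
  cochainlike f -> balN g ->
  dsum f ((t a * u) :: us) g = dsum f (u :: us) (fun d n => g d (Y (t a) n)).
Proof.
move=> fC gB; rewrite /dsum (cosum_tgt hQ _ _ _ (dsum_mixed fC gB)).
apply: eq_cosum => vs w; rewrite (sweepN_tgtr hQ hR _ a (balN_mul w gB)).
by apply: eq_sweep => y n; rewrite UmulA.
Qed.

Lemma dsum_mulr_tgt (V : lmodType k) f (g : U -> N -> V) a u us :
  cochainlike f -> balN g ->
  dsum f (rcons us (u * t a)) g = dsum f (rcons us u) (fun d n => g (d * t a) n).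
Proof.
move=> fC gB; rewrite /dsum (cosum_mulr_tgt hQ _ _ _ (dsum_mixed fC gB)).
by apply: eq_cosum => vs w; apply: eq_sweep => y n; rewrite UmulA.
Qed.

Lemma dsum_nil (V : lmodType k) f (g : U -> N -> V) :
  dsum f [::] g = sweep R (f [::]) g.
Proof. by rewrite /dsum cosum_nil; apply: eq_sweep => y n; rewrite mulr1. Qed.

Lemma dsum_nil_tgt (V : lmodType k) f (g : U -> N -> V) a : balN g ->
  dsum f [::] (fun d n => g d (Y (t a) n)) = dsum f [::] (fun d n => g (d * t a) n).
Proof. by move=> gB; rewrite !dsum_nil; exact: sweepN_tgtr. Qed.

Lemma nmul_lin_r n : linear (nmul Y n). Proof. exact: nmul_linearr. Qed.
Lemma nmul_lin_l n : linear (fun m => m .* n). Proof. exact: nmul_linearl. Qed.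

Lemma nmul_mixed f n : cochainlike f -> mixed H (fun vs w => f vs .* Y w n).
Proof.
move=> [fm ft]; split.
- by move=> w; exact: multi_comp (nmul_lin_l _) fm.
- by move=> vs; apply: (linear_comp (nmul_lin_r _)); exact: Ylinl.
- by move=> a v vs w; rewrite ft nmul_balanced YM.
Qed.

(* phi(us_(1), d, T) . (us_(2) n) as a function of d and n *)
Definition outer (f : seq U -> N) (us T : seq U) (d : U) (n : N) : N :=
  cosum us (fun vs w => f (vs ++ d :: T) .* Y w n).

(** By the Takeuchi condition for lists, an insertion depends only on the class of D_g in U (x)_A
    N. *)
Lemma outer_bal f us T : cochainlike f -> balN (outer f us T).
Proof.
move=> fC; have [fm ft] := fC; apply: balNP => [n|u|a u n].
- apply: linear_cosum => vs w; apply: (linear_comp (nmul_lin_l _)).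
  exact: (multi_lin fm vs T).
- apply: linear_cosum => vs w; apply: (linear_comp (nmul_lin_r _)).
  exact: Ylinr.
- rewrite /outer (cosum_takeuchi hQ _ _ _ _ (nmul_mixed n fC)).
  by apply: eq_cosum => vs w; rewrite YM.
Qed.

Definition insert (f g : seq U -> N) (us1 us2 us3 : seq U) : N :=
  dsum g us2 (outer f us1 us3).

Lemma insertE f g us1 us2 us3 : insert f g us1 us2 us3 =
  cosum us1 (fun vs w => dsum g us2 (fun d n => f (vs ++ d :: us3) .* Y w n)).
Proof. exact: dsum_cosum. Qed.

Lemma insert_mixed1 f g us2 us3 : cochainlike f ->
  mixed H (fun vs w => dsum g us2 (fun d n => f (vs ++ d :: us3) .* Y w n)).
Proof.
move=> fC; have M n := nmul_mixed n fC; split.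
- move=> w; apply: multi_bigsum => c; apply: multi_bigsum => y.
  exact: multi_catr (mixed_multi (M y.2) w).
- move=> vs; apply: linear_dsum => d n; exact: mixed_lin (M n) _.
- move=> a v vs w; apply: eq_dsum => d n.
  exact: (mixed_tgt (M n) a v (vs ++ d :: us3) w).
Qed.

(** The composite is balanced inside each of the three blocks ([insert_multi1] to [insert_multi3])
    and across their borders ([insert_bal12], [insert_bal23]); [insert_bal13] is the border left
    when the middle block is empty, that is, q = 0. *)
Lemma insert_multi1 f g us2 us3 : cochainlike f ->
  multi H (fun us1 => insert f g us1 us2 us3).
Proof.
move=> fC; have [ml mb] := cosum_multi hQ (insert_mixed1 g us2 us3 fC).
split=> [s1 s2|s1 s2 u a v]; last by rewrite !insertE mb.
by move=> c u v; rewrite !insertE ml.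
Qed.

Lemma insert_multi2 f g us1 us3 : cochainlike f -> cochainlike g ->
  multi H (fun us2 => insert f g us1 us2 us3).
Proof. by move=> fC gC; exact: (dsum_multi gC (outer_bal us1 us3 fC)). Qed.

Lemma insert_multi3 f g us1 us2 : cochainlike f ->
  multi H (fun us3 => insert f g us1 us2 us3).
Proof.
move=> fC; apply: multi_bigsum => c; apply: multi_bigsum => y; apply: multi_bigsum => c'.
apply: (multi_comp (nmul_lin_l _)).
have := multi_catl (fsts c' ++ [:: y.1 * snds c]) (cl_multi fC).
move=> [ml mb]; split=> [s1 s2|s1 s2 u a v].
  by move=> b u v; have := ml s1 s2 b u v; rewrite -!catA.
by have := mb s1 s2 u a v; rewrite -!catA.
Qed.

Lemma outer_mulr_tgt f us u T a d n : cochainlike f ->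
  outer f (rcons us (u * t a)) T d n = outer f (rcons us u) T d (Y (t a) n).
Proof.
move=> fC; rewrite /outer.
rewrite (cosum_mulr_tgt hQ _ _ _ (mixed_append (d :: T) (nmul_mixed n fC))).
by apply: eq_cosum => vs w; rewrite YM.
Qed.

Lemma outer_bal_right f us T d a v n : cochainlike f ->
  outer f us (v :: T) (d * t a) n = outer f us ((t a * v) :: T) d n.
Proof. by move=> [fm _]; apply: eq_cosum => vs w; rewrite (multi_bal fm). Qed.

Lemma insert_bal12 f g us1 us2 us3 u a v : cochainlike f -> cochainlike g ->
  insert f g (rcons us1 (u * t a)) (v :: us2) us3 =
  insert f g (rcons us1 u) ((t a * v) :: us2) us3.
Proof.
move=> fC gC; rewrite /insert (dsum_tgt _ _ _ gC (outer_bal _ _ fC)).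
by apply: eq_dsum => d n; exact: outer_mulr_tgt.
Qed.

Lemma insert_bal23 f g us1 us2 us3 u a v : cochainlike f -> cochainlike g ->
  insert f g us1 (rcons us2 (u * t a)) (v :: us3) =
  insert f g us1 (rcons us2 u) ((t a * v) :: us3).
Proof.
move=> fC gC; rewrite /insert (dsum_mulr_tgt _ _ _ gC (outer_bal _ _ fC)).
by apply: eq_dsum => d n; exact: outer_bal_right.
Qed.

Lemma insert_bal13 f g us1 us3 u a v : cochainlike f ->
  insert f g (rcons us1 (u * t a)) [::] (v :: us3) =
  insert f g (rcons us1 u) [::] ((t a * v) :: us3).
Proof.
move=> fC; rewrite /insert.
transitivity (dsum g [::] (fun d n => outer f (rcons us1 u) (v :: us3) d (Y (t a) n))).
  by apply: eq_dsum => d n; exact: outer_mulr_tgt.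
rewrite (dsum_nil_tgt _ _ (outer_bal _ _ fC)).
by apply: eq_dsum => d n; exact: outer_bal_right.
Qed.

(** Right A-linearity of the composite has three versions, according to the block that contains the
    first argument. *)
Lemma insert_tgt1 f g us1 us2 us3 u a : cochainlike f ->
  insert f g ((t a * u) :: us1) us2 us3 = Y (t a) (insert f g (u :: us1) us2 us3).
Proof.
move=> fC; rewrite !insertE (cosum_tgt hQ _ _ _ (insert_mixed1 g us2 us3 fC)).
rewrite (cosum_lin _ _ _ (Ylinr Y _)); apply: eq_cosum => vs w.
rewrite (dsum_lin _ _ _ (Ylinr Y _)); apply: eq_dsum => d n.
by rewrite YM nmul_ract.
Qed.

Lemma outer_nil f T d n : outer f [::] T d n = f (d :: T) .* n.
Proof. by rewrite /outer cosum_nil Y1. Qed.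

Lemma insert_tgt2 f g us2 us3 u a : cochainlike f -> cochainlike g ->
  insert f g [::] ((t a * u) :: us2) us3 = Y (t a) (insert f g [::] (u :: us2) us3).
Proof.
move=> fC gC; rewrite /insert (dsum_tgt _ _ _ gC (outer_bal _ _ fC)).
rewrite (dsum_lin _ _ _ (Ylinr Y _)); apply: eq_dsum => d n.
by rewrite !outer_nil nmul_ract.
Qed.

Lemma insert_tgt3 f g us3 u a : cochainlike f ->
  insert f g [::] [::] ((t a * u) :: us3) = Y (t a) (insert f g [::] [::] (u :: us3)).
Proof.
move=> fC; rewrite /insert.
transitivity (dsum g [::] (fun d n => outer f [::] (u :: us3) d (Y (t a) n))).
  rewrite (dsum_nil_tgt _ _ (outer_bal _ _ fC)); apply: eq_dsum => d n.
  by rewrite outer_bal_right.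
rewrite (dsum_lin _ _ _ (Ylinr Y _)); apply: eq_dsum => d n.
by rewrite !outer_nil nmul_ract.
Qed.

End Insertions.

(** * Parallel and nested insertions; insertions involving mu and the units *)

Section Compositions.
Variables (k : comNzRingType) (A U : algType k) (H : left_bialgebroid A U).
Variables (N : lmodType k) (Y : yd_algebra H N).
Local Notation s := (src H).
Local Notation t := (tgt H).
Local Notation eps := (counit H).
Local Notation "n '.*' m" := (nmul Y n m) (at level 40, left associativity).
Local Notation balN := (@balN k A U H N Y).
Local Notation bal3N := (@bal3N k A U H N Y).
Local Notation cochainlike := (cochainlike Y).

Variables (Q : U -> seq (U * U)) (R : N -> seq (U * N)).
Hypotheses (hQ : sweedler (Delta H) Q) (hR : sweedler (yd_coact Y) R).
Local Notation cosum := (cosum Q).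
Local Notation dsum := (dsum Q R).
Local Notation outer := (outer Y Q).
Local Notation insert := (insert Y Q R).

(** A coproduct preserves the length of a list, and the composites [F] and [G] below are known only
    on lists of the right lengths. *)
Lemma eq_cosum_size (V : lmodType k) us (f g : seq U -> U -> V) :
  (forall vs w, size vs = size us -> f vs w = g vs w) -> cosum us f = cosum us g.
Proof.
elim: us f g => [|u us IH] f g fg; first by rewrite !cosum_nil fg.
rewrite !cosum_cons; apply: eq_sweep => x y; apply: IH => vs w e.
by apply: fg; rewrite /= e.
Qed.

Lemma nmul2_mixed2 f X n : cochainlike f ->
  mixed2 H (fun vs w z => f vs .* Y w X .* Y z n).
Proof.
move=> fC; have [fm ft] := fC; split.
- move=> w z; apply: (multi_comp (nmul_lin_l Y _)).
  exact: (multi_comp (nmul_lin_l Y _) fm).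
- move=> vs z; apply: (linear_comp (nmul_lin_l Y _)).
  by apply: (linear_comp (nmul_lin_r Y _)); exact: Ylinl.
- by move=> vs w; apply: (linear_comp (nmul_lin_r Y _)); exact: Ylinl.
- by move=> a v vs w z; rewrite ft nmul_balanced YM.
- by move=> vs a w z; rewrite !YM -!nmulA nmul_balanced.
Qed.

Lemma mixed2_append (V : lmodType k) (f : seq U -> U -> U -> V) T :
  mixed2 H f -> mixed2 H (fun vs => f (vs ++ T)).
Proof.
move=> [fm f1 f2 ft fb]; split=> [w z|vs z|vs w|a v vs w z|vs a w z].
- exact: multi_catr (fm w z).
- exact: f1.
- exact: f2.
- exact: ft.
- exact: fb.
Qed.

(** By coassociativity the second and third legs form the coproduct of a single element, which acts
    on the product of X and n by [nmul_act]. *)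
Lemma cosum_outer f us T d X n : cochainlike f ->
  cosum us (fun vs z => outer f vs T d X .* Y z n) = outer f us T d (X .* n).
Proof.
move=> fC; have M := mixed2_append (d :: T) (nmul2_mixed2 X n fC).
transitivity (cosum us (fun vs z => cosum vs (fun vs' w =>
    f (vs' ++ d :: T) .* Y w X .* Y z n))).
  by apply: eq_cosum => vs z; rewrite (cosum_lin _ _ _ (nmul_lin_l Y _)).
rewrite (cosum_coassoc hQ _ M); apply: eq_cosum => vs w.
rewrite (nmul_act Y hQ) (lin_sum _ _ _ (nmul_lin_r Y _)).
by apply: eq_bigr => x _; rewrite nmulA.
Qed.

Lemma nmul_balN (V : lmodType k) (g : U -> N -> V) M : balN g ->
  balN (fun d n => g d (n .* M)).
Proof.
move=> gB; have [gl gr _] := gB; apply: balNP => [n|u|a u n].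
- exact: gl.
- by apply: (linear_comp (gr u)); exact: nmul_lin_l.
- by rewrite (balNE _ _ _ gB) nmul_lact.
Qed.

Lemma nmul_act_mixed2 (V : lmodType k) f (g : U -> N -> V) X :
  cochainlike f -> balN g ->
  mixed2 H (fun vs w z => sweep R (f vs) (fun y n => g (y * w) (n .* Y z X))).
Proof.
move=> [fm ft] gB; have [gl gr _] := gB.
have B w z := nmul_balN (Y z X) (balN_mul w gB); split.
- move=> w z; exact: (multi_comp (sweepN_linear hR (B w z)) fm).
- move=> vs z; apply: linear_sweep => y n.
  by apply: (linear_comp (gl _)); exact: mull_linear.
- move=> vs w; apply: linear_sweep => y n; apply: (linear_comp (gr _)).
  by apply: (linear_comp (nmul_lin_r Y _)); exact: Ylinl.
- move=> a v vs w z; rewrite ft (sweepN_tgt hQ hR _ _ (B w z)).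
  by apply: eq_sweep => y n; rewrite UmulA.
- move=> vs a w z; have := sweepN_tgtr hQ hR (f vs) a (B w z) => /= E.
  transitivity (sweep R (f vs) (fun y n => g (y * t a * w) (n .* Y z X))).
    by apply: eq_sweep => y n; rewrite UmulA.
  by rewrite -E; apply: eq_sweep => y n; rewrite nmul_balanced YM.
Qed.

Lemma dsum_exchange (V : lmodType k) f g us vs (h : U -> N -> U -> N -> V) :
  dsum f us (fun d n => dsum g vs (h d n)) =
  dsum g vs (fun e m => dsum f us (fun d n => h d n e m)).
Proof.
apply: etrans (dsum_bigsum _ _ _ _ _ _) _; apply: eq_bigr => c _.
exact: dsum_bigsum.
Qed.

Section Parallel.
Hypothesis HY : braided_commutative Y.

(** Coassociativity of the coaction turns y_(2) into n_(-1), and (n_(-1) Z) n_(0) = n Z is braided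
    commutativity. *)
Lemma sweepN_braided (V : lmodType k) (g : U -> N -> V) m Z : balN g ->
  sweep R m (fun y n => sweep Q y (fun a b => g a (Y b Z .* n))) =
  sweep R m (fun y n => g y (n .* Z)).
Proof.
move=> gB; have [gl gr _] := gB.
have B : bal3N (fun a b n => g a (Y b Z .* n)).
  split=> [b n|a n|a b|a c b n|a b c n].
  - exact: gl.
  - apply: (linear_comp (gr _)); apply: (linear_comp (nmul_lin_l Y _)).
    exact: Ylinl.
  - by apply: (linear_comp (gr _)); exact: nmul_lin_r.
  - by rewrite /ract /lact (balNE _ _ _ gB) nmul_lact YM.
  - by rewrite /ract YM nmul_balanced yd_lact.
rewrite (sweepN_assoc hQ hR _ B); apply: eq_sweep => y n.
by rewrite (HY hR) (lin_sum _ _ _ (gr y)).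
Qed.

(** The U-leg of D_f is a coaction leg times second legs, so its coproduct factors: [sweepN_braided]
    treats the first factor, and the other remains as the action of [w] on X. *)
Lemma dsum_braided (V : lmodType k) f us (g : U -> N -> V) X :
  cochainlike f -> balN g ->
  dsum f us (fun d n => sweep Q d (fun x y => g x (Y y X .* n))) =
  cosum us (fun vs w => dsum f vs (fun d n => g d (n .* Y w X))).
Proof.
move=> fC gB; have [gl gr _] := gB.
have B n : balU H (fun x y => g x (Y y X .* n)).
  split=> [y|x|x a y]; first exact: gl.
  - apply: (linear_comp (gr _)); apply: (linear_comp (nmul_lin_l Y _)).
    exact: Ylinl.
  - by rewrite /ract /lact (balNE _ _ _ gB) nmul_lact YM.
rewrite (cosum_coassoc hQ us (nmul_act_mixed2 X fC gB)); apply: eq_cosum => vs w.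
transitivity (sweep Q w (fun b1 b2 => sweep R (f vs) (fun y n =>
    sweep Q y (fun a1 a2 => g (a1 * b1) (Y a2 (Y b2 X) .* n))))).
  rewrite sweep_exchange; apply: eq_sweep => y n.
  rewrite (sweepU_mulr hQ _ _ (B n)); apply: eq_sweep => b1 b2.
  by apply: eq_sweep => a1 a2; rewrite YM.
apply: eq_sweep => b1 b2.
by rewrite (sweepN_braided _ _ (balN_mul b1 gB)).
Qed.

(** [h] is inserted to the left of [g]. On the left side the leg d of D_h precedes the slot of [g],
    so d_(2) acts on the leg m of D_g; on the right side the leg n of D_h stands as a factor to the
    left of m. [dsum_braided] passes from one to the other. *)
Lemma insert_parallel f g h F G us1 us2 us3 us4 us5 :
  cochainlike f -> cochainlike h ->
  (forall vs d, size vs = size us1 ->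
    F (vs ++ d :: us3 ++ us4 ++ us5) = insert f g (vs ++ d :: us3) us4 us5) ->
  (forall vs1 vs2 vs3 d, size vs1 = size us1 -> size vs2 = size us2 ->
    size vs3 = size us3 ->
    G (vs1 ++ vs2 ++ vs3 ++ d :: us5) = insert f h vs1 vs2 (vs3 ++ d :: us5)) ->
  insert F h us1 us2 (us3 ++ us4 ++ us5) = insert G g (us1 ++ us2 ++ us3) us4 us5.
Proof.
move=> fC hC FE GE.
transitivity (dsum g us4 (fun e m => dsum h us2 (fun d n =>
    cosum us1 (fun vs z => outer f (vs ++ d :: us3) us5 e m .* Y z n)))).
  rewrite dsum_exchange; apply: eq_dsum => d n; rewrite dsum_cosum.
  apply: eq_cosum_size => vs z e; rewrite FE //.
  by rewrite (dsum_lin _ _ _ _ _ (nmul_lin_l Y _)).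
apply: eq_dsum => e m.
pose T v3 := v3 ++ e :: us5.
(* Separates the coproduct of d from those of the arguments on its two sides. *)
have outerE vs d : outer f (vs ++ d :: us3) us5 e m =
    cosum us3 (fun v3 w3 => sweep Q d (fun x y => outer f vs (T v3) x (Y (y * w3) m))).
  rewrite /outer cosum_cat.
  transitivity (cosum vs (fun vs w => cosum us3 (fun v3 w3 => sweep Q d (fun x y =>
      f (vs ++ x :: T v3) .* Y w (Y (y * w3) m))))).
    apply: eq_cosum => v w; rewrite cosum_cons -cosum_sweep.
    by apply: eq_cosum => v3 w3; apply: eq_sweep => x y; rewrite -catA YM.
  rewrite cosum_exchange; apply: eq_cosum => v3 w3.
  exact: cosum_sweep.
(* Merges the two factors from N under one [outer], the balanced function to which [dsum_braided] is
   applied. *)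
transitivity (cosum us3 (fun v3 w3 => dsum h us2 (fun d n => sweep Q d (fun x y =>
    outer f us1 (T v3) x (Y y (Y w3 m) .* n))))).
  rewrite -dsum_cosum; apply: eq_dsum => d n.
  transitivity (cosum us1 (fun vs z => cosum us3 (fun v3 w3 => sweep Q d (fun x y =>
      outer f vs (T v3) x (Y (y * w3) m) .* Y z n)))).
    apply: eq_cosum => vs z; rewrite outerE (cosum_lin _ _ _ (nmul_lin_l Y _)).
    apply: eq_cosum => v3 w3; exact: sweep_lin (nmul_lin_l Y _).
  rewrite cosum_exchange; apply: eq_cosum => v3 w3; rewrite cosum_sweep.
  by apply: eq_sweep => x y; rewrite (cosum_outer _ _ _ _ _ fC) YM.
transitivity (cosum us3 (fun v3 w3 => cosum us2 (fun v2 w2 => dsum h v2 (fun d n =>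
    outer f us1 (T v3) d (n .* Y w2 (Y w3 m)))))).
  apply: eq_cosum => v3 w3.
  exact: (dsum_braided _ _ hC (outer_bal hQ us1 (T v3) fC)).
rewrite -[RHS]/(cosum (us1 ++ us2 ++ us3) (fun vs w => G (vs ++ e :: us5) .* Y w m)).
rewrite cosum_cat.
transitivity (cosum us1 (fun v1 w1 => cosum us3 (fun v3 w3 => cosum us2 (fun v2 w2 =>
    dsum h v2 (fun d n => outer f v1 (T v3) d n .* Y w1 (Y w2 (Y w3 m))))))); last first.
  apply: eq_cosum_size => v1 w1 e1; rewrite cosum_cat cosum_exchange.
  apply: eq_cosum_size => v3 w3 e3; apply: eq_cosum_size => v2 w2 e2.
  rewrite -!catA GE // (dsum_lin _ _ _ _ _ (nmul_lin_l Y _)).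
  by apply: eq_dsum => d n; rewrite !YM.
rewrite [RHS]cosum_exchange; apply: eq_cosum => v3 w3.
rewrite [RHS]cosum_exchange; apply: eq_cosum => v2 w2.
rewrite -dsum_cosum; apply: eq_dsum => d n.
by rewrite (cosum_outer _ _ _ _ _ fC).
Qed.

End Parallel.

Lemma mixed2_mixed (V : lmodType k) (f : seq U -> U -> U -> V) : mixed2 H f ->
  mixed H (fun vs w => sweep Q w (f vs)).
Proof.
move=> fm2; have [fm f1 f2 ft fb] := fm2; have B vs := mixed2_balU vs fm2; split.
- by move=> w; apply: multi_bigsum => x; exact: fm.
- by move=> vs; exact: (sweepU_linear hQ (B vs)).
- move=> a v vs w; rewrite (sweepU_src hQ (B (v :: vs))).
  by apply: eq_sweep => x y; rewrite ft.
Qed.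

(** Multiplicativity splits the coproduct of the U-leg into a coaction part and a part from the
    second legs; [sweepN_assoc] settles the former and [cosum_coassoc] the latter. *)
Lemma dsum_coassoc (V : lmodType k) f us (g : U -> U -> N -> V) :
  cochainlike f -> bal3N g ->
  dsum f us (fun d n => sweep Q d (fun x y => g x y n)) =
  cosum us (fun vs w => dsum f vs (fun d n =>
    sweep R n (fun y m => g d (y * w) m))).
Proof.
move=> [fm ft] gB; have [g1 g2 g3 g12 g23] := gB.
have B n : balU H (fun x y => g x y n) by split=> // x a y; exact: g12.
have B3 x : balN (g x) by split=> // y a n; exact: g23.
have C w z : balN (fun y n => sweep R n (fun y' m => g (y * w) (y' * z) m)).
  apply: balNP => [n|y|a y n].
  - apply: linear_sweep => y' m; apply: (linear_comp (g1 _ _)).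
    exact: mulr_linear.
  - exact: (sweepN_linear hR (balN_mul z (B3 (y * w)))).
  - rewrite (sweepN_src hR (balN_mul z (B3 (y * w)))).
    by apply: eq_sweep => y' m; rewrite -!UmulA g12.
have M : mixed2 H (fun vs w z => sweep R (f vs) (fun y n =>
    sweep R n (fun y' m => g (y * w) (y' * z) m))).
  split.
  - by move=> w z; exact: (multi_comp (sweepN_linear hR (C w z)) fm).
  - move=> vs z; apply: linear_sweep => y n; apply: linear_sweep => y' m.
    by apply: (linear_comp (g1 _ _)); exact: mull_linear.
  - move=> vs w; apply: linear_sweep => y n; apply: linear_sweep => y' m.
    by apply: (linear_comp (g2 _ _)); exact: mull_linear.
  - move=> a v vs w z; rewrite ft (sweepN_tgt hQ hR _ _ (C w z)).
    by apply: eq_sweep => y n; apply: eq_sweep => y' m; rewrite UmulA.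
  - move=> vs a w z; have := sweepN_tgtr hQ hR (f vs) a (C w z) => /= E.
    transitivity (sweep R (f vs) (fun y n =>
        sweep R n (fun y' m => g (y * t a * w) (y' * z) m))).
      by apply: eq_sweep => y n; apply: eq_sweep => y' m; rewrite UmulA.
    rewrite -E; apply: eq_sweep => y n.
    rewrite (sweepN_tgt hQ hR _ _ (balN_mul z (B3 _))).
    by apply: eq_sweep => y' m; rewrite UmulA.
rewrite [RHS](cosum_coassoc hQ us M); apply: eq_cosum => vs w.
transitivity (sweep Q w (fun b1 b2 => sweep R (f vs) (fun y n =>
    sweep Q y (fun a1 a2 => g (a1 * b1) (a2 * b2) n)))).
  rewrite sweep_exchange; apply: eq_sweep => y n.
  exact: (sweepU_mulr hQ _ _ (B n)).
apply: eq_sweep => b1 b2.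
apply: (sweepN_assoc hQ hR (f := fun a1 a2 n => g (a1 * b1) (a2 * b2) n)).
split=> [y z|x z|x y|x a y z|x y a z].
- by apply: (linear_comp (g1 _ _)); exact: mulr_linear.
- by apply: (linear_comp (g2 _ _)); exact: mulr_linear.
- exact: g3.
- by rewrite /ract /lact -!UmulA; exact: g12.
- by rewrite /ract -UmulA; exact: g23.
Qed.

(** Expresses D of a composite through D_g and D_h. The coaction is multiplicative on the product,
    the Yetter-Drinfel'd condition carries it past the action of the second legs of [us2] on n, and
    [dsum_coassoc] reassembles the coproduct of d. *)
Lemma dsum_insert (V : lmodType k) g h G us2 us3 us4 (P : U -> N -> V) :
  cochainlike g -> cochainlike h -> balN P ->
  (forall vs2 vs3 vs4, size vs2 = size us2 -> size vs3 = size us3 ->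
    size vs4 = size us4 -> G (vs2 ++ vs3 ++ vs4) = insert g h vs2 vs3 vs4) ->
  dsum G (us2 ++ us3 ++ us4) P =
  dsum h us3 (fun d n => cosum us2 (fun v2 w2 =>
    dsum g (v2 ++ d :: us4) (fun e m => P e (m .* Y w2 n)))).
Proof.
move=> gC hC PB GE; have [gm gt] := gC; have [Pl Pr _] := PB.
pose K X n vs b1 b2 := sweep R (g vs) (fun y m => P (y * (b1 * X)) (m .* Y b2 n)).
have KE X n vs b1 b2 : K X n vs b1 b2 =
    sweep R (g vs) (fun y m => P (y * b1 * X) (m .* Y b2 n)).
  by apply: eq_sweep => y m; rewrite UmulA.
have KM X n : mixed2 H (K X n).
  have [m0 m1 m2 m3 m4] := nmul_act_mixed2 n gC (balN_mul X PB).
  split.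
  - move=> w z; have [a b] := m0 w z; split=> [s1 s2|s1 s2 u c v].
      by move=> c u v; rewrite !KE a.
    by rewrite !KE b.
  - by move=> vs z c u v; rewrite !KE m1.
  - by move=> vs w c u v; rewrite !KE m2.
  - by move=> a v vs w z; rewrite !KE m3.
  - by move=> vs a w z; rewrite !KE m4.
(* The target expression with the two legs x1, x2 of d kept apart; its balancedness [TB] is what
   [dsum_coassoc] asks for. *)
pose T v4 w4 x1 x2 n := cosum us2 (fun v2 w2 =>
  sweep Q w2 (K (x2 * w4) n (v2 ++ x1 :: v4))).
have TB v4 w4 : bal3N (T v4 w4).
  split.
  - move=> y z; apply: linear_cosum => v2 w2; apply: linear_sweep => b1 b2.
    exact: (multi_lin (mixed2_multi (KM _ _) b1 b2)).
  - move=> x z; apply: linear_cosum => v2 w2; apply: linear_sweep => b1 b2.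
    apply: linear_sweep => y m; apply: (linear_comp (Pl _)).
    apply: (linear_comp (mull_linear _)); apply: (linear_comp (mull_linear _)).
    exact: mulr_linear.
  - move=> x y; apply: linear_cosum => v2 w2; apply: linear_sweep => b1 b2.
    apply: linear_sweep => y' m; apply: (linear_comp (Pr _)).
    by apply: (linear_comp (nmul_lin_r Y _)); exact: Ylinr.
  - move=> x a y z; rewrite /T /ract /lact.
    rewrite (cosum_takeuchi hQ _ _ _ _ (mixed2_mixed (KM (y * w4) z))).
    apply: eq_cosum => v2 w2.
    rewrite (sweepU_mulr_src hQ _ _ (mixed2_balU _ (KM (y * w4) z))).
    apply: eq_sweep => b1 b2; apply: eq_sweep => y' m.
    by rewrite !UmulA.
  - move=> x y a z; apply: eq_cosum => v2 w2.
    transitivity (sweep Q w2 (fun b1 b2 =>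
        K (y * w4) z (v2 ++ x :: v4) (b1 * t a) b2)).
      apply: eq_sweep => b1 b2; apply: eq_sweep => y' m.
      by rewrite /ract !UmulA.
    rewrite (sweepU_takeuchi hQ (mixed2_balU _ (KM _ _))).
    by apply: eq_sweep => b1 b2; apply: eq_sweep => y' m; rewrite yd_lact YM.
have TE v4 w4 x y n : T v4 w4 x y n = cosum us2 (fun v2 w2 =>
    cosum v2 (fun v w => K (y * w4) n (v ++ x :: v4) w w2)).
  by rewrite (cosum_coassoc hQ us2 (mixed2_append (x :: v4) (KM (y * w4) n))).
(* The coaction of the [g]-factor, with the coaction legs e, n of the other factor left open; [LB]
   allows the Yetter-Drinfel'd condition to be applied to them. *)
pose L W vs e n := sweep R (g vs) (fun y m => P (y * (e * W)) (m .* n)).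
have LB W vs : balN (L W vs).
  apply: balNP => [n|u|a u n].
  - apply: linear_sweep => y m; apply: (linear_comp (Pl _)).
    by apply: (linear_comp (mull_linear _)); exact: mulr_linear.
  - apply: linear_sweep => y m; apply: (linear_comp (Pr _)).
    exact: nmul_lin_r.
  - have B : balN (fun y m => P (y * (u * W)) (m .* n)).
      exact: (nmul_balN n (balN_mul (u * W) PB)).
    have := sweepN_tgtr hQ hR (g vs) a B => /= E.
    transitivity (sweep R (g vs) (fun y m => P (y * t a * (u * W)) (m .* n))).
      by apply: eq_sweep => y m; rewrite !UmulA.
    by rewrite -E; apply: eq_sweep => y m; rewrite nmul_balanced.
have FM W n : mixed2 H (fun vs w z => sweep R (Y w n) (fun y m => L W vs (y * z) m)).
  split.
  - move=> w z; apply: multi_bigsum => y.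
    have B := nmul_balN y.2 (balN_mul (y.1 * z * W) PB).
    exact: (multi_comp (sweepN_linear hR B) gm).
  - move=> vs z; apply: (linear_comp (sweepN_linear hR (balN_mul z (LB W vs)))).
    exact: Ylinl.
  - move=> vs w; apply: linear_sweep => y m.
    by apply: (linear_comp (bal_l (LB W vs) m)); exact: mull_linear.
  - move=> a v vs w z; rewrite YM (sweepN_src hR (balN_mul z (LB W (v :: vs)))).
    apply: eq_sweep => y m; rewrite /L gt.
    rewrite (sweepN_tgt hQ hR _ _ (nmul_balN m (balN_mul (y * z * W) PB))).
    by apply: eq_sweep => y' m'; rewrite !UmulA.
  - move=> vs a w z; rewrite YM (sweepN_tgt hQ hR _ _ (balN_mul z (LB W vs))).
    by apply: eq_sweep => y m; rewrite UmulA.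
have step v3 w3 v4 w4 : cosum us2 (fun v2 w2 => sweep R (insert g h v2 v3 v4)
      (fun y m => P (y * (w2 * (w3 * w4))) m)) =
    dsum h v3 (fun d n => sweep R n (fun y m => T v4 w4 d (y * w3) m)).
  transitivity (dsum h v3 (fun d n => cosum us2 (fun v2 w2 =>
      sweep R (outer g v2 v4 d n) (fun y m => P (y * (w2 * (w3 * w4))) m)))).
    rewrite dsum_cosum; apply: eq_cosum => v2 w2.
    exact: (dsum_lin _ _ _ _ _ (sweepN_linear hR (balN_mul _ PB))).
  apply: eq_dsum => d n.
  transitivity (cosum us2 (fun v2 w2 => cosum v2 (fun v w =>
      sweep R (Y w n) (fun y m => L (w3 * w4) (v ++ d :: v4) (y * w2) m)))).
    apply: eq_cosum => v2 w2.
    have PB' := balN_mul (w2 * (w3 * w4)) PB.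
    rewrite (cosum_lin _ _ _ (sweepN_linear hR PB')); apply: eq_cosum => v w.
    rewrite (sweepN_mul hR PB') sweep_exchange; apply: eq_sweep => y m.
    by apply: eq_sweep => y' m'; rewrite !UmulA.
  rewrite (cosum_coassoc hQ us2 (mixed2_append (d :: v4) (FM _ n))).
  rewrite -cosum_sweep; apply: eq_cosum => v2 w2.
  rewrite (sweepN_act hQ hR (LB _ _)) sweep_exchange; apply: eq_sweep => y m.
  by apply: eq_sweep => b1 b2; apply: eq_sweep => y' m'; rewrite !UmulA.
transitivity (cosum us4 (fun v4 w4 => cosum us3 (fun v3 w3 =>
    dsum h v3 (fun d n => sweep R n (fun y m => T v4 w4 d (y * w3) m))))).
  transitivity (cosum us2 (fun v2 w2 => cosum us4 (fun v4 w4 => cosum us3 (fun v3 w3 =>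
      sweep R (insert g h v2 v3 v4) (fun y m => P (y * (w2 * (w3 * w4))) m))))).
    rewrite /dsum cosum_cat; apply: eq_cosum_size => v2 w2 e2.
    rewrite cosum_cat cosum_exchange; apply: eq_cosum_size => v4 w4 e4.
    by apply: eq_cosum_size => v3 w3 e3; rewrite GE.
  rewrite cosum_exchange; apply: eq_cosum => v4 w4.
  by rewrite cosum_exchange; apply: eq_cosum => v3 w3; exact: step.
transitivity (cosum us4 (fun v4 w4 => dsum h us3 (fun d n =>
    sweep Q d (fun x y => T v4 w4 x y n)))).
  by apply: eq_cosum => v4 w4; rewrite (dsum_coassoc _ hC (TB v4 w4)).
rewrite -dsum_cosum; apply: eq_dsum => d n.
transitivity (cosum us2 (fun v2 w2 => cosum us4 (fun v4 w4 => sweep Q d (fun x y =>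
    cosum v2 (fun v w => K (y * w4) n (v ++ x :: v4) w w2))))).
  rewrite cosum_exchange; apply: eq_cosum => v4 w4.
  by rewrite cosum_sweep; apply: eq_sweep => x y; rewrite TE.
apply: eq_cosum => v2 w2; rewrite /dsum cosum_cat.
rewrite [RHS](_ : _ = cosum v2 (fun v w => cosum us4 (fun v4 w4 => sweep Q d (fun x y =>
    K (y * w4) n (v ++ x :: v4) w w2)))); last first.
  apply: eq_cosum => v w; rewrite cosum_cons -cosum_sweep.
  by apply: eq_cosum => v4 w4.
rewrite [RHS]cosum_exchange; apply: eq_cosum => v4 w4.
by rewrite cosum_sweep.
Qed.

(** Once [dsum_insert] has rewritten the right side, the two sides differ only in whether the second
    legs of [us1] act before or after multiplying in N, which is [cosum_outer]. *)
Lemma insert_nested f g h F G us1 us2 us3 us4 us5 :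
  cochainlike f -> cochainlike g -> cochainlike h ->
  (forall vs1 vs2 d, size vs1 = size us1 -> size vs2 = size us2 ->
    F ((vs1 ++ vs2) ++ d :: us4 ++ us5) = insert f g vs1 (vs2 ++ d :: us4) us5) ->
  (forall vs2 vs3 vs4, size vs2 = size us2 -> size vs3 = size us3 ->
    size vs4 = size us4 -> G (vs2 ++ vs3 ++ vs4) = insert g h vs2 vs3 vs4) ->
  insert F h (us1 ++ us2) us3 (us4 ++ us5) = insert f G us1 (us2 ++ us3 ++ us4) us5.
Proof.
move=> fC gC hC FE GE.
rewrite [RHS](dsum_insert gC hC (outer_bal hQ us1 us5 fC) GE).
apply: eq_dsum => d n; rewrite /outer cosum_cat cosum_exchange.
apply: eq_cosum_size => v2 w2 e2.
transitivity (cosum us1 (fun v1 w1 => dsum g (v2 ++ d :: us4) (fun e m =>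
    outer f v1 us5 e m .* Y w1 (Y w2 n)))).
  apply: eq_cosum_size => v1 w1 e1; rewrite FE // YM.
  exact: (dsum_lin _ _ _ _ _ (nmul_lin_l Y _)).
rewrite -dsum_cosum; apply: eq_dsum => e m.
exact: cosum_outer.
Qed.

Local Notation nu := (none Y).

Lemma sweepN_counit_tgt n w :
  sweep R n (fun y m => Y (s (eps (y * w))) m) = Y (t (eps w)) n.
Proof.
rewrite -(sweepN_ract hR); apply: eq_sweep => y m.
by rewrite counitM_tgt.
Qed.

Lemma counit_multi (F : seq U -> N) v vs w : cochainlike F ->
  Y (t (eps w)) (F (v :: vs)) = F ((t (eps w) * v) :: vs).
Proof. by move=> [_ ->]. Qed.

Lemma cosum_counit_cl F us v T : cochainlike F ->
  cosum us (fun vs w => Y (t (eps w)) (F (vs ++ v :: T))) = F (us ++ v :: T).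
Proof.
move=> FC; apply: (@cosum_counit1 _ _ _ _ _ hQ _ us F (fun vs w => Y (t (eps w)) (F vs)) v T).
  exact: cl_multi FC.
by move=> v' vs w; exact: counit_multi.
Qed.

Lemma cosum_counit_cl_last F us u z : cochainlike F ->
  cosum (rcons us u) (fun vs w => Y (t (eps (w * z))) (F vs)) =
  F (us ++ [:: u * t (eps z)]).
Proof.
move=> FC; apply: (@cosum_counit_last _ _ _ _ _ hQ _ us u F
  (fun vs w => Y (t (eps w)) (F vs)) z).
  exact: cl_multi FC.
by move=> v' vs w; exact: counit_multi.
Qed.

Lemma cosum_counit_cl0 F us : cochainlike F ->
  cosum us (fun vs w => Y (t (eps w)) (F vs)) = F us.
Proof.
move=> FC; case/lastP: us => [|us u].
  by rewrite cosum_nil counit1 tgt1 Y1.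
have := cosum_counit_cl_last us u 1 FC; rewrite counit1 tgt1 mulr1 cats1 => <-.
by apply: eq_cosum => vs w; rewrite mulr1.
Qed.

(** The last hypothesis says D_g(us2) = x (x) 1_N. The second legs of [us1] act on 1_N through the
    counit, and the counit law for lists removes them. *)
Lemma insert_none f g us1 us2 us3 x : cochainlike f ->
  (forall (h : U -> N -> N), balN h -> dsum g us2 h = h x nu) ->
  insert f g us1 us2 us3 = f (us1 ++ x :: us3).
Proof.
move=> fC gE; rewrite /insert gE; last exact: outer_bal.
rewrite -(cosum_counit_cl us1 x us3 fC); apply: eq_cosum => vs w.
by rewrite none_actr -nmul_ract nmuln1.
Qed.

(** A left counit law for products: [counitM_tgt] turns the scalar b of the tail into t(b) on u_(1),
    and the Takeuchi condition into s(b) between [u] and the tail. *)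
Lemma cosum_counit_prod us :
  cosum us (fun vs w => s (eps (\prod_(x <- vs) x)) * w) = \prod_(x <- us) x.
Proof.
elim: us => [|u us IH].
  by rewrite cosum_nil !big_nil counit1 src1 mulr1.
have sl c p q x : s (c *: p + q) * x = c *: (s p * x) + s q * x.
  by rewrite src_linear (mulr_linear x).
have B : balU H (fun x y => s (eps x) * y).
  split=> [y|x|x a y].
  - by move=> c p q; rewrite linearP sl.
  - exact: mull_linear.
  - by rewrite /ract /lact counit_tgt UmulA srcM.
rewrite big_cons -IH (cosum_lin _ _ _ (mull_linear u)) cosum_cons -cosum_sweep.
apply: eq_cosum => vs w; set b := eps (\prod_(x <- vs) x).
transitivity (sweep Q u (fun x y => s (eps (x * t b)) * y) * w).
  rewrite (sweep_lin _ _ _ (mulr_linear w)); apply: eq_sweep => x y.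
  by rewrite big_cons UmulA -counitM_tgt.
rewrite (sweepU_takeuchi hQ B) UmulA; congr (_ * w).
rewrite -[in RHS](sweepU_counitl hQ u) (sweep_lin _ _ _ (mulr_linear _)).
by apply: eq_sweep => x y; rewrite UmulA.
Qed.

(** Since s(b) 1_N coacts as s(b) (x) 1_N, the preceding counit law reduces D_g to the product of
    the arguments, tensored with 1_N. *)
Lemma dsum_counit_prod (V : lmodType k) g us (h : U -> N -> V) : balN h ->
  (forall vs, size vs = size us -> g vs = Y (s (eps (\prod_(x <- vs) x))) nu) ->
  dsum g us h = h (\prod_(x <- us) x) nu.
Proof.
move=> hB gE; have [hl hr _] := hB.
rewrite -[in RHS]cosum_counit_prod (cosum_lin _ _ _ (hl nu)).
apply: eq_cosum_size => vs w e; rewrite gE //.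
rewrite (sweepN_src hR (balN_mul w hB)) (sweepN_none hR); last first.
  split=> [n|u|u a n].
  - apply: (linear_comp (hl n)); apply: (linear_comp (mulr_linear w)).
    exact: mull_linear.
  - exact: hr.
  - by rewrite /ract yd_lact -(balNE _ _ _ hB) !UmulA src_tgt.
by rewrite mulr1.
Qed.

Lemma insert_one f us : cochainlike f ->
  forall g, (forall u, g [:: u] = Y (s (eps u)) nu) ->
  insert g f [::] us [::] = f us.
Proof.
move=> fC g gE; rewrite -[RHS](cosum_counit_cl0 us fC).
apply: eq_cosum => vs w; rewrite -sweepN_counit_tgt; apply: eq_sweep => y n.
by rewrite outer_nil gE -nmul_lact nmul1n.
Qed.

Section Product.
Variable m : seq U -> N.
Hypothesis mE : forall u v, m [:: u; v] = Y (s (eps (u * v))) nu.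

(** With the next two lemmas, this computes the outer terms of [hochschild_delta]: the last one, its
    form in degree 0, and the first one. *)
Lemma insert_mul1 f us u v : cochainlike f ->
  insert m f [::] (rcons us u) [:: v] = f (us ++ [:: u * t (eps v)]).
Proof.
move=> fC; rewrite -(cosum_counit_cl_last us u v fC).
apply: eq_cosum => vs w; rewrite -sweepN_counit_tgt; apply: eq_sweep => y n.
by rewrite outer_nil mE -nmul_lact nmul1n UmulA.
Qed.

Lemma insert_mul1_nil f v : insert m f [::] [::] [:: v] = Y (t (eps v)) (f [::]).
Proof.
rewrite /insert dsum_nil -sweepN_counit_tgt; apply: eq_sweep => y n.
by rewrite outer_nil mE -nmul_lact nmul1n.
Qed.

(** The Yetter-Drinfel'd condition exchanges u_(1) d (x) u_(2) n for the coaction of u_(1) acting on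
    the value of [f]; the counits then collapse. *)
Lemma insert_mul2 f u us : cochainlike f ->
  insert m f [:: u] us [::] = Y u (f us).
Proof.
move=> fC.
have B w : balN (fun d n => Y (s (eps (d * w))) n).
  have sL n : linear (fun a => Y (s a) n).
    by apply: (linear_comp (Ylinl Y n)); exact: src_linear.
  apply: balNP => [n|d|a d n].
  - apply: (linear_comp (sL n)).
    by move=> c p q; rewrite (mulr_linear w) linearP.
  - exact: Ylinr.
  - by rewrite -UmulA counit_tgt srcM YM.
rewrite -[in RHS](cosum_counit_cl0 us fC) (cosum_lin _ _ _ (Ylinr Y _)).
apply: eq_cosum => vs w.
transitivity (sweep Q u (fun x y => sweep R (f vs) (fun d n =>
    Y (s (eps (x * d * w))) (Y y n)))).
  rewrite sweep_exchange; apply: eq_sweep => d n.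
  rewrite /outer cosum_cons; apply: eq_sweep => x y.
  by rewrite cosum_nil mulr1 /= mE -nmul_lact nmul1n UmulA.
rewrite -(sweepN_act hQ hR (B w)).
transitivity (sweep Q u (fun x y => Y (t (eps (y * w)) * x) (f vs))).
  apply: eq_sweep => x y; rewrite YM -sweepN_counit_tgt.
  by apply: eq_sweep => d n; rewrite UmulA.
by rewrite (sweepU_counit_tgt hQ u w (Ylinl Y (f vs))) YM.
Qed.

End Product.

End Compositions.

(** * Cochains as list functions, their operad, and its differential *)

Section CochainOperad.
Variables (k : comNzRingType) (A U : algType k) (H : left_bialgebroid A U).
Variables (N : lmodType k) (Y : yd_algebra H N).
Local Notation s := (src H).
Local Notation t := (tgt H).
Local Notation eps := (counit H).
Local Notation nu := (none Y).
Local Notation "n '.*' m" := (nmul Y n m) (at level 40, left associativity).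
Local Notation cochain := (cochain Y).
Local Notation cochainlike := (cochainlike Y).

Lemma presented_ext (T : choiceType) (rel : {malg k[T]} -> Prop) (V : lmodType k)
    (f g : presented rel -> V) : linear f -> linear g ->
  (forall x, f (pgen rel x) = g (pgen rel x)) -> f = g.
Proof.
move=> fL gL fg; apply: functional_extensionality_dep => q.
rewrite -[q]qclassK [repr q]monalgE.
rewrite (lin_sum _ _ _ (@qclass_linear _ _ rel)) !(lin_sum _ _ _ fL, lin_sum _ _ _ gL).
apply: eq_bigr => x _.
have -> : << (repr q)@_x *g x >> = (repr q)@_x *: << x >> :> {malg k[T]}.
  by apply/malgP=> i; rewrite malgZ_def fgscaleE !mcoeffU mulrnAr mulr1.
by rewrite (linZ _ _ (@qclass_linear _ _ rel)) (linZ _ _ fL) (linZ _ _ gL) -/(pgen rel x) fg.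
Qed.

Lemma tppure_multi p : multi H (tppure H p).
Proof.
have g_add s1 s2 u v : tppure H p (s1 ++ (u + v) :: s2) =
    tppure H p (s1 ++ u :: s2) + tppure H p (s1 ++ v :: s2).
  rewrite /tppure /pgen -qclassD; apply/qclassP/asboolP => S _ _; rewrite opprD addrA.
  by apply; exact: TPowerAdd.
have g_scale s1 s2 c u : tppure H p (s1 ++ (c *: u) :: s2) =
    c *: tppure H p (s1 ++ u :: s2).
  rewrite /tppure /pgen -linearZ; apply/qclassP/asboolP => S _ _.
  by apply; exact: TPowerScale.
split=> [s1 s2 c u v|s1 s2 u a v]; first by rewrite g_add g_scale.
apply/qclassP/asboolP => S _ _; apply; exact: TPowerBalanced.
Qed.

Lemma tppure_size p us : size us <> p -> tppure H p us = 0.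
Proof.
move=> /eqP e; rewrite -[RHS](linear0 (qclass (tpower_rel H p))).
by apply/qclassP/asboolP => S _ _; rewrite subr0; apply; exact: TPowerSize.
Qed.

Lemma cochainP p (f : cochain p) :
  linear (f : cochain_of Y p) /\ forall (a : A) (u : U) (us : seq U),
    (f : cochain_of Y p) (tppure H p ((t a * u) :: us)) =
    Y (t a) ((f : cochain_of Y p) (tppure H p (u :: us))).
Proof. by case: f => f /= /asboolP. Qed.

Lemma ceval_cochainlike p (f : cochain p) : cochainlike (ceval f).
Proof.
have [fL fA] := cochainP f; split; last exact: fA.
exact: multi_comp fL (tppure_multi p).
Qed.

Lemma ceval_inj p (f g : cochain p) :
  (forall us, size us = p -> ceval f us = ceval g us) -> f = g.
Proof.
move=> fg; have [fL _] := cochainP f; have [gL _] := cochainP g.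
apply: val_inj; apply: (presented_ext fL gL) => us.
have [e|/eqP e] := eqVneq (size us) p; first exact: fg.
by rewrite -/(tppure H p us) tppure_size // !lin0.
Qed.

Lemma ceval_linear p us : linear (fun f : cochain p => ceval f us).
Proof. by []. Qed.

Lemma mkcochain_exists p (F : seq U -> N) : cochainlike F ->
  exists f : cochain p, forall us, size us = p -> ceval f us = F us.
Proof.
(* The tensor power kills lists of other lengths, so [F] is cut off there. *)
move=> [[Fl Fb] Ft]; pose G us := if size us == p then F us else 0.
have [|L LL LE] := @presented_lift k _ N (tpower_rel H p) G.
  move=> r; case=> [us e|s1 s2 u v|s1 s2 c u|s1 s2 u a v].
  - by rewrite extendU /G (negbTE e).
  - apply: extend_add; rewrite /G !size_cat /=; case: eqP => _; last by rewrite addr0.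
    exact: (linD (Fl s1 s2)).
  - apply: extend_scale; rewrite /G !size_cat /=; case: eqP => _; last by rewrite scaler0.
    exact: (linZ _ _ (Fl s1 s2)).
  - by apply: extend_eq; rewrite /G !size_cat /= Fb.
have LP : @cochain_pred k A U H N Y p L.
  apply/asboolP; split=> // a u us; rewrite /tppure !LE /G /=.
  by case: eqP => _; [exact: Ft | rewrite (lin0 (Ylinr Y _))].
by exists (Cochain LP) => us e; rewrite /ceval /= /tppure LE /G e eqxx.
Qed.

Definition mkcochain p F (FC : cochainlike F) : cochain p :=
  projT1 (cid (mkcochain_exists p FC)).

Lemma mkcochainE p F (FC : cochainlike F) us : size us = p ->
  ceval (mkcochain p FC) us = F us.
Proof. exact: (projT2 (cid (mkcochain_exists p FC))). Qed.

Lemma ceval_regrade p q (f : cochain p) us : p = q ->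
  ceval (regrade q f) us = ceval f us.
Proof. by move=> e; case: _ / e; rewrite regrade_id. Qed.

(** The last hypothesis serves the one case in which the cut separates the two neighbours to be
    balanced. *)
Lemma multi_split (V : lmodType k) i (h : seq U -> seq U -> V) :
  (forall T, multi H (h ^~ T)) -> (forall vs, multi H (h vs)) ->
  (forall vs u a v T, (0 < i)%N -> size vs = i.-1 ->
    h (rcons vs (u * t a)) (v :: T) = h (rcons vs u) ((t a * v) :: T)) ->
  multi H (fun us => h (take i us) (drop i us)).
Proof.
move=> h1 h2 h12.
have beyond (s1 T : seq U) : (i <= size s1)%N ->
    take i (s1 ++ T) = take i s1 /\ drop i (s1 ++ T) = drop i s1 ++ T.
  move=> is1; rewrite take_cat drop_cat; case: ltnP => // si.
  have -> : i = size s1 by apply/eqP; rewrite eqn_leq is1.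
  by rewrite subnn take0 drop0 cats0 take_size drop_size.
have within (s1 : seq U) u T : (size s1 < i)%N ->
    take i (s1 ++ u :: T) = s1 ++ u :: take (i - (size s1).+1) T /\
    drop i (s1 ++ u :: T) = drop (i - (size s1).+1) T.
  move=> s1i; rewrite take_cat drop_cat ltnNge (ltnW s1i) /=.
  by have -> : (i - size s1 = (i - (size s1).+1).+1)%N by lia.
split=> [s1 s2|s1 s2 u a v].
  have [is1|s1i] := leqP i (size s1); move=> c u v.
    by rewrite !(beyond s1 _ is1).1 !(beyond s1 _ is1).2 (multi_lin (h2 _)).
  by rewrite !(within s1 _ _ s1i).1 !(within s1 _ _ s1i).2 (multi_lin (h1 _)).
have [is1|s1i] := leqP i (size s1).
  by rewrite !(beyond s1 _ is1).1 !(beyond s1 _ is1).2 (multi_bal (h2 _)).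
rewrite !(within s1 _ _ s1i).1 !(within s1 _ _ s1i).2.
case: (posnP (i - (size s1).+1)) => [e|].
  by rewrite e !take0 !drop0 !cats1 h12 //; lia.
case: (i - (size s1).+1)%N => [//|j] _ /=.
by rewrite (multi_bal (h1 _)).
Qed.

Variables (Q : U -> seq (U * U)) (R : N -> seq (U * N)).
Hypotheses (hQ : sweedler (Delta H) Q) (hR : sweedler (yd_coact Y) R).

Definition split_insert i q (f g : seq U -> N) (us : seq U) : N :=
  insert Y Q R f g (take i us) (take q (drop i us)) (drop q (drop i us)).

Lemma split_insertE i q f g us1 us2 us3 : size us1 = i -> size us2 = q ->
  split_insert i q f g (us1 ++ us2 ++ us3) = insert Y Q R f g us1 us2 us3.
Proof.
by move=> <- <-; rewrite /split_insert take_size_cat // !drop_size_cat // take_size_cat.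
Qed.

Lemma split_insert_cochainlike i q f g : cochainlike f -> cochainlike g ->
  cochainlike (split_insert i q f g).
Proof.
move=> fC gC; split.
  pose h us T := insert Y Q R f g us (take q T) (drop q T).
  apply: (@multi_split _ i h) => [T|us|us u a v T i0 ui].
  - exact: insert_multi1.
  - apply: (@multi_split _ q (insert Y Q R f g us)) => [T|vs|vs u a v T q0 vq].
    + exact: insert_multi2.
    + exact: insert_multi3.
    + exact: insert_bal23.
  - rewrite /h; case: (q) => [|q'] /=; last exact: insert_bal12.
    exact: insert_bal13.
move=> a u us; rewrite /split_insert; case: i => [|i] /=; last exact: insert_tgt1.
case: q => [|q] /=; last exact: insert_tgt2.
exact: insert_tgt3.
Qed.

Definition ccirc p q i (f : cochain p) (g : cochain q) : cochain (p + q - 1)%N :=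
  if (0 < i <= p)%N then
    mkcochain _ (split_insert_cochainlike i.-1 q (ceval_cochainlike f)
                   (ceval_cochainlike g))
  else 0.

Lemma ccircE p q i (f : cochain p) (g : cochain q) us1 us2 us3 :
  (0 < i <= p)%N -> size us1 = i.-1 -> size us2 = q -> size us3 = (p - i)%N ->
  ceval (ccirc i f g) (us1 ++ us2 ++ us3) =
  insert Y Q R (ceval f) (ceval g) us1 us2 us3.
Proof.
move=> ip e1 e2 e3; rewrite /ccirc ip mkcochainE ?split_insertE //.
by rewrite !size_cat e1 e2 e3; lia.
Qed.

Lemma ccirc_out p q i (f : cochain p) (g : cochain q) :
  ~~ (0 < i <= p)%N -> ccirc i f g = 0.
Proof. by rewrite /ccirc => /negbTE ->. Qed.

Lemma size_splitP (us : seq U) a b : size us = (a + b)%N ->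
  exists us1 us2, [/\ us = us1 ++ us2, size us1 = a & size us2 = b].
Proof.
move=> e; exists (take a us), (drop a us); rewrite cat_take_drop size_drop e addKn.
by split=> //; rewrite size_takel // e leq_addr.
Qed.

Lemma ccirc_ext p q i (f : cochain p) (g : cochain q) (h : cochain (p + q - 1)%N) :
  (0 < i <= p)%N ->
  (forall us1 us2 us3, size us1 = i.-1 -> size us2 = q -> size us3 = (p - i)%N ->
    insert Y Q R (ceval f) (ceval g) us1 us2 us3 = ceval h (us1 ++ us2 ++ us3)) ->
  ccirc i f g = h.
Proof.
move=> ip E; apply: ceval_inj => us e.
have [|us1 [T [-> e1 eT]]] := @size_splitP us i.-1 (q + (p - i)); first by lia.
have [us2 [us3 [-> e2 e3]]] := size_splitP eT.
by rewrite ccircE // E.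
Qed.

Lemma ccirc_linearr p q i (f : cochain p) : (0 < i)%N -> linear (@ccirc p q i f).
Proof.
move=> _ c g g'; case: (boolP (0 < i <= p)%N) => ip; last first.
  by rewrite !ccirc_out // scaler0 addr0.
apply: ccirc_ext => // us1 us2 us3 e1 e2 e3.
rewrite ceval_linear !ccircE //.
have L : linear (fun h : cochain q => insert Y Q R (ceval f) (ceval h) us1 us2 us3).
  apply: linear_cosum => vs w.
  have B := balN_mul w (outer_bal hQ us1 us3 (ceval_cochainlike f)).
  by apply: (linear_comp (sweepN_linear hR B)); exact: ceval_linear.
exact: L.
Qed.

Lemma ccirc_linearl p q i (g : cochain q) : (0 < i)%N ->
  linear (fun f : cochain p => ccirc i f g).
Proof.
move=> _ c f f'; case: (boolP (0 < i <= p)%N) => ip; last first.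
  by rewrite !ccirc_out // scaler0 addr0.
apply: ccirc_ext => // us1 us2 us3 e1 e2 e3.
rewrite ceval_linear !ccircE //.
have L : linear (fun h : cochain p => insert Y Q R (ceval h) (ceval g) us1 us2 us3).
  apply: linear_dsum => d n; apply: linear_cosum => vs w.
  by apply: (linear_comp (nmul_lin_l Y _)); exact: ceval_linear.
exact: L.
Qed.

Section PartialCompositions.
Variables (p q r : nat) (f : cochain p) (g : cochain q) (h : cochain r).
Let fC := ceval_cochainlike f.
Let gC := ceval_cochainlike g.
Let hC := ceval_cochainlike h.

Lemma ccirc0l p' q' i (x : cochain q') : ccirc i (0 : cochain p') x = 0.
Proof.
case: i => [|i]; first by rewrite ccirc_out.
exact: lin0 (ccirc_linearl x (ltn0Sn i)).
Qed.

Lemma regrade_zero a b : regrade b (0 : cochain a) = 0.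
Proof. exact: regrade0. Qed.

Lemma ccircA_lt i j : braided_commutative Y -> (0 < j)%N -> (j < i)%N ->
  ccirc j (ccirc i f g) h = regrade _ (ccirc (i + r - 1) (ccirc j f h) g).
Proof.
move=> HY j0 ji; have [ip|pi] := leqP i p; last first.
  rewrite (@ccirc_out p q i f g); last by lia.
  by rewrite ccirc0l ccirc_out ?regrade_zero //; lia.
apply: ccirc_ext; first by lia.
move=> us1 us2 T e1 e2 eT; rewrite ceval_regrade; last by lia.
(* [us3] holds the i - j - 1 arguments strictly between the two insertions. *)
have [|us3 [T' [eq3 e3 eT']]] := @size_splitP T (i - j.+1) (q + (p - i)); first by lia.
have [us4 [us5 [eq4 e4 e5]]] := size_splitP eT'; subst T' T.
have -> : us1 ++ us2 ++ us3 ++ us4 ++ us5 = (us1 ++ us2 ++ us3) ++ us4 ++ us5.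
  by rewrite -!catA.
rewrite ccircE //; [|lia|by rewrite !size_cat; lia|lia].
apply: (insert_parallel hQ hR HY fC hC).
  move=> vs d ev; rewrite -(@ccircE p q i) //; first by rewrite -catA.
  + by lia.
  + by rewrite size_cat /=; lia.
move=> vs1 vs2 vs3 d ev1 ev2 ev3; rewrite ccircE //; [lia|lia|lia|].
by rewrite size_cat /=; lia.
Qed.

Lemma ccircA_mid i j : (0 < i)%N -> (i <= j < q + i)%N ->
  ccirc j (ccirc i f g) h = regrade _ (ccirc i f (ccirc (j - i + 1) g h)).
Proof.
move=> i0 ij; have [ip|pi] := leqP i p; last first.
  rewrite (@ccirc_out p q i f g); last by lia.
  by rewrite ccirc0l ccirc_out ?regrade_zero //; lia.
apply: ccirc_ext; first by lia.
move=> T us3 T' e1 e3 eT; rewrite ceval_regrade; last by lia.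
(* Of the arguments of [g], j - i precede the slot of [h] and q + i - j - 1 follow it. *)
have [|us1 [us2 [eq1 e11 e2]]] := @size_splitP T i.-1 (j - i); first by lia.
have [|us4 [us5 [eq4 e4 e5]]] := @size_splitP T' (q + i - j.+1) (p - i); first by lia.
subst T T'.
have -> : (us1 ++ us2) ++ us3 ++ us4 ++ us5 = us1 ++ (us2 ++ us3 ++ us4) ++ us5.
  by rewrite -!catA.
rewrite ccircE //; [|lia|by rewrite !size_cat; lia].
apply: (insert_nested hQ hR fC gC hC).
  move=> vs1 vs2 d ev1 ev2; rewrite -(@ccircE p q i) //; first by rewrite -!catA.
  + by lia.
  + by lia.
  + by rewrite size_cat /=; lia.
by move=> vs2 vs3 vs4 ev2 ev3 ev4; rewrite ccircE //; lia.
Qed.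

End PartialCompositions.

(** This is [ccircA_lt] with [g] and [h] exchanged, read from right to left. *)
Lemma ccircA_ge p q r i j (f : cochain p) (g : cochain q) (h : cochain r) :
  braided_commutative Y -> (0 < i)%N -> (q + i <= j)%N ->
  ccirc j (ccirc i f g) h = regrade _ (ccirc i (ccirc (j - q + 1) f h) g).
Proof.
move=> HY i0 ij; have [ip|pi] := leqP i p; last first.
  rewrite (@ccirc_out p q i f g); last by lia.
  rewrite (@ccirc_out p r (j - q + 1) f h); last by lia.
  by rewrite !ccirc0l regrade_zero.
rewrite (@ccircA_lt _ _ _ f h g (j - q + 1) i HY) //; last by lia.
have -> : (j - q + 1 + q - 1 = j)%N by lia.
apply: ceval_inj => us e; rewrite !ceval_regrade //; lia.
Qed.

Definition eps_fun (us : seq U) : N := Y (s (eps (\prod_(x <- us) x))) nu.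

Lemma eps_fun_cochainlike : cochainlike eps_fun.
Proof.
have L : linear (fun x : U => Y (s (eps x)) nu).
  apply: (linear_comp (Ylinl Y nu)) => c u v.
  by rewrite linearP src_linear.
split; first split=> [s1 s2|s1 s2 u a v].
- move=> c u v; rewrite /eps_fun !big_cat !big_cons /=.
  by rewrite (mulr_linear _ c u v) (mull_linear _ c _ _) L.
- by rewrite /eps_fun !big_cat !big_cons /= !UmulA.
- move=> a u us; rewrite /eps_fun !big_cons -UmulA counit_tgt srcM YM.
  have -> : Y (s a) nu = Y (t a) nu.
    by rewrite [RHS]none_actl -[t a]mulr1 counit_tgt counit1 mul1r.
  by rewrite -!YM src_tgt.
Qed.

(* The unit e, the identity and the multiplication mu are the cases p = 0, 1, 2. *)
Definition eps_cochain p : cochain p := mkcochain p eps_fun_cochainlike.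

Lemma eps_cochainE p us : size us = p ->
  ceval (eps_cochain p) us = Y (s (eps (\prod_(x <- us) x))) nu.
Proof. exact: mkcochainE. Qed.

Lemma insert_eps p q (f : cochain p) us1 us2 us3 : size us2 = q ->
  insert Y Q R (ceval f) (ceval (eps_cochain q)) us1 us2 us3 =
  ceval f (us1 ++ \prod_(x <- us2) x :: us3).
Proof.
move=> e; apply: (insert_none hQ) => [|h hB]; first exact: ceval_cochainlike.
apply: (dsum_counit_prod hQ hR hB) => vs ev.
by rewrite eps_cochainE // ev.
Qed.

Lemma ccirc_eps p q i (f : cochain p) us1 us2 us3 :
  (0 < i <= p)%N -> size us1 = i.-1 -> size us2 = q -> size us3 = (p - i)%N ->
  ceval (ccirc i f (eps_cochain q)) (us1 ++ us2 ++ us3) =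
  ceval f (us1 ++ \prod_(x <- us2) x :: us3).
Proof. by move=> ip e1 e2 e3; rewrite ccircE // insert_eps. Qed.

(** Substituting a product into a product. The cases p = 2 with q = 2 or q = 0 are the axioms for mu
    and e. *)
Lemma eps_ccirc_eps p q i : (0 < i <= p)%N ->
  ccirc i (eps_cochain p) (eps_cochain q) = eps_cochain (p + q - 1).
Proof.
move=> ip; apply: ccirc_ext => // us1 us2 us3 e1 e2 e3.
rewrite insert_eps // !eps_cochainE.
- by rewrite !big_cat big_cons.
- by rewrite !size_cat e1 e2 e3; lia.
- by rewrite size_cat /= e1 e3; lia.
Qed.

Lemma ccirc1r p i (f : cochain p) : (0 < i <= p)%N ->
  ccirc i f (eps_cochain 1) = regrade _ f.
Proof.
move=> ip; apply: ccirc_ext => // us1 us2 us3 e1 e2 e3.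
rewrite insert_eps // ceval_regrade; last by lia.
by case: us2 e2 => [|u []] // _; rewrite big_seq1.
Qed.

Lemma ccirc1l p (f : cochain p) : ccirc 1 (eps_cochain 1) f = regrade _ f.
Proof.
apply: ccirc_ext => // us1 us2 us3 e1 e2 e3.
rewrite ceval_regrade; last by lia.
move: e1 e3 => /size0nil -> /size0nil ->; rewrite cats0 /=.
apply: (insert_one hQ hR); first exact: ceval_cochainlike.
by move=> u; rewrite eps_cochainE // big_seq1.
Qed.

Lemma ccirc_range p q i (f : cochain p) (g : cochain q) : (0 < i)%N ->
  (p < i)%N || (p == 0%N) -> ccirc i f g = 0.
Proof. by move=> i0 pi; rewrite ccirc_out //; lia. Qed.

Section Operad.
Hypothesis HY : braided_commutative Y.

Definition cochain_operad : operad_mult cochain :=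
  @OperadMult k cochain (eps_cochain 1) ccirc ccirc_linearr ccirc_linearl
    ccirc_range
    (fun p q r i j f g h => @ccircA_lt p q r f g h i j HY)
    (fun p q r i j f g h => @ccircA_mid p q r f g h i j)
    (fun p q r i j f g h => @ccircA_ge p q r i j f g h HY)
    ccirc1r ccirc1l (eps_cochain 2) (eps_cochain 0)
    (etrans (@eps_ccirc_eps 2 2 1 isT) (esym (@eps_ccirc_eps 2 2 2 isT)))
    (@eps_ccirc_eps 2 0 1 isT) (@eps_ccirc_eps 2 0 2 isT).

Local Notation P := cochain_operad.

Lemma cosum_irrel (V : lmodType k) Q' us (f : seq U -> U -> V) :
  sweedler (Delta H) Q' -> mixed H f -> cosum Q us f = cosum Q' us f.
Proof.
move=> hQ'; elim: us f => [|u us IH] f fm; first by rewrite !cosum_nil.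
rewrite !cosum_contract IH; last exact: contract_mixed.
apply: eq_cosum => vs w; exact: (sweep_irrel u (mixed_balU vs w fm) hQ hQ').
Qed.

(** The operad is built from one choice of [Q] and [R], whereas its specification quantifies over
    all of them. *)
Lemma insert_irrel Q' R' f g us1 us2 us3 :
  sweedler (Delta H) Q' -> sweedler (yd_coact Y) R' ->
  cochainlike f -> cochainlike g ->
  insert Y Q R f g us1 us2 us3 = insert Y Q' R' f g us1 us2 us3.
Proof.
move=> hQ' hR' fC gC; rewrite /insert.
have B := outer_bal hQ us1 us3 fC; have M := dsum_mixed hQ hR gC B.
rewrite [LHS](cosum_irrel us2 hQ' M); apply: eq_cosum => vs w.
rewrite (sweep_irrel (g vs) (balN_mul w B) hR hR'); apply: eq_sweep => y n.
exact: (cosum_irrel us1 hQ' (mixed_append _ (nmul_mixed n fC))).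
Qed.

Lemma insertionE Q' R' p q (f : cochain p) (g : cochain q) us1 us2 us3 :
  insertion Q' R' f g us1 us2 us3 =
  insert Y Q' R' (ceval f) (ceval g) us1 us2 us3.
Proof.
rewrite insertE /insertion; apply: eq_bigr => c _.
rewrite /dterms big_allpairs_dep; apply: eq_bigr => c' _.
by apply: eq_bigr.
Qed.

Lemma cochain_operad_spec : is_cochain_operad P.
Proof.
split=> [p q i f g us1 us2 us3 ip e1 e2 e3 Q' hQ' R' hR'|u v|u|].
- rewrite insertionE -insert_irrel //; [|exact: ceval_cochainlike..].
  exact: ccircE.
- by rewrite [LHS]eps_cochainE // big_cons big_seq1.
- by rewrite [LHS]eps_cochainE // big_seq1.
- by rewrite [LHS]eps_cochainE // big_nil counit1 src1 Y1.
Qed.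

Lemma cevalN p (f : cochain p) us : ceval (- f) us = - ceval f us.
Proof. by []. Qed.
Lemma cevalD p (f g : cochain p) us : ceval (f + g) us = ceval f us + ceval g us.
Proof. by []. Qed.
Lemma ceval_sg p b (f : cochain p) us : ceval (sg b f) us = sg b (ceval f us).
Proof. by case: b. Qed.
Lemma ceval_sum p (I : Type) (r : seq I) (F : I -> cochain p) us :
  ceval (\sum_(i <- r) F i) us = \sum_(i <- r) ceval (F i) us.
Proof. exact: (lin_sum _ _ _ (ceval_linear (p := p) us)). Qed.

Lemma ceval_ccirc_mul p i (f : cochain p) us : size us = p.+1 -> (0 < i <= p)%N ->
  ceval (ccirc i f (eps_cochain 2)) us =
  ceval f (take i.-1 us ++ (us`_i.-1 * us`_i) :: drop i.+1 us).
Proof.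
move=> e; case: i => [//|i] ip /=.
have E : us = take i us ++ [:: us`_i; us`_i.+1] ++ drop i.+2 us.
  have d1 : drop i us = us`_i :: drop i.+1 us by apply: drop_nth; lia.
  have d2 : drop i.+1 us = us`_i.+1 :: drop i.+2 us by apply: drop_nth; lia.
  by rewrite -[LHS](cat_take_drop i us) d1 d2.
rewrite [in LHS]E ccirc_eps //.
- by rewrite big_cons big_seq1.
- by rewrite size_takel //; lia.
- by rewrite size_drop; lia.
Qed.

Lemma cochain_operad_delta p (f : cochain p) us : size us = p.+1 ->
  ceval (delta P f) us = hochschild_delta f us.
Proof.
move=> e; have mE u v : ceval (eps_cochain 2) [:: u; v] = Y (s (eps (u * v))) nu.
  by rewrite eps_cochainE // big_cons big_seq1.
have fC := ceval_cochainlike f.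
rewrite /delta ceval_regrade; last by lia.
rewrite /bracket cevalD cevalN /bcirc !sgn_degE !ceval_sg ceval_regrade; last by lia.
rewrite ceval_sg !ceval_sum [\sum_(1 <= i < 3) _]big_ltn // big_ltn // big_geq // addr0.
(* mu inserted in the cochain gives the inner terms; the cochain inserted in mu gives the outer
   ones, slot 2 the first and slot 1 the last. *)
have -> : \sum_(1 <= i < p.+1) ceval (sgn (deg 2 * deg i) *: circ P i f (omul P)) us =
    \sum_(1 <= i < p.+1) sg (odd i.+1)
      (ceval f (take i.-1 us ++ (us`_i.-1 * us`_i) :: drop i.+1 us)).
  apply: eq_big_nat => i ip; rewrite sgn_degE ceval_sg.
  by rewrite -[circ P i f _]/(ccirc i f (eps_cochain 2)) ceval_ccirc_mul.
rewrite !sgn_degE !ceval_sg sg_sg.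
have E2 : ceval (circ P 2 (omul P) f) us = Y us`_0 (ceval f (behead us)).
  case: us e => [//|u us] [e].
  have := @ccircE 2 p 2 (eps_cochain 2) f [:: u] us [::] isT erefl e erefl.
  by rewrite cats0 (insert_mul2 hQ hR mE).
rewrite {}E2 /hochschild_delta.
have signE n (x : N) : (-1) ^+ n *: x = sg (odd n) x.
  by rewrite -signr_odd; case: (odd n); rewrite ?expr1 ?scaleN1r ?expr0 ?scale1r.
have E1 us1 v : us = rcons us1 v -> ceval (circ P 1 (omul P) f) us =
    insert Y Q R (ceval (eps_cochain 2)) (ceval f) [::] us1 [:: v].
  move=> eu; have e1 : size us1 = p by move: e; rewrite eu size_rcons => -[].
  by rewrite -(@ccircE 2 p 1) //= eu cats1.
case/lastP: us e E1 => [//|us v] e /(_ us v erefl) ->.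
have {}e : size us = p by move: e; rewrite size_rcons => -[].
(* In degree 0 no argument precedes v to absorb eps(v), which acts on the value instead. *)
case: p f fC e => [|p] f fC e.
  rewrite (size0nil e) (insert_mul1_nil Q hR mE) big_geq //=.
  by rewrite subr0 opprB.
pose F i := ceval f (take i.-1 (rcons us v) ++
  ((rcons us v)`_i.-1 * (rcons us v)`_i) :: drop i.+1 (rcons us v)).
have -> : \sum_(1 <= i < p.+2) sg (odd i.+1) (F i) =
    - \sum_(1 <= i < p.+2) sg (odd i) (F i).
  by rewrite -sumrN; apply: eq_bigr => i _; rewrite /=; case: (odd i) => //=; rewrite opprK.
have -> : \sum_(1 <= i < p.+2) (-1) ^+ i *: F i = \sum_(1 <= i < p.+2) sg (odd i) (F i).
  by apply: eq_bigr => i _; rewrite signE.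
have -> : take p.+1.-1 (rcons us v) ++
    [:: (rcons us v)`_p.+1.-1 * t (eps (rcons us v)`_p.+1)] =
    take p us ++ [:: us`_p * t (eps v)].
  by rewrite /= -cats1 !nth_cat e ltnn subnn ltnSn takel_cat // e.
have -> : insert Y Q R (ceval (eps_cochain 2)) (ceval f) [::] us [:: v] =
    ceval f (take p us ++ [:: us`_p * t (eps v)]).
  case/lastP: us e F => [//|us u] e F; move: e; rewrite size_rcons => -[e].
  rewrite (insert_mul1 hQ hR mE) //.
  by rewrite -cats1 take_size_cat // nth_cat e ltnn subnn.
rewrite signE /=.
by case: (odd p) => /=; zmod_eq.
Qed.

End Operad.

End CochainOperad.

Theorem theorem1p3 (k : comNzRingType) (A U : algType k)
    (H : left_bialgebroid A U) (N : lmodType k) (Y : yd_algebra H N)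
    (HY : braided_commutative Y) :
  exists P : operad_mult (cochain Y),
    [/\ is_cochain_operad P,
        forall (p : nat) (phi : cochain Y p) (us : seq U), size us = p.+1 ->
          ceval (delta P phi) us = hochschild_delta phi us,
        forall (p : nat) (phi : cochain Y p), delta P (delta P phi) = 0
      & exists G : gerstenhaber (cohomology P), induced_gerstenhaber G].
Proof.
have [Q hQ] := sweedler_exists (Delta H).
have [R hR] := sweedler_exists (yd_coact Y).
exists (cochain_operad hQ hR HY); split.
- exact: cochain_operad_spec.
- exact: cochain_operad_delta.
- exact: delta_delta.
- exists (cohomology_gerstenhaber (cochain_operad hQ hR HY)).
  exact: cohomology_gerstenhaber_induced.
Qed.
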